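(* Let $\mathfrak g$ be a finitary Lie algebra which is a union of reductive subalgebras. Then there exist Lie algebras $\mathfrak g_i$, each isomorphic to $\mathfrak{gl}_\infty$, $\mathfrak{so}_\infty$, $\mathfrak{sp}_\infty$, or a finite-dimensional simple Lie algebra, and an injective homomorphism $\varphi:\mathfrak g\hookrightarrow\mathfrak z(\mathfrak g)\oplus\bigoplus_i\mathfrak g_i$ such that $\varphi|_{\mathfrak z(\mathfrak g)}=\mathrm{id}$ (onto the summand $\mathfrak z(\mathfrak g)$) and $\varphi([\mathfrak g,\mathfrak g])=\bigoplus_i[\mathfrak g_i,\mathfrak g_i]$.
   Context: Ground field $\mathbb C$; Lie algebras of at most countable dimension. A locally finite Lie algebra is finitary if it admits a faithful representation with a basis in which all its elements act by finite matrices (equivalently, it embeds into $\mathfrak{gl}_\infty$). A Lie algebra is a union of reductive subalgebras if it is the union of nested finite-dimensional reductive Lie subalgebras $\mathfrak g_1\subset\mathfrak g_2\subset\cdots$. $\mathfrak z(\mathfrak g)$ is the center. $\mathfrak{gl}_\infty=\mathfrak{gl}(V,V_* )$ is the Lie algebra of $V\otimes V_*$ for countable-dimensional $V,V_*$ with nondegenerate pairing, product $(v\otimes w)(v'\otimes w')=\langle v',w\rangle v\otimes w'$; $\mathfrak{so}_\infty=\bigwedge^2V\subset\mathfrak{gl}(V,V)$ for a nondegenerate symmetric form on $V$; $\mathfrak{sp}_\infty=\mathrm{Sym}^2V\subset\mathfrak{gl}(V,V)$ for a nondegenerate antisymmetric form. *)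

(* Defs.v *)
(* Lie algebras over an algebraically closed field of
   characteristic 0 (standing in for C), realised as an lmodType with a bracket. *)
From HB Require Import structures.
From mathcomp Require Import all_boot all_algebra.
Set Implicit Arguments. Unset Strict Implicit. Unset Printing Implicit Defensive.
Import GRing.Theory.
Local Open Scope ring_scope.

Section LieDefs.
Variables (F : fieldType) (L : lmodType F) (br : L -> L -> L).

Definition lie_axioms : Prop :=
  (forall a x y z, br (a *: x + y) z = a *: br x z + br y z) /\
  (forall a x y z, br z (a *: x + y) = a *: br z x + br z y) /\
  (forall x, br x x = 0) /\
  (forall x y z, br x (br y z) + br y (br z x) + br z (br x y) = 0).

Definition span (P : L -> Prop) (x : L) : Prop :=
  exists n (v : 'I_n -> L) (c : 'I_n -> F),
    (forall i, P (v i)) /\ x = \sum_(i < n) c i *: v i.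

Definition subspace (S : L -> Prop) : Prop :=
  S 0 /\ forall a x y, S x -> S y -> S (a *: x + y).

Definition fin_dim (S : L -> Prop) : Prop :=
  exists n (v : 'I_n -> L), forall x, S x <-> exists c : 'I_n -> F, x = \sum_(i < n) c i *: v i.

Definition subalg (S : L -> Prop) : Prop :=
  subspace S /\ forall x y, S x -> S y -> S (br x y).

Definition ideal_in (H J : L -> Prop) : Prop :=
  subspace J /\ (forall x, J x -> H x) /\ forall x y, H x -> J y -> J (br x y).

Definition derived_set (S : L -> Prop) : L -> Prop :=
  span (fun z => exists x y, S x /\ S y /\ z = br x y).

Definition solvable (S : L -> Prop) : Prop :=
  exists k, forall x, iter k derived_set S x -> x = 0.

Definition center_in (H : L -> Prop) (x : L) : Prop :=
  H x /\ forall y, H y -> br y x = 0.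

(* reductive: radical = center, i.e. every solvable ideal lies in the center *)
Definition reductive (H : L -> Prop) : Prop :=
  forall J, ideal_in H J -> solvable J -> forall x, J x -> center_in H x.

Definition union_of_reductive : Prop :=
  exists h : nat -> L -> Prop,
    (forall n, fin_dim (h n) /\ subalg (h n) /\ reductive (h n)) /\
    (forall n x, h n x -> h n.+1 x) /\
    (forall x, exists n, h n x).

Definition center (x : L) : Prop := forall y, br y x = 0.

Definition derived : L -> Prop := derived_set (fun _ => True).

Definition fd_simple : Prop :=
  fin_dim (fun _ => True) /\ (exists x y, br x y <> 0) /\
  forall J, ideal_in (fun _ => True) J -> (forall x, J x -> x = 0) \/ (forall x, J x).

Definition fsupp_lt (N : nat) (A : nat -> nat -> F) : Prop :=
  forall i j, (N <= i)%N \/ (N <= j)%N -> A i j = 0.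

Definition fsupp (A : nat -> nat -> F) : Prop := exists N, fsupp_lt N A.

Definition mmul (N : nat) (A B : nat -> nat -> F) (i j : nat) : F :=
  \sum_(k < N) A i k * B k j.

Definition mat_lie_hom (f : L -> nat -> nat -> F) : Prop :=
  (forall a x y i j, f (a *: x + y) i j = a * f x i j + f y i j) /\
  (forall x, fsupp (f x)) /\
  (forall x y N, fsupp_lt N (f x) -> fsupp_lt N (f y) ->
     forall i j, f (br x y) i j = mmul N (f x) (f y) i j - mmul N (f y) (f x) i j).

Definition finitary : Prop :=
  exists f, mat_lie_hom f /\ injective f.

Definition iso_to_mat (P : (nat -> nat -> F) -> Prop) : Prop :=
  exists f, mat_lie_hom f /\ injective f /\ (forall x, P (f x)) /\
    (forall A, fsupp A -> P A -> exists x, forall i j, f x i j = A i j).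

Definition is_gl_inf : Prop := iso_to_mat (fun _ => True).

(* so_infty: form with orthonormal basis e_0, e_1, ... *)
Definition is_so_inf : Prop := iso_to_mat (fun A => forall i j, A j i = - A i j).

(* sp_infty: symplectic form with w(e_2m, e_2m+1) = 1 = -w(e_2m+1, e_2m) *)
Definition partner (k : nat) : nat := if odd k then k.-1 else k.+1.
Definition psign (k : nat) : F := if odd k then -1 else 1.
Definition is_sp_inf : Prop :=
  iso_to_mat (fun A => forall i j, psign i * A (partner i) j = psign j * A (partner j) i).

End LieDefs.

(* Main.v *)
(* Let f be a faithful representation of L by finitary matrices and BB the associative algebra
   spanned by the products of elements of f(L). On every ideal inside S = [L, L] the trace form
   of f is nondegenerate (Cartan's criterion, applied in the reductive subalgebras), so each
   nonzero ideal X of L in S produces an idempotent e in BB f(X) BB of minimal trace, and e is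
   primitive: tr(e p e q) tr(e) = tr(e p) tr(e q). The elements x with tr(e BB f(x) BB) = 0 form
   an ideal K_e, and only finitely many inequivalent primitive e have a given x outside K_e,
   whence minimal ideals exist and each x acts nontrivially on finitely many of them only.

   For a minimal ideal Y not in K_e, either L / K_e is finite-dimensional and Y is simple, or BB e
   gives a representation g with kernel K_e whose associative envelope contains all matrix units.
   In that case consider the relation between products w_1 ... w_k and (-1)^k w_k ... w_1 of
   elements of g(L). If it is not a function, g(Y) consists of all traceless matrices, and g is the
   required map to gl_infinity; if it is, it is an involution of the algebra of finitary matrices,
   g(Y) is the set of its skew elements, and Gram-Schmidt identifies it with so_infinity or
   sp_infinity. In the last cases, as in the simple one, L acts on Y by inner derivations, which
   defines the map L -> Y. *)
From Pilot Require Import Defs.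
From HB Require Import structures.
From mathcomp Require Import all_boot all_order all_algebra.
From mathcomp Require Import ring zify boolp functions.
Set Implicit Arguments. Unset Strict Implicit. Unset Printing Implicit Defensive.
Import Order.TTheory GRing.Theory Num.Theory.
Local Open Scope ring_scope.
Notation lspan := Pilot.Defs.span.

(** * Finitary matrices *)

Section SubLmod.
Variables (F : fieldType) (V : lmodType F).

(** Commutators are turned into one-sided products by elements x of an ideal for which g(x) vanishes
    on a large square block. If g(s_1), ..., g(s_k) are supported in that block, every term with
    g(x) between two of them vanishes, so [s_1, [..., [s_k, x]]] is sent to g(s_1) ... g(s_k) g(x) +
    (-1)^k g(x) g(s_k) ... g(s_1). This is the origin of the signed reversal. Products of two such
    elements must survive as the block grows: some fixed entry of g(z) g(z') has to be nonzero for
    arbitrarily large blocks. Otherwise double commutators have finite rank on the ideal modulo ker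
    g, and a nonzero finite-dimensional subspace of g(L) stable under g(L) arises, which the matrix
    units exclude. Traces do the rest. In characteristic 0 the trace of an idempotent is its rank,
    so a minimal one exists; nilpotents have trace 0, so tr(e p q) / tr(e) sees only the simple
    module of e and no quotient by a radical has to be formed. Finiteness is a rank count: k
    inequivalent idempotents that detect x yield a matrix of bounded rank with k distinct nonzero
    eigenvalues. *)

Record subsp := Subsp { sp_pred :> V -> Prop; sp_ok : subspace sp_pred }.

Definition sp_mem (p : subsp) : pred V := fun x => `[< p x >].

(** A predicate subspace becomes a module of its own. This carries the finitary matrices, and later
    a minimal ideal, or the finitary matrices inside [emx], when these serve as Lie algebras
    [G i]. *)
Record sub_lmod (p : subsp) := SubLmod { sl_val :> V; _ : sp_mem p sl_val }.

HB.instance Definition _ p := [isSub for @sl_val p].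
HB.instance Definition _ p := [Choice of sub_lmod p by <:].

Lemma sp_mem_closed p : subsemimod_closed (sp_mem p).
Proof.
have [P0 PD] := sp_ok p; split; first split.
- exact/asboolP.
- move=> x y /asboolP Px /asboolP Py; apply/asboolP => /=.
  rewrite -[x]scale1r; exact: PD.
- move=> a x /asboolP Px; apply/asboolP.
  rewrite -[a *: x]addr0; exact: PD.
Qed.

HB.instance Definition _ p :=
  GRing.SubChoice_isSubLmodule.Build F V (sp_mem p) (sub_lmod p) (sp_mem_closed p).

Lemma sl_valP p (x : sub_lmod p) : p (sl_val x).
Proof. by case: x => x px; apply/asboolP. Qed.

Definition sl_mk (p : subsp) (x : V) (px : p x) : sub_lmod p :=
  SubLmod (introT (asboolP _) px).

Lemma sl_inj p : injective (@sl_val p).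
Proof. exact: val_inj. Qed.

Lemma sl_lin p a (x y : sub_lmod p) : sl_val (a *: x + y) = a *: sl_val x + sl_val y.
Proof. exact: (linearP (\val : sub_lmod p -> V)). Qed.

Lemma sl_0 p : sl_val (0 : sub_lmod p) = 0.
Proof. exact: (linear0 (\val : sub_lmod p -> V)). Qed.
End SubLmod.

Section FinitaryMatrices.
Variable F : fieldType.

Lemma fsupp_subspace : subspace (fun A : nat -> nat -> F^o => fsupp (A : nat -> nat -> F)).
Proof.
split; first by exists 0%N.
move=> a A B [N HA] [M HB]; exists (maxn N M) => i j H.
have HN : (N <= i)%N \/ (N <= j)%N.
  by case: H => H; [left|right]; apply: leq_trans H; rewrite leq_maxl.
have HM : (M <= i)%N \/ (M <= j)%N.
  by case: H => H; [left|right]; apply: leq_trans H; rewrite leq_maxr.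
by rewrite !fctE HA // HB // scaler0 addr0.
Qed.

Definition fmx := sub_lmod (Subsp fsupp_subspace).
HB.instance Definition _ := GRing.Lmodule.on fmx.

Definition fent (A : fmx) (i j : nat) : F := sl_val A i j.
Arguments fent : simpl never.

Lemma fentP (A : fmx) : fsupp (fent A). Proof. exact: (sl_valP A). Qed.

Definition mkf (A : nat -> nat -> F) (HA : fsupp A) : fmx :=
  @sl_mk _ _ (Subsp fsupp_subspace) A HA.

Lemma fent_ext A B : (forall i j, fent A i j = fent B i j) -> A = B.
Proof. by move=> H; apply: sl_inj; apply/funext => i; apply/funext => j; exact: H. Qed.

Lemma fent_lin c A B i j : fent (c *: A + B) i j = c * fent A i j + fent B i j.
Proof. by rewrite /fent sl_lin !fctE. Qed.

Definition fbnd (A : fmx) : nat := projT1 (cid (fentP A)).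
Lemma fbndP A : fsupp_lt (fbnd A) (fent A).
Proof. by rewrite /fbnd; case: cid. Qed.
Arguments fbndP : clear implicits.

Lemma sum_widen (V : zmodType) N M (G : nat -> V) :
  (forall k, (N <= k)%N -> G k = 0) -> (forall k, (M <= k)%N -> G k = 0) ->
  \sum_(k < N) G k = \sum_(k < M) G k.
Proof.
wlog le : N M / (N <= M)%N => [hw|] HN HM.
  by case/orP: (leq_total N M) => le; [|symmetry]; exact: hw.
rewrite (big_ord_widen _ G le) big_mkcond /=; apply: eq_bigr => k _.
by case: ltnP => // /HN ->.
Qed.

(** The infinite sum over k is cut at a chosen bound of the support of [A]; by [fmul_funE] every
    bound beyond which the terms vanish gives the same value, so nothing depends on the choice. *)
Definition fmul_fun (A B : fmx) i j : F := \sum_(k < fbnd A) fent A i k * fent B k j.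

Lemma fmul_funE N A B i j : (forall k, (N <= k)%N -> fent A i k * fent B k j = 0) ->
  fmul_fun A B i j = \sum_(k < N) fent A i k * fent B k j.
Proof.
move=> HN; apply: (@sum_widen F^o _ _ (fun k => fent A i k * fent B k j)) => // k Hk.
by rewrite (fbndP A) ?mul0r //; right.
Qed.

Lemma fmul_fsupp A B : fsupp (fmul_fun A B).
Proof.
exists (maxn (fbnd A) (fbnd B)) => i j H; apply: big1 => k _.
case: H => H; [rewrite (fbndP A) ?mul0r // | rewrite (fbndP B) ?mulr0 //].
- by left; apply: leq_trans H; rewrite leq_maxl.
- by right; apply: leq_trans H; rewrite leq_maxr.
Qed.

Definition fmul A B : fmx := mkf (fmul_fsupp A B).

Lemma fmulEl N A B i j : fsupp_lt N (fent A) ->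
  fent (fmul A B) i j = \sum_(k < N) fent A i k * fent B k j.
Proof. by move=> HA; apply: fmul_funE => k Hk; rewrite HA ?mul0r //; right. Qed.

Lemma fmulEr N A B i j : fsupp_lt N (fent B) ->
  fent (fmul A B) i j = \sum_(k < N) fent A i k * fent B k j.
Proof. by move=> HA; apply: fmul_funE => k Hk; rewrite HA ?mulr0 //; left. Qed.

Lemma fmulA : associative fmul.
Proof.
move=> A B C; apply: fent_ext => i j.
rewrite (fmulEl _ _ _ (fbndP A)) (fmulEr _ _ _ (fbndP C)).
under eq_bigr => k _ do rewrite (fmulEr _ _ _ (fbndP C)) mulr_sumr.
rewrite exchange_big /=; apply: eq_bigr => k _.
rewrite (fmulEl _ _ _ (fbndP A)) mulr_suml.
by apply: eq_bigr => l _; rewrite mulrA.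
Qed.

Lemma fmul_linl c A B C : fmul (c *: A + B) C = c *: fmul A C + fmul B C.
Proof.
apply: fent_ext => i j; rewrite fent_lin !(fmulEr _ _ _ (fbndP C)) mulr_sumr -big_split /=.
by apply: eq_bigr => k _; rewrite fent_lin mulrDl mulrA.
Qed.

Lemma fmul_linr c A B C : fmul C (c *: A + B) = c *: fmul C A + fmul C B.
Proof.
apply: fent_ext => i j; rewrite fent_lin !(fmulEl _ _ _ (fbndP C)) mulr_sumr -big_split /=.
by apply: eq_bigr => k _; rewrite fent_lin mulrDr !mulrA [c * _]mulrC.
Qed.

Lemma fmulDl A B C : fmul (A + B) C = fmul A C + fmul B C.
Proof. by rewrite -[A in LHS]scale1r fmul_linl scale1r. Qed.
Lemma fmulDr A B C : fmul C (A + B) = fmul C A + fmul C B.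
Proof. by rewrite -[A in LHS]scale1r fmul_linr scale1r. Qed.
Lemma fmul0l C : fmul 0 C = 0.
Proof. by apply: (addrI (fmul 0 C)); rewrite -fmulDl !addr0. Qed.
Lemma fmul0r C : fmul C 0 = 0.
Proof. by apply: (addrI (fmul C 0)); rewrite -fmulDr !addr0. Qed.
Lemma fmulZl c A C : fmul (c *: A) C = c *: fmul A C.
Proof. by rewrite -[c *: A]addr0 fmul_linl fmul0l addr0. Qed.
Lemma fmulZr c A C : fmul C (c *: A) = c *: fmul C A.
Proof. by rewrite -[c *: A]addr0 fmul_linr fmul0r addr0. Qed.

(* Finitary matrices with a unit adjoined: (c, A) stands for c + A. *)
Definition emx : Type := (F^o * fmx)%type.
HB.instance Definition _ := GRing.Lmodule.copy emx (F^o * fmx)%type.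

Definition emx_mul (a b : emx) : emx := (a.1 * b.1, a.1 *: b.2 + b.1 *: a.2 + fmul a.2 b.2).
Definition emx_one : emx := (1, 0).

Lemma emx_mulA : associative emx_mul.
Proof.
move=> [a A] [b B] [c C]; rewrite /emx_mul /= !mulrA; congr pair.
rewrite !fmulDl !fmulDr !fmulZl !fmulZr fmulA !scalerDr !scalerA -!addrA.
by rewrite [c * a]mulrC [c * b]mulrC !addrA [LHS](ACl (1*2*4*6*3*5*7)).
Qed.
Lemma emx_mul1l : left_id emx_one emx_mul.
Proof. by move=> [b B]; rewrite /emx_mul /= mul1r scaler0 scale1r fmul0l !addr0. Qed.
Lemma emx_mul1r : right_id emx_one emx_mul.
Proof. by move=> [b B]; rewrite /emx_mul /= mulr1 scaler0 scale1r fmul0r add0r addr0. Qed.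
Lemma emx_mulDl : left_distributive emx_mul +%R.
Proof.
move=> [a A] [b B] [c C]; rewrite /emx_mul /=; congr pair; rewrite ?mulrDl //=.
by rewrite fmulDl scalerDl scalerDr !addrA [LHS](ACl (1*3*5*2*4*6)).
Qed.
Lemma emx_mulDr : right_distributive emx_mul +%R.
Proof.
move=> [a A] [b B] [c C]; rewrite /emx_mul /=; congr pair; rewrite ?mulrDr //=.
by rewrite fmulDr scalerDl scalerDr !addrA [LHS](ACl (1*3*5*2*4*6)).
Qed.
Lemma emx_1neq0 : emx_one != 0.
Proof. by apply/eqP => -[] /eqP; rewrite oner_eq0. Qed.

HB.instance Definition _ := GRing.Zmodule_isNzRing.Build emx
  emx_mulA emx_mul1l emx_mul1r emx_mulDl emx_mulDr emx_1neq0.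

Lemma emx_scaleAl (k : F) (a b : emx) : k *: (a * b) = (k *: a) * b.
Proof.
case: a b => [a A] [b B].
change ((k * (a * b), k *: (a *: B + b *: A + fmul A B)) =
        ((k * a) * b, (k * a) *: B + b *: (k *: A) + fmul (k *: A) B) :> emx).
by rewrite fmulZl !scalerDr !scalerA mulrA [b * k]mulrC.
Qed.
HB.instance Definition _ := GRing.Lmodule_isLalgebra.Build F emx emx_scaleAl.
Lemma emx_scaleAr (k : F) (a b : emx) : k *: (a * b) = a * (k *: b).
Proof.
case: a b => [a A] [b B].
change ((k * (a * b), k *: (a *: B + b *: A + fmul A B)) =
        (a * (k * b), a *: (k *: B) + (k * b) *: A + fmul A (k *: B)) :> emx).
by rewrite fmulZr !scalerDr !scalerA mulrCA [a * k]mulrC.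
Qed.
HB.instance Definition _ := GRing.Lalgebra_isAlgebra.Build F emx emx_scaleAr.

(** The finitary matrices form the ideal of zero scalar part in [emx]. Both [ent] and [tr] ignore
    the scalar part: they are linear on all of [emx], and [tr] is still cyclic there, but only a
    [fin] element is determined by its entries. *)
Definition fin (a : emx) : Prop := a.1 = 0.
Definition ent (a : emx) (i j : nat) : F := fent a.2 i j.
Definition bounded N (a : emx) : Prop := fin a /\ fsupp_lt N (ent a).

Lemma ent_lin c a b i j : ent (c *: a + b) i j = c * ent a i j + ent b i j.
Proof. exact: fent_lin. Qed.
Lemma entD a b i j : ent (a + b) i j = ent a i j + ent b i j.
Proof. by rewrite -[a]scale1r ent_lin mul1r scale1r. Qed.
Lemma ent0 i j : ent 0 i j = 0. Proof. by []. Qed.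
Lemma entZ c a i j : ent (c *: a) i j = c * ent a i j.
Proof. by rewrite -[c *: a]addr0 ent_lin ent0 addr0. Qed.
Lemma entN a i j : ent (- a) i j = - ent a i j.
Proof. by rewrite -scaleN1r entZ mulN1r. Qed.
Lemma entB a b i j : ent (a - b) i j = ent a i j - ent b i j.
Proof. by rewrite entD entN. Qed.
Lemma ent_sum (I : Type) (r : seq I) (P : pred I) (G : I -> emx) i j :
  ent (\sum_(k <- r | P k) G k) i j = \sum_(k <- r | P k) ent (G k) i j.
Proof. by apply: (big_morph (fun a => ent a i j)) => // a b; exact: entD. Qed.

Lemma fin_sub : subspace fin.
Proof.
split=> // c a b; rewrite /fin /= => -> ->.
by rewrite addr0 -[_ *: _]/(c * 0) mulr0.
Qed.
Lemma fin_mull a b : fin a -> fin (a * b).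
Proof. by rewrite /fin /= => ->; rewrite mul0r. Qed.
Lemma fin_mulr a b : fin b -> fin (a * b).
Proof. by rewrite /fin /= => ->; rewrite mulr0. Qed.

Lemma ent_ext a b : fin a -> fin b -> (forall i j, ent a i j = ent b i j) -> a = b.
Proof.
case: a b => [a A] [b B]; rewrite /fin /= => -> -> H.
by congr pair; exact: fent_ext.
Qed.

Lemma fin_bounded a : fin a -> exists N, bounded N a.
Proof. by move=> fa; have [N HN] := fentP a.2; exists N. Qed.

Lemma bounded_le N M a : (N <= M)%N -> bounded N a -> bounded M a.
Proof.
move=> le [fa Ha]; split=> // i j H; apply: Ha.
by case: H => H; [left|right]; exact: leq_trans H.
Qed.

Lemma bounded_sub N : subspace (bounded N).
Proof.
split; first by split.
move=> c a b [fa Ha] [fb Hb]; split; first exact: (proj2 fin_sub).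
by move=> i j H; rewrite ent_lin Ha // Hb // mulr0 addr0.
Qed.

Lemma fin_mx (A : nat -> nat -> F) : fsupp A -> exists2 a, fin a & ent a = A.
Proof. by move=> HA; exists (0, mkf HA). Qed.

Lemma ent_mull N a b i j : bounded N a -> fin b ->
  ent (a * b) i j = \sum_(k < N) ent a i k * ent b k j.
Proof.
case: a b => [a A] [b B]; rewrite /bounded /fin /= => -[-> HA] ->.
by rewrite /ent /= !scale0r !add0r (fmulEl _ _ _ HA).
Qed.
Lemma ent_mulr N a b i j : fin a -> bounded N b ->
  ent (a * b) i j = \sum_(k < N) ent a i k * ent b k j.
Proof.
case: a b => [a A] [b B]; rewrite /bounded /fin /= => -> [-> HB].
by rewrite /ent /= !scale0r !add0r (fmulEr _ _ _ HB).
Qed.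

Lemma bounded_mul N a b : bounded N a -> bounded N b -> bounded N (a * b).
Proof.
move=> Ha Hb; split; first exact: fin_mull (proj1 Ha).
move=> i j H; rewrite (ent_mull _ _ Ha (proj1 Hb)); apply: big1 => k _.
case: H => H.
  by rewrite (proj2 Ha) ?mul0r //; left.
by rewrite (proj2 Hb) ?mulr0 //; right.
Qed.

Definition trunc N (a : emx) : 'M[F]_N := \matrix_(i, j) ent a i j.

Lemma trunc_lin N : linear (trunc N).
Proof. by move=> c a b; apply/matrixP => i j; rewrite !mxE ent_lin. Qed.
HB.instance Definition _ N := GRing.isLinear.Build F emx 'M[F]_N _ (trunc N) (trunc_lin N).

Lemma trunc_mull N a b : bounded N a -> fin b -> trunc N (a * b) = trunc N a *m trunc N b.
Proof.
move=> Ha fb; apply/matrixP => i j; rewrite !mxE (ent_mull _ _ Ha fb).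
by apply: eq_bigr => k _; rewrite !mxE.
Qed.
Lemma trunc_inj N a b : bounded N a -> bounded N b -> trunc N a = trunc N b -> a = b.
Proof.
move=> [fa Ha] [fb Hb] /matrixP H; apply: ent_ext => // i j.
case: (ltnP i N) => Hi; last by rewrite Ha ?Hb //; left.
case: (ltnP j N) => Hj; last by rewrite Ha ?Hb //; right.
by have := H (Ordinal Hi) (Ordinal Hj); rewrite !mxE.
Qed.

Definition tr (a : emx) : F := \sum_(i < fbnd a.2) ent a i i.

Lemma trE_fsupp N a : fsupp_lt N (ent a) -> tr a = \sum_(i < N) ent a i i.
Proof.
move=> H; apply: (@sum_widen F^o _ _ (fun i => ent a i i)) => k Hk.
  by apply: fbndP; left.
by apply: H; left.
Qed.

Lemma trE N a : bounded N a -> tr a = \tr (trunc N a).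
Proof.
by case=> _ H; rewrite (trE_fsupp H); apply: eq_bigr => i _; rewrite mxE.
Qed.

Lemma tr_lin c a b : tr (c *: a + b) = c * tr a + tr b.
Proof.
pose N := maxn (fbnd a.2) (fbnd b.2).
have Ha : fsupp_lt N (ent a).
  by move=> i j H; apply: fbndP; case: H => H; [left|right]; apply: leq_trans H; rewrite leq_maxl.
have Hb : fsupp_lt N (ent b).
  by move=> i j H; apply: fbndP; case: H => H; [left|right]; apply: leq_trans H; rewrite leq_maxr.
rewrite (trE_fsupp Ha) (trE_fsupp Hb) (@trE_fsupp N).
  by rewrite mulr_sumr -big_split; apply: eq_bigr => i _; rewrite ent_lin.
by move=> i j H; rewrite ent_lin Ha // Hb // mulr0 addr0.
Qed.
HB.instance Definition _ := GRing.isLinear.Build F emx F^o _ tr tr_lin.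

Lemma trC a b : tr (a * b) = tr (b * a).
Proof.
pose em (c : F) (A : fmx) : emx := (c, A).
suff H (A B : fmx) : tr (em 0 (fmul A B)) = tr (em 0 (fmul B A)).
  case: a b => [a A] [b B].
  have E c C D : tr (em c (C + D)) = tr (em 0 C) + tr (em 0 D).
    exact: (linearD tr (em 0 C) (em 0 D)).
  change (tr (em (a * b) (a *: B + b *: A + fmul A B)) =
          tr (em (b * a) (b *: A + a *: B + fmul B A))).
  by rewrite E H [a *: B + _]addrC -(E (b * a)) .
have [N [HA HB]] : exists N, fsupp_lt N (fent A) /\ fsupp_lt N (fent B).
  exists (maxn (fbnd A) (fbnd B)); split=> i j H; apply: fbndP;
    by case: H => H; [left|right]; apply: leq_trans H; rewrite ?leq_maxl ?leq_maxr.
have bA : bounded N (em 0 A) by [].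
have bB : bounded N (em 0 B) by [].
have E C D : em 0 (fmul C D) = em 0 C * em 0 D.
  change (em 0 (fmul C D) = em (0 * 0) (0 *: D + 0 *: C + fmul C D)).
  by rewrite mulr0 !scale0r !add0r.
rewrite !E (trE (bounded_mul bA bB)) (trE (bounded_mul bB bA)).
by rewrite (trunc_mull bA (proj1 bB)) (trunc_mull bB (proj1 bA)) mxtrace_mulC.
Qed.

Definition eu_fun (i j k l : nat) : F := ((k == i) && (l == j))%:R.
Lemma eu_fsupp i j : fsupp (eu_fun i j).
Proof.
exists (maxn i j).+1 => k l H; rewrite /eu_fun.
case: eqP => //= Ek; case: eqP => //= El; subst.
by case: H; rewrite ltnNge ?leq_maxl ?leq_maxr.
Qed.
Definition eu i j : emx := (0, mkf (eu_fsupp i j)).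

Lemma fin_eu i j : fin (eu i j). Proof. by []. Qed.
Lemma ent_eu i j k l : ent (eu i j) k l = ((k == i) && (l == j))%:R. Proof. by []. Qed.
Lemma bounded_eu N i j : (i < N)%N -> (j < N)%N -> bounded N (eu i j).
Proof.
move=> Hi Hj; split=> // k l H; rewrite ent_eu.
case: eqP => //= Ek; case: eqP => //= El; subst.
by case: H; rewrite leqNgt ?Hi ?Hj.
Qed.

Lemma ent_eul i p a k l : fin a -> ent (eu i p * a) k l = (k == i)%:R * ent a p l.
Proof.
move=> fa; pose N := (maxn i p).+1.
have b : bounded N (eu i p) by apply: bounded_eu; rewrite ltnS ?leq_maxl ?leq_maxr.
rewrite (ent_mull _ _ b fa).
have Hp : (p < N)%N by rewrite ltnS leq_maxr.
rewrite (bigD1 (Ordinal Hp)) //= big1 ?addr0; first by rewrite ent_eu eqxx andbT.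
by move=> q /negP Hq; rewrite ent_eu; case: eqP => // _; case: eqP => [E|_]; rewrite ?mul0r //;
   case: Hq; apply/eqP; apply: val_inj.
Qed.
Lemma ent_eur i p a k l : fin a -> ent (a * eu p i) k l = ent a k p * (l == i)%:R.
Proof.
move=> fa; pose N := (maxn i p).+1.
have b : bounded N (eu p i) by apply: bounded_eu; rewrite ltnS ?leq_maxl ?leq_maxr.
rewrite (ent_mulr _ _ fa b).
have Hp : (p < N)%N by rewrite ltnS leq_maxr.
rewrite (bigD1 (Ordinal Hp)) //= big1 ?addr0; first by rewrite ent_eu eqxx.
by move=> q /negP Hq; rewrite ent_eu; case: eqP => [E|_]; rewrite ?mulr0 //;
   case: Hq; apply/eqP; apply: val_inj.
Qed.

Lemma eu_sandwich i p q j a : fin a -> eu i p * a * eu q j = ent a p q *: eu i j.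
Proof.
move=> fa; apply: ent_ext.
- by apply: fin_mulr.
- by rewrite -[_ *: _]addr0; apply: (proj2 fin_sub).
move=> k l; rewrite ent_eur; last exact: fin_mull.
rewrite ent_eul // entZ ent_eu.
by case: (k == i); case: (l == j); rewrite /= ?(mulr0, mul0r, mulr1, mul1r).
Qed.

Lemma eu_mul i j k l : eu i j * eu k l = (j == k)%:R *: eu i l.
Proof.
apply: ent_ext; first by apply: fin_mull.
  by rewrite -[_ *: _]addr0; apply: (proj2 fin_sub).
move=> p q; rewrite ent_eul // entZ !ent_eu.
by case: (p == i); case: (q == l); case: (j == k); rewrite /= ?(mulr0, mul0r, mulr1, mul1r).
Qed.

Lemma eu_decomp N a : bounded N a -> a = \sum_(i < N) \sum_(j < N) ent a i j *: eu i j.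
Proof.
move=> b; apply: (@trunc_inj N) => //.
  apply: (big_ind (bounded N)); first exact: (proj1 (bounded_sub N)).
    by move=> x y bx ky; rewrite -[x]scale1r; apply: (proj2 (bounded_sub N)).
  move=> i _; apply: (big_ind (bounded N)); first exact: (proj1 (bounded_sub N)).
    by move=> x y bx ky; rewrite -[x]scale1r; apply: (proj2 (bounded_sub N)).
  move=> j _; rewrite -[_ *: _]addr0; apply: (proj2 (bounded_sub N)).
    by apply: bounded_eu.
  exact: (proj1 (bounded_sub N)).
rewrite linear_sum /= [LHS]matrix_sum_delta; apply: eq_bigr => i _.
rewrite linear_sum /=; apply: eq_bigr => j _.
rewrite linearZ /= mxE; congr (_ *: _); apply/matrixP => k l.
by rewrite !mxE.
Qed.

(** The truncated identity is a unit for matrices bounded by [N]; sandwiching with it cuts out the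
    upper left block. *)
Definition eid N : emx := \sum_(i < N) eu i i.

Lemma bounded_eid N : bounded N (eid N).
Proof.
apply: (big_ind (bounded N)); first exact: (proj1 (bounded_sub N)).
  by move=> x y bx ky; rewrite -[x]scale1r; apply: (proj2 (bounded_sub N)).
by move=> i _; apply: bounded_eu.
Qed.

Lemma ent_eidl N a i j : fin a -> ent (eid N * a) i j = if (i < N)%N then ent a i j else 0.
Proof.
move=> fa; rewrite mulr_suml ent_sum.
case: ltnP => Hi; last first.
  apply: big1 => k _; rewrite ent_eul //; case: eqP => [E|_]; rewrite ?mul0r //.
  by move: Hi; rewrite E leqNgt ltn_ord.
rewrite (bigD1 (Ordinal Hi)) //= big1 ?addr0; first by rewrite ent_eul // eqxx mul1r.
move=> k /negP Hk; rewrite ent_eul //; case: eqP => [E|_]; rewrite ?mul0r //.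
by case: Hk; apply/eqP; apply: val_inj.
Qed.
Lemma ent_eidr N a i j : fin a -> ent (a * eid N) i j = if (j < N)%N then ent a i j else 0.
Proof.
move=> fa; rewrite mulr_sumr ent_sum.
case: ltnP => Hi; last first.
  apply: big1 => k _; rewrite ent_eur //; case: eqP => [E|_]; rewrite ?mulr0 //.
  by move: Hi; rewrite E leqNgt ltn_ord.
rewrite (bigD1 (Ordinal Hi)) //= big1 ?addr0; first by rewrite ent_eur // eqxx mulr1.
move=> k /negP Hk; rewrite ent_eur //; case: eqP => [E|_]; rewrite ?mulr0 //.
by case: Hk; apply/eqP; apply: val_inj.
Qed.

Lemma eid_mull N a : bounded N a -> eid N * a = a.
Proof.
move=> [fa Ha]; apply: ent_ext => //; first exact: fin_mulr.
by move=> i j; rewrite ent_eidl //; case: ltnP => // Hi; rewrite Ha //; left.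
Qed.
Lemma eid_mulr N a : bounded N a -> a * eid N = a.
Proof.
move=> [fa Ha]; apply: ent_ext => //; first exact: fin_mull.
by move=> i j; rewrite ent_eidr //; case: ltnP => // Hi; rewrite Ha //; right.
Qed.
Lemma ent_eid N a i j : fin a ->
  ent (eid N * a * eid N) i j = if ((i < N) && (j < N))%N then ent a i j else 0.
Proof.
move=> fa; rewrite ent_eidr; last exact: fin_mulr.
by rewrite ent_eidl //; case: (i < N)%N; case: (j < N)%N.
Qed.
Lemma eid_bounded N a : fin a -> bounded N (eid N * a * eid N).
Proof.
move=> fa; split; first by apply/fin_mull/fin_mulr.
move=> i j H; rewrite ent_eid //.
by case: H; rewrite leqNgt => /negbTE ->; rewrite ?andbF.
Qed.
End FinitaryMatrices.

(** * Linear algebra on subspaces given by predicates *)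

Section LinearCombinations.
Variables (F : fieldType) (L : lmodType F).

Lemma linear_comb (V : lmodType F) (g : L -> V) n (c : 'I_n -> F) (v : 'I_n -> L) :
  linear g -> g (\sum_i c i *: v i) = \sum_i c i *: g (v i).
Proof.
move=> lg; have g0 : g 0 = 0 by have := lg (-1) 0 0; rewrite scaler0 addr0 scaleN1r addNr.
have gD x y : g (x + y) = g x + g y by rewrite -[x]scale1r lg !scale1r.
rewrite (big_morph g gD g0); apply: eq_bigr => i _.
by rewrite -[_ *: _]addr0 lg g0 addr0.
Qed.

Section Subspace.
Variables (S : L -> Prop).
Hypothesis HS : subspace S.

Lemma subsp0 : S 0. Proof. by case: HS. Qed.
Lemma subspZ a x : S x -> S (a *: x).
Proof. by move=> Sx; rewrite -[_ *: _]addr0; apply: (proj2 HS) => //; exact: subsp0. Qed.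
Lemma subspD x y : S x -> S y -> S (x + y).
Proof. by move=> Sx Sy; rewrite -[x]scale1r; apply: (proj2 HS). Qed.
Lemma subspN x : S x -> S (- x).
Proof. by move=> Sx; rewrite -scaleN1r; exact: subspZ. Qed.
Lemma subspB x y : S x -> S y -> S (x - y).
Proof. by move=> Sx Sy; apply: subspD => //; exact: subspN. Qed.
Lemma subsp_sum (I : Type) (r : seq I) (P : pred I) (v : I -> L) :
  (forall i, P i -> S (v i)) -> S (\sum_(i <- r | P i) v i).
Proof. move=> H; apply: big_ind => //; [exact: subsp0 | exact: subspD]. Qed.
Lemma subsp_comb n (c : 'I_n -> F) (v : 'I_n -> L) :
  (forall i, S (v i)) -> S (\sum_i c i *: v i).
Proof. by move=> H; apply: subsp_sum => i _; exact: subspZ. Qed.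
End Subspace.

Lemma span_incl (P : L -> Prop) x : P x -> lspan P x.
Proof.
move=> Px; exists 1%N, (fun _ => x), (fun _ => 1); split => //.
by rewrite big_ord1 scale1r.
Qed.

Lemma span_min (P S : L -> Prop) : subspace S -> (forall x, P x -> S x) ->
  forall x, lspan P x -> S x.
Proof. by move=> HS PS x [n [v [c [Pv ->]]]]; apply: subsp_comb => // i; apply: PS. Qed.

Lemma span_subspace (P : L -> Prop) : subspace (lspan P).
Proof.
split; first by exists 0%N, (fun _ => 0), (fun _ => 0); split=> [[]|] //; rewrite big_ord0.
move=> a _ _ [n [v [c [Pv ->]]]] [m [w [d [Pw ->]]]].
exists (n + m)%N, (fun i => match fintype.split i with inl j => v j | inr j => w j end),
  (fun i => match fintype.split i with inl j => a * c j | inr j => d j end); split.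
  by move=> i; case: fintype.split.
rewrite big_split_ord /= scaler_sumr; congr (_ + _); apply: eq_bigr => i _.
  by rewrite -[lshift _ _]/(unsplit (inl i)) unsplitK scalerA.
by rewrite -[rshift _ _]/(unsplit (inr i)) unsplitK.
Qed.

Lemma span_mono (P Q : L -> Prop) : (forall x, P x -> Q x) -> forall x, lspan P x -> lspan Q x.
Proof. by move=> PQ; apply: span_min => [|x /PQ]; [exact: span_subspace | exact: span_incl]. Qed.

Lemma fin_dim_generator n (S : L -> Prop) (v : 'I_n -> L) :
  (forall x, S x <-> exists c : 'I_n -> F, x = \sum_(i < n) c i *: v i) -> forall i, S (v i).
Proof.
move=> Hv i; apply/Hv; exists (fun j => (j == i)%:R); rewrite (bigD1 i) //= eqxx scale1r.
by rewrite big1 ?addr0 // => j /negPf ->; rewrite scale0r.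
Qed.

Lemma fin_dim_subspace (S : L -> Prop) : fin_dim S -> subspace S.
Proof.
move=> [n [v Hv]]; split.
  by apply/Hv; exists (fun _ => 0); rewrite big1 // => i _; rewrite scale0r.
move=> a x y /Hv [c ->] /Hv [d ->]; apply/Hv; exists (fun i => a * c i + d i).
by rewrite scaler_sumr -big_split; apply: eq_bigr => i _; rewrite scalerDl scalerA.
Qed.
End LinearCombinations.

(** Take a subspace of maximal dimension among those contained in [P]; a vector of [P] outside it
    could be adjoined. *)
Lemma vspace_of_subspace (F : fieldType) (vT : vectType F) (P : vT -> Prop) :
  subspace P -> exists U : {vspace vT}, forall v, P v <-> v \in U.
Proof.
move=> HP.
pose Q d := `[< exists U : {vspace vT}, \dim U = d /\ forall v, v \in U -> P v >].
have Q0 : exists d, Q d.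
  exists 0%N; apply/asboolP; exists 0%VS; split; first exact: dimv0.
  by move=> v; rewrite memv0 => /eqP ->; case: HP.
have Qb d : Q d -> (d <= \dim {:vT})%N.
  by move=> /asboolP [U [<- _]]; apply/dimvS/subvf.
have [d /asboolP [U [dU HU]] Hmax] := ex_maxnP Q0 Qb.
exists U => v; split; last exact: HU.
move=> Pv; apply: contrapT => nUv.
apply: nUv; have /Hmax : Q (\dim (U + <[v]>)).
  apply/asboolP; exists (U + <[v]>)%VS; split=> // w /memv_addP [u Uu [x /vlineP [k ->]] ->].
  by rewrite addrC; apply: (proj2 HP) => //; exact: HU.
rewrite -dU (geq_leqif (dimv_leqif_sup (addvSl U <[v]>))).
by move/(subv_trans (addvSr U <[v]>)); rewrite -memvE.
Qed.

Section FiniteDimension.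
Variables (F : fieldType) (L : lmodType F).

Definition comb n (v : 'I_n -> L) (u : 'rV[F]_n) : L := \sum_i u 0 i *: v i.

Lemma comb_linear n (v : 'I_n -> L) : linear (comb v).
Proof.
move=> a x y; rewrite /comb scaler_sumr -big_split; apply: eq_bigr => i _.
by rewrite !mxE scalerDl scalerA.
Qed.

Lemma comb_row n (v : 'I_n -> L) (c : 'I_n -> F) :
  \sum_i c i *: v i = comb v (\row_i c i).
Proof. by apply: eq_bigr => i _; rewrite mxE. Qed.

Lemma preim_subspace (V : lmodType F) (W : L -> Prop) (g : V -> L) :
  linear g -> subspace W -> subspace (fun u => W (g u)).
Proof.
move=> lg HW; split.
  have -> : g 0 = 0 by have := lg (-1) 0 0; rewrite scaler0 addr0 scaleN1r addNr.
  exact: subsp0.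
by move=> a x y Hx Hy; rewrite lg; apply: (proj2 HW).
Qed.

Lemma comb_vbasis n (v : 'I_n -> L) (U : {vspace 'rV[F]_n}) u : u \in U ->
  comb v u = \sum_(k < \dim U) coord (vbasis U) k u *: comb v (vbasis U)`_k.
Proof.
by move=> Uu; rewrite {1}(coord_vbasis Uu) (linear_comb _ _ (comb_linear v)).
Qed.

Definition spanned n (S : L -> Prop) : Prop :=
  exists v : 'I_n -> L, forall x, S x <-> exists c : 'I_n -> F, x = \sum_(i < n) c i *: v i.

(** Coefficient vectors of elements of [T] form a subspace of row space, and a basis of it generates
    [T]. The strict inequality for proper [T] is what allows choosing an ideal with the least number
    of generators. *)
Lemma spanned_sub n (S T : L -> Prop) : spanned n S -> subspace T -> (forall x, T x -> S x) ->
  exists2 m, (m <= n)%N & spanned m T /\ ((exists2 x, S x & ~ T x) -> (m < n)%N).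
Proof.
move=> [v Hv] HT TS.
have [U HU] := vspace_of_subspace (preim_subspace (comb_linear v) HT).
have dF : \dim {: 'rV[F]_n} = n by rewrite dimvf /dim /= mul1n.
have dU : (\dim U <= n)%N by rewrite -[leqRHS]dF dimvS ?subvf.
exists (\dim U) => //.
split.
  exists (fun k => comb v (vbasis U)`_k) => x; split.
    move=> Tx; have /Hv [c Ex] := TS _ Tx.
    move: Tx; rewrite Ex comb_row => /HU /comb_vbasis ->; by eexists.
  case=> c ->; apply: subsp_comb => // k; apply/HU.
  by apply/vbasis_mem/mem_nth; rewrite size_tuple.
case=> x /Hv [c ->] nT; rewrite ltn_neqAle dU andbT.
apply/eqP => E; apply: nT; rewrite comb_row; apply/HU.
have /eqP -> : U == fullv; last exact: memvf.
by rewrite eqEdim subvf dF E leqnn.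
Qed.

Lemma fin_dim_sub (S T : L -> Prop) :
  fin_dim S -> subspace T -> (forall x, T x -> S x) -> fin_dim T.
Proof. by move=> [n HS] HT TS; have [m _ [HT' _]] := spanned_sub HS HT TS; exists m. Qed.

Lemma fin_dim_basis (S : L -> Prop) : fin_dim S ->
  exists d (v : 'I_d -> L) (c : L -> 'I_d -> F),
  [/\ forall i, S (v i), forall x, S x -> x = \sum_i c x i *: v i &
      forall e i, c (\sum_j e j *: v j) i = e i].
Proof.
move=> fS; have HS := fin_dim_subspace fS; move: fS => [n [v Hv]].
have s0 : subspace (fun x : L => x = 0) by split=> // a x y -> ->; rewrite scaler0 addr0.
have [U HU] := vspace_of_subspace (preim_subspace (comb_linear v) s0).
(* [U] is the space of linear relations among the generators. On a complement of it the combination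
   map is injective, so the images of a basis of the complement are a basis of [S]. *)
pose C := (U^C)%VS; pose d := \dim C; pose b k := comb v (vbasis C)`_k.
have Cu u : exists2 u', u' \in C & comb v u' = comb v u.
  have : u \in (U + C)%VS by rewrite addv_complf memvf.
  case/memv_addP => u1 U1 [u2 U2 ->]; exists u2 => //.
  have := comb_linear v 1 u1 u2; rewrite !scale1r => ->.
  by move/HU: U1 => ->; rewrite add0r.
have Cinj u u' : u \in C -> u' \in C -> comb v u = comb v u' -> u = u'.
  move=> Hu Hu' E; apply/eqP; rewrite -subr_eq0 -memv0 -(capv_compl U) memv_cap.
  apply/andP; split; last exact: memvB.
  apply/HU; have := comb_linear v (-1) u' u; rewrite !scaleN1r [- u' + u]addrC => ->.
  by rewrite E addNr.
have HC x : exists u : 'rV[F]_n, S x -> u \in C /\ comb v u = x.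
  case: (pselect (S x)) => [/Hv [c ->]|nS]; last by exists 0.
  by have [u ? E] := Cu (\row_i c i); exists u => _; rewrite comb_row.
have [u Hu] := choice HC.
exists d, (fun k => b k), (fun x k => coord (vbasis C) k (u x)); split.
- by move=> i; apply/Hv; eexists; exact: erefl.
- by move=> x /Hu [Cux E]; rewrite -{1}E (comb_vbasis v Cux).
move=> e i.
have Sb : S (\sum_j e j *: b j).
  by apply: subsp_comb => // k; apply/Hv; eexists; exact: erefl.
have [Cx Ex] := Hu _ Sb.
have -> : u (\sum_j e j *: b j) = \sum_j e j *: (vbasis C)`_j.
  apply: Cinj => //; last by rewrite Ex (linear_comb _ _ (comb_linear v)).
  by apply: memv_suml => k _; apply/memvZ/vbasis_mem/mem_nth; rewrite size_tuple.
by apply: coord_sum_free; exact: (basis_free (vbasisP C)).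
Qed.

(** Fredholm alternative for the Gram matrix of a generating family: a row vector lies in the row
    space as soon as it kills the cokernel. The form may be degenerate; [g] only has to vanish on
    its right radical. *)
Lemma represent_functional (J : L -> Prop) (beta : L -> L -> F^o) (g : L -> F^o) :
  fin_dim J -> (forall x, linear (beta x)) -> (forall x, linear (beta^~ x)) -> linear g ->
  (forall w, J w -> (forall u, J u -> beta u w = 0) -> g w = 0) ->
  exists2 u, J u & forall w, J w -> beta u w = g w.
Proof.
move=> [n [v Hv]] lr ll lg H.
pose G : 'M[F]_n := \matrix_(i, j) beta (v i) (v j).
pose f : 'rV[F]_n := \row_j g (v j).
have : (f <= G)%MS.
  rewrite submxE; apply/eqP/rowP => k; rewrite !mxE.
  transitivity (g (\sum_j cokermx G j k *: v j)).
    rewrite (linear_comb _ _ lg); apply: eq_bigr => j _; rewrite mxE.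
    exact: mulrC.
  apply: H; first by apply/Hv; eexists.
  move=> u /Hv [c ->]; rewrite (linear_comb _ _ (ll _)); apply: big1 => i _.
  rewrite (linear_comb _ _ (lr _)).
  have /matrixP/(_ i k) := mulmx_coker G; rewrite !mxE => E.
  rewrite -[_ *: _]/(_ * _); under eq_bigr => j _.
    rewrite -[_ *: _]/(_ * _) mulrC; have -> : beta (v i) (v j) = G i j by rewrite mxE.
    over.
  by rewrite E mulr0.
case/submxP => D fD.
exists (\sum_i D 0 i *: v i) => [|w /Hv [c ->]]; first by apply/Hv; eexists.
rewrite (linear_comb _ _ (lr _)) (linear_comb _ _ lg); apply: eq_bigr => j _; congr (_ *: _).
rewrite (linear_comb _ _ (ll _)).
have /rowP/(_ j) := fD; rewrite !mxE => ->; apply: eq_bigr => i _.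
by rewrite mxE.
Qed.

(** The values of the [D] functionals on [Y] form a subspace of F^D, and the [u j] lift a basis of
    it. Hence they span [Y] modulo the common kernel. *)
Lemma finite_codim (Y : L -> Prop) D (th : 'I_D -> L -> F^o) :
  subspace Y -> (forall i, linear (th i)) ->
  exists r (u : 'I_r -> L), (forall j, Y (u j)) /\
    forall x, Y x -> exists c : 'I_r -> F, forall i, th i x = th i (\sum_j c j *: u j).
Proof.
move=> HY lth.
pose T (row : 'rV[F]_D) := exists2 x, Y x & forall i, row 0 i = th i x.
have HT : subspace T.
  split.
    exists 0; first exact: subsp0.
    move=> i; rewrite mxE; have := lth i (-1) 0 0.
    by rewrite scaler0 addr0 scaleN1r addNr => ->.
  move=> a x y [x' Yx Ex] [y' Yy Ey]; exists (a *: x' + y'); first exact: (proj2 HY).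
  by move=> i; rewrite lth !mxE Ex Ey.
have [U HU] := vspace_of_subspace HT.
have Hb (k : 'I_(\dim U)) : exists x, Y x /\ forall i, (vbasis U)`_k 0 i = th i x.
  have /HU [x ? ?] : (vbasis U)`_k \in U by apply/vbasis_mem/mem_nth; rewrite size_tuple.
  by exists x.
have [u Hu] := choice Hb.
exists (\dim U), u; split=> [j|x Yx]; first exact: (proj1 (Hu j)).
have Ux : \row_i th i x \in U by apply/HU; exists x => // i; rewrite mxE.
exists (fun k => coord (vbasis U) k (\row_i th i x)) => i.
rewrite (linear_comb _ _ (lth i)).
have := coord_vbasis Ux => /rowP/(_ i); rewrite mxE => {1}->.
rewrite summxE; apply: eq_bigr => k _; rewrite mxE; congr (_ * _).
exact: (proj2 (Hu k)).
Qed.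

Lemma fin_dim_of_injective (Y : L -> Prop) D (th : 'I_D -> L -> F^o) :
  subspace Y -> (forall i, linear (th i)) ->
  (forall x, Y x -> (forall i, th i x = 0) -> x = 0) -> fin_dim Y.
Proof.
move=> HY lth inj; have [r [u [Yu Hu]]] := finite_codim HY lth.
exists r, u => x; split; last by case=> c ->; exact: subsp_comb.
move=> Yx; have [c Hc] := Hu x Yx; exists c; apply/eqP; rewrite -subr_eq0; apply/eqP.
apply: inj; first by apply: subspB => //; exact: subsp_comb.
move=> i; rewrite addrC -scaleN1r lth -Hc scaleN1r; exact: addNr.
Qed.

Lemma dependent D (th : 'I_D -> L -> F^o) m (u : 'I_m -> L) : (D < m)%N ->
  (forall i, linear (th i)) ->
  exists2 c : 'I_m -> F, exists j, c j != 0 & forall i, th i (\sum_j c j *: u j) = 0.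
Proof.
move=> Dm lth; pose A : 'M[F]_(m, D) := \matrix_(j, i) th i (u j).
have : kermx A != 0.
  by rewrite kermx_eq0 /row_free neq_ltn (leq_ltn_trans (rank_leq_col A) Dm).
case/rowV0Pn => c /sub_kermxP cA c0; exists (fun j => c 0 j).
  have : exists j, c 0 j != 0.
    apply: contrapT => H; case/eqP: c0; apply/rowP => j; rewrite mxE; apply/eqP.
    by apply: contrapT => /negP Hj; apply: H; exists j.
  by [].
move=> i; rewrite (linear_comb _ _ (lth i)).
transitivity ((c *m A) 0 i); last by rewrite cA mxE.
by rewrite mxE; apply: eq_bigr => j _; rewrite mxE.
Qed.
End FiniteDimension.

(** * Cartan's criterion *)

Section MatrixTraces.
Variable F : fieldType.

(** In a full rank factorization P = C R of an idempotent one has R C = 1, so the trace is that of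
    an identity matrix of size the rank. *)
Lemma mxtrace_idem n (P : 'M[F]_n) : P *m P = P -> \tr P = (\rank P)%:R.
Proof.
move=> PP; move: (col_base_full P) (row_base_free P) (mulmx_base P).
move: (col_base P) (row_base P) => C R Cf Rf E; rewrite -{1}E mxtrace_mulC.
have -> : R *m C = 1%:M; last by rewrite mxtrace1.
apply: (row_free_inj Rf); apply: (row_full_inj Cf).
by rewrite /= mul1mx E !mulmxA E -mulmxA E PP.
Qed.

Lemma zero_notin_unitmx n : (0 < n)%N -> ((0 : 'M[F]_n) \in unitmx) = false.
Proof. by case: n => // n _; rewrite unitmxE det0 unitr0. Qed.

(** A nilpotent A is singular, so a full rank factorization A = C R passes to the smaller matrix R
    C, again nilpotent and of the same trace. *)
Lemma mxtrace_nilp n (A : 'M[F]_n) k : A ^+ k = 0 -> \tr A = 0.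
Proof.
have [m] := ubnP n; elim: m => // m IH in n A k *; rewrite ltnS => le_n_m Ak0.
have [n0|n0] := posnP n; first by move: A Ak0; rewrite n0 => A _; rewrite /mxtrace big_ord0.
have rA : (\rank A < n)%N.
  rewrite ltn_neqAle rank_leq_row andbT; apply/negP => uA.
  have : A ^+ k \in unitmx.
    elim: k {Ak0} => [|k IHk]; first by rewrite expr0 unitmx1.
    by rewrite exprS unitmx_mul IHk andbT -row_free_unit.
  by rewrite Ak0 zero_notin_unitmx.
move: (mulmx_base A) rA; move: (col_base A) (row_base A); move: (\rank A) => r C R E rA.
rewrite -E mxtrace_mulC; apply: (IH _ _ k.+1) => //; first exact: leq_trans rA _.
have H j : (R *m C) ^+ j.+1 = R *m A ^+ j *m C.
  elim: j => [|j IHj]; first by rewrite expr1 expr0 mulmx1.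
  rewrite exprS IHj -[_ * _]/(_ *m _) exprS -[A * _]/(A *m _).
  by rewrite (_ : A *m A ^+ j = C *m (R *m A ^+ j)) ?mulmxA ?E.
by rewrite H Ak0 mulmx0 mul0mx.
Qed.

(** Fitting decomposition. Write the characteristic polynomial as s X^m with s(0) nonzero and take u
    X^(m+1) + v s = 1: the first summand, evaluated at [A], projects onto the part where [A] is
    invertible. It is nonzero, for otherwise A^m would be a multiple of the characteristic
    polynomial of [A]. *)
Lemma idempotent_polynomial n (A : 'M[F]_n.+1) : (forall k, A ^+ k != 0) ->
  exists2 q : {poly F}, A * horner_mx A q != 0 &
    (A * horner_mx A q) * (A * horner_mx A q) = A * horner_mx A q.
Proof.
move=> nA; pose p := char_poly A.
have p0 : p != 0 by apply: monic_neq0; exact: char_poly_monic.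
have [m [s]] := multiplicity_XsubC p 0; rewrite p0 subr0 /= => s0 Ep.
have pA : horner_mx A p = 0 by exact: Cayley_Hamilton.
have : coprimep ('X^(m.+1)) s.
  by apply: coprimep_expl; rewrite coprimep_sym; have := coprimep_XsubC s 0; rewrite subr0 => ->.
case/Bezout_eq1_coprimepP => -[u v] /= uv.
have hX : horner_mx A 'X = A by rewrite horner_mx_X.
have EE : A * horner_mx A (u * 'X^m) = horner_mx A (u * 'X^(m.+1)).
  by rewrite -{1}hX -rmorphM exprS mulrCA mulrA.
have E1 : horner_mx A (u * 'X^(m.+1)) = 1 - horner_mx A (v * s).
  by rewrite -[in RHS](rmorph1 (horner_mx A)) -uv -rmorphB addrK.
exists (u * 'X^m); rewrite EE.
  apply/negP => /eqP E0; move/eqP: E1; rewrite E0 eq_sym subr_eq0 => /eqP E1.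
  case/negP: (nA m); rewrite -[A ^+ m]mulr1 E1.
  have -> : A ^+ m = horner_mx A 'X^m by rewrite rmorphXn /= hX.
  have E3 : 'X^m * (v * s) = v * p by rewrite Ep; ring.
  by rewrite -rmorphM E3 rmorphM /= pA mulr0.
have E4 : v * s * (u * 'X^(m.+1)) = u * 'X * v * p by rewrite Ep exprS; ring.
have E5 : horner_mx A (v * s) * horner_mx A (u * 'X^(m.+1)) = 0.
  by rewrite -rmorphM E4 rmorphM /= pA mulr0.
by rewrite {1}E1 mulrBl mul1r E5 subr0.
Qed.
End MatrixTraces.

Lemma common_denominator m (c : 'I_m -> rat) :
  exists2 D : int, D != 0 & exists z : 'I_m -> int, forall k, D%:~R * c k = (z k)%:~R.
Proof.
exists (\prod_k denq (c k)); first by apply/prodf_neq0 => k _; exact: denq_neq0.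
exists (fun k => (\prod_(l | l != k) denq (c l)) * numq (c k)) => k.
rewrite (bigD1 k) //= !rmorphM /= numqE; ring.
Qed.

(** * Integer-valued functionals on finitely many scalars *)

Section RationalFunctional.
Variables (F : fieldType) (charF : [pchar F] =i pred0).

Lemma natr_eq0_pchar0 n : (n%:R == 0 :> F) = (n == 0)%N.
Proof. by move: n; apply/pcharf0P. Qed.

Lemma intr_eq0_pchar0 (z : int) : (z%:~R == 0 :> F) = (z == 0).
Proof.
by case: z => n; rewrite ?NegzE ?mulrNz ?oppr_eq0 -pmulrn natr_eq0_pchar0.
Qed.

(* A nonzero element of F is seen by an additive map from the span of the a_i to the integers. *)
Lemma integer_functional n (a : 'I_n -> F) i0 : a i0 != 0 ->
  exists2 f : 'I_n -> int, exists i, f i != 0 &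
    forall q : 'I_n -> int, \sum_i (q i)%:~R * a i = 0 -> \sum_i q i * f i = 0.
Proof.
move=> a0; pose rel (q : 'I_n -> int) := \sum_i (q i)%:~R * a i = 0.
pose row_of (q : 'I_n -> int) : 'rV[rat]_n := \row_i (q i)%:~R.
pose P : 'rV[rat]_n -> Prop := lspan (fun r => exists2 q, rel q & r = row_of q).
have [U HU] := vspace_of_subspace (span_subspace (fun r => exists2 q, rel q & r = row_of q)).
(* If the unit vector at [i0] were a rational combination of relations, clearing denominators would
   make a nonzero integer multiple of [a i0] vanish. So the relations do not fill the space, and a
   nonzero rational vector [g] is orthogonal to all of them; [z] is an integer multiple of it. *)
have nU : delta_mx 0 i0 \notin U.
  apply/negP => /HU [m [v [c [Pv E]]]].
  have [q Hq] := choice (fun k => let: ex_intro2 q A B := Pv k in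
     ex_intro (fun q => rel q /\ v k = row_of q) q (conj A B)).
  have [D D0 [z Hz]] := common_denominator c.
  have Ei i : D * (i == i0)%:R = \sum_k z k * q k i.
    apply/eqP; rewrite -(eqr_int rat) rmorphM rmorph_sum /=.
    have /rowP/(_ i) := E; rewrite mxE eqxx /= summxE => Ei.
    rewrite (_ : ((i == i0)%:R : int)%:~R = (i == i0)%:R :> rat); last by case: (i == i0).
    rewrite Ei mulr_sumr; apply/eqP; apply: eq_bigr => k _.
    by rewrite rmorphM /= -Hz (proj2 (Hq k)) !mxE mulrA.
  case/negP: a0; have : D%:~R * a i0 = 0.
    transitivity (\sum_i (D * (i == i0)%:R)%:~R * a i).
      rewrite (bigD1 i0) //= big1 ?addr0 ?eqxx ?mulr1 // => i /negbTE ->.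
      by rewrite mulr0 mul0r.
    under eq_bigr => i _ do rewrite Ei rmorph_sum /= mulr_suml.
    rewrite exchange_big /=; apply: big1 => k _.
    transitivity ((z k)%:~R * \sum_i (q k i)%:~R * a i); last by rewrite (proj1 (Hq k)) mulr0.
    by rewrite mulr_sumr; apply: eq_bigr => i _; rewrite rmorphM mulrA.
  by move/eqP; rewrite mulf_eq0 intr_eq0_pchar0 (negbTE D0).
pose B : 'M[rat]_(\dim U, n) := \matrix_(k, i) (vbasis U)`_k 0 i.
have rB : kermx B^T != 0.
  rewrite kermx_eq0 /row_free mxrank_tr; apply: contra nU => /eqP rB.
  have /submxP [D ED] : (delta_mx (0 : 'I_1) i0 <= B)%MS by apply: submx_full; rewrite /row_full rB.
  have -> : delta_mx 0 i0 = \sum_k D 0 k *: (vbasis U)`_k.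
    rewrite ED; apply/rowP => i; rewrite mxE summxE; apply: eq_bigr => k _; by rewrite !mxE.
  by apply: memv_suml => k _; apply/memvZ/vbasis_mem/mem_nth; rewrite size_tuple.
case/rowV0Pn: rB => g /sub_kermxP gB g0.
have [D D0 [z Hz]] := common_denominator (g 0).
exists z.
  apply: contrapT => H; case/eqP: g0; apply/rowP => i; rewrite mxE; apply/eqP.
  have : z i = 0 by apply: contrapT => /eqP zi; apply: H; exists i.
  have := Hz i => /[swap] -> /eqP; rewrite mulf_eq0 intr_eq0 (negbTE D0) //.
move=> q /= Hq; apply/eqP; rewrite -(intr_eq0 rat) rmorph_sum /=.
have : row_of q \in U by apply/HU/span_incl; exists q.
move/coord_vbasis => Eq.
have Eg : \sum_i (row_of q) 0 i * g 0 i = 0.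
  rewrite Eq; under eq_bigr => i _ do rewrite summxE mulr_suml.
  rewrite exchange_big /=; apply: big1 => k _.
  transitivity (coord (vbasis U) k (row_of q) * (g *m B^T) 0 k); last by rewrite gB mxE mulr0.
  rewrite mxE mulr_sumr; apply: eq_bigr => i _; rewrite !mxE; ring.
transitivity (D%:~R * \sum_i (row_of q) 0 i * g 0 i == 0); last by rewrite Eg mulr0 eqxx.
rewrite mulr_sumr; congr (_ == 0); apply: eq_bigr => i _.
by rewrite rmorphM /= -Hz mxE; ring.
Qed.
End RationalFunctional.

(** * Engel's theorem for Lie algebras of nilpotent matrices *)

Section Engel.
Variables (F : fieldType) (n : nat).
Local Notation M := 'M[F]_n.+1.
Implicit Types (x y : M) (s : seq M).

Definition mbr x y : M := x * y - y * x.

Definition nil_words (m : M -> Prop) K : Prop :=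
  forall s, size s = K -> (forall x, x \in s -> m x) -> \prod_(x <- s) x = 0.

Lemma nil_words_le m K s : nil_words m K -> (K <= size s)%N ->
  (forall x, x \in s -> m x) -> \prod_(x <- s) x = 0.
Proof.
move=> Hm le Hs; rewrite -(cat_take_drop K s) big_cat /= Hm ?mul0r //.
  by rewrite size_takel.
by move=> x /mem_take /Hs.
Qed.

Section Extension.
Variables (m : M -> Prop) (K : nat) (x : M) (N : nat).
Hypothesis nilm : nil_words m K.
Hypothesis xm : forall v, m v -> m (mbr x v).
Hypothesis xN : x ^+ N = 0.

(* Words in x and in elements of m, the letter None standing for x. *)
Definition letters (w : seq (option M)) : Prop := forall v, Some v \in w -> m v.
Definition word (w : seq (option M)) : M := \prod_(o <- w) odflt x o.
Definition nfree (w : seq (option M)) : nat := count (fun o => o != None) w.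
Definition lead (w : seq (option M)) : nat := find (fun o => o != None) w.

Lemma letters_cons o w : letters (o :: w) -> letters w.
Proof. by move=> H v Hv; apply: H; rewrite inE Hv orbT. Qed.

Lemma move_left v i : m v ->
  lspan (fun z => exists2 j, True & exists2 v', m v' & z = x ^+ j * v') (v * x ^+ i).
Proof.
elim: i v => [|i IH] v mv.
  by apply: span_incl; exists 0%N => //; exists v => //; rewrite expr0 mulr1 mul1r.
set P := (fun z => _) in IH *.
have -> : v * x ^+ i.+1 = x * (v * x ^+ i) - mbr x v * x ^+ i.
  by rewrite exprS /mbr mulrBl !mulrA opprB addrC subrK.
apply: subspB; [exact: span_subspace| |by apply: IH; exact: xm].
move: (v * x ^+ i) (IH v mv); apply: span_min.
  apply: (preim_subspace (g := fun z => x * z)); last exact: span_subspace.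
  by move=> c a b; rewrite mulrDr scalerAr.
move=> z [j _ [v' mv' ->]]; apply: span_incl; exists j.+1 => //.
by exists v' => //; rewrite exprS mulrA.
Qed.

(** The rule v x = x v - [x, v] moves every x to the left. Since [x, v] is again in [m], the number
    of letters from [m] does not change. *)
Lemma word_free_left w : letters w ->
  lspan (fun z => exists2 j, True & exists2 s, size s = nfree w /\ (forall y, y \in s -> m y)
     & z = x ^+ j * \prod_(y <- s) y) (word w).
Proof.
elim: w => [|o w IH] Hw.
  apply: span_incl; exists 0%N => //; exists [::] => //.
  by rewrite /word !big_nil expr0 mulr1.
have {}IH := IH (letters_cons Hw).
rewrite /word big_cons -/(word w); case: o Hw => [v|] Hw /=.
  have mv : m v by apply: Hw; rewrite inE eqxx.
  move: (word w) IH; apply: span_min.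
    apply: (preim_subspace (g := fun z => v * z)); last exact: span_subspace.
    by move=> c a b; rewrite mulrDr scalerAr.
  move=> z [j _ [s [ss Hs] ->]]; rewrite mulrA.
  move: (v * x ^+ j) (move_left j mv); apply: span_min.
    apply: (preim_subspace (g := fun z => z * _)); last exact: span_subspace.
    by move=> c a b; rewrite mulrDl scalerAl.
  move=> z' [j' _ [v' mv' ->]]; apply: span_incl; exists j' => //.
  exists (v' :: s); first split; rewrite /= ?ss //.
    by move=> y; rewrite inE => /orP[/eqP ->|/Hs].
  by rewrite big_cons mulrA.
move: (word w) IH; apply: span_min.
  apply: (preim_subspace (g := fun z => x * z)); last exact: span_subspace.
  by move=> c a b; rewrite mulrDr scalerAr.
move=> z [j _ [s [ss Hs] ->]]; apply: span_incl; exists j.+1 => //.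
by exists s => //; rewrite exprS mulrA.
Qed.

Lemma word_many_free w : letters w -> (K <= nfree w)%N -> word w = 0.
Proof.
move=> Hw le; have := word_free_left Hw; apply: (@span_min _ _ _ (fun z => z = 0)).
  by split=> // c a b -> ->; rewrite scaler0 addr0.
by move=> z [j _ [s [ss Hs] ->]]; rewrite (nil_words_le nilm) ?mulr0 // ss.
Qed.

Lemma word_lead w : word w = x ^+ lead w * word (drop (lead w) w).
Proof.
elim: w => [|[v|] w IH]; rewrite /word /lead /= ?drop0 ?expr0 ?mul1r //.
by rewrite big_cons /= -/(word w) IH exprS mulrA.
Qed.

Lemma word_size w : word w != 0 -> (lead w < N)%N /\ (size w <= nfree w * N + lead w)%N.
Proof.
have lN w' : word w' != 0 -> (lead w' < N)%N.
  rewrite ltnNge; apply: contra => le; rewrite word_lead.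
  by rewrite -(subnKC le) exprD xN !mul0r.
elim: w => [|o w IH] w0; split=> //; try exact: lN.
have /IH [l1 l2] : word w != 0.
  by apply: contraNneq w0; rewrite /word big_cons => ->; rewrite mulr0.
case: o w0 => [v|] _; rewrite /nfree /lead /= -/(nfree w) -/(lead w) ?addn0 ?addnS ?ltnS //.
apply: (leq_trans (n := (nfree w * N + lead w).+1)); first by rewrite ltnS.
by rewrite -addnS mulSn addnC leq_add2r.
Qed.

Lemma word_long w : letters w -> (K * N <= size w)%N -> (0 < K)%N -> word w = 0.
Proof.
move=> Hw le K0; apply/eqP; apply: contraT => w0.
have [l1 l2] := word_size w0.
case: (leqP K (nfree w)) => [/(word_many_free Hw)/eqP|lt]; first by rewrite (negbTE w0).
have : (nfree w * N + lead w < K * N)%N.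
  apply: (leq_trans (n := (nfree w).+1 * N)); last by rewrite leq_mul2r lt orbT.
  by rewrite mulSn addnC ltn_add2r.
by rewrite ltnNge (leq_trans le l2).
Qed.

(** A word of length K N in x and elements of [m] has at least K letters from [m], and then vanishes
    after all x are moved to the left, or it has fewer, and then contains a run of N letters x. *)
Lemma nil_words_adjoin : (0 < K)%N ->
  nil_words (fun y => exists2 v, m v & exists c, y = v + c *: x) (K * N).
Proof.
move=> K0 s ss Hs.
pose P j z := exists2 w, letters w /\ size w = j & z = word w.
have : lspan (P (size s)) (\prod_(y <- s) y).
  elim: s Hs {ss} => [|y s IH] Hs.
    by apply: span_incl; exists [::]; rewrite ?big_nil // /word big_nil.
  have {}IH := IH (fun z Hz => Hs z (mem_behead (s := y :: s) Hz)).
  have [v mv [c ->]] := Hs y (mem_head _ _).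
  rewrite big_cons; move: (\prod_(z <- s) z) IH; apply: span_min.
    apply: (preim_subspace (g := fun z => (v + c *: x) * z)); last exact: span_subspace.
    by move=> c' a b; rewrite mulrDr scalerAr.
  move=> z [w [Hw sw] ->]; rewrite mulrDl -scalerAl.
  rewrite /= addrC; apply: (proj2 (span_subspace (P _))); apply: span_incl.
    exists (None :: w); last by rewrite /word big_cons.
    by split; rewrite /= ?sw // => v'; rewrite inE => /Hw.
  exists (Some v :: w); last by rewrite /word big_cons.
  by split; rewrite /= ?sw // => v'; rewrite inE => /orP[/eqP[->]|/Hw].
apply: (@span_min _ _ _ (fun z => z = 0)).
  by split=> // c a b -> ->; rewrite scaler0 addr0.
by move=> z [w [Hw sw] ->]; apply: word_long; rewrite ?sw ?ss.
Qed.
End Extension.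

Variable U : {vspace M}.
Hypothesis Ubr : forall x y, x \in U -> y \in U -> mbr x y \in U.
Hypothesis Unil : forall x, x \in U -> exists k, x ^+ k = 0.

Lemma normalizer_grows (m : {vspace M}) K : (m <= U)%VS -> nil_words (fun x => x \in m) K ->
  (exists2 y, y \in U & y \notin m) ->
  exists2 y, y \in U /\ y \notin m & forall v, v \in m -> mbr v y \in m.
Proof.
move=> mU nilm [y0 y0U y0m]; apply: contrapT => H.
have {}H y : y \in U -> y \notin m -> exists2 v, v \in m & mbr v y \notin m.
  move=> yU ym; apply: contrapT => H'; apply: H; exists y => // s sm.
  by apply: contrapT => /negP nm; apply: H'; exists s.
pose P j z := exists2 p : seq M * seq M, (forall v, v \in p.1 ++ p.2 -> v \in m) /\
  size (p.1 ++ p.2) = j & z = \prod_(v <- p.1) v * y0 * \prod_(v <- p.2) v.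
have [z zU [zm Pz]] : exists2 z, z \in U & z \notin m /\ lspan (P (K + K)%N) z.
  elim: (K + K)%N => [|j [z zU [zm Pz]]].
    exists y0 => //; split=> //; apply: span_incl; exists ([::], [::]) => //.
    by rewrite !big_nil mul1r mulr1.
  have [s sm szm] := H z zU zm; exists (mbr s z); first by apply: Ubr => //; apply: (subvP mU).
  split=> //; move: z Pz {zU zm szm}; apply: span_min.
    apply: (preim_subspace (g := mbr s)); last exact: span_subspace.
    move=> c a b; rewrite /mbr mulrDr mulrDl -scalerAr -scalerAl scalerBr opprD !addrA.
    by congr (_ - _); rewrite addrAC.
  move=> z [[p q] /= [Hpq spq] ->]; apply: subspB; first exact: span_subspace.
    apply: span_incl; exists (s :: p, q); rewrite /= ?spq; last by rewrite big_cons !mulrA.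
    by split=> // v; rewrite inE => /orP[/eqP ->|/Hpq].
  apply: span_incl; exists (p, rcons q s) => /=.
    split; last by rewrite -spq !size_cat size_rcons addnS.
    move=> v; rewrite mem_cat mem_rcons inE orbCA => /orP[/eqP ->//|Hv].
    by apply: Hpq; rewrite mem_cat.
  by rewrite -cats1 big_cat big_seq1 !mulrA.
case/negP: zm; suff -> : z = 0 by exact: mem0v.
move: z Pz {zU}; apply: span_min; first by split=> // c a b -> ->; rewrite scaler0 addr0.
move=> z [[p q] /= [Hpq]]; rewrite size_cat => spq ->.
have Hp v : v \in p -> v \in m by move=> Hv; apply: Hpq; rewrite mem_cat Hv.
have Hq v : v \in q -> v \in m by move=> Hv; apply: Hpq; rewrite mem_cat Hv orbT.
case: (leqP K (size p)) => Kp; first by rewrite (nil_words_le nilm) ?mul0r.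
rewrite [X in _ * X](nil_words_le nilm) ?mulr0 //.
by rewrite -(leq_add2l (size p)) spq leq_add2r ltnW.
Qed.

Theorem engel : exists K, nil_words (fun x => x \in U) K.
Proof.
(* A subalgebra of [U] with vanishing long words is enlarged by one dimension at a time, adjoining
   an element that normalizes it. *)
suff H d : (d <= \dim U)%N -> exists m : {vspace M}, [/\ (m <= U)%VS, \dim m = d,
    forall x y, x \in m -> y \in m -> mbr x y \in m &
    exists2 K, (0 < K)%N & nil_words (fun x => x \in m) K].
  have [m [mU dm _ [K _ HK]]] := H _ (leqnn _); exists K => s ss Hs; apply: HK => // x /Hs.
  by have /eqP -> : m == U by rewrite eqEdim mU dm leqnn.
elim: d => [|d IH] le.
  exists 0%VS; split; rewrite ?sub0v ?dimv0 //.
    by move=> x y; rewrite !memv0 => /eqP -> _; rewrite /mbr mul0r mulr0 subr0.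
  exists 1%N => // s; case: s => [|x [|]] //= _ /(_ x (mem_head _ _)).
  by rewrite memv0 big_seq1 => /eqP.
have [m [mU dm mbrm [K K0 HK]]] := IH (ltnW le).
have [|x [xU xm] Hx] := normalizer_grows mU HK.
  apply: contrapT => H; have : (U <= m)%VS.
    by apply/subvP => x xU; apply: contrapT => /negP xm; apply: H; exists x.
  by move/dimvS; rewrite dm leqNgt le.
have [N xN] := Unil xU.
have memm' y : y \in (m + <[x]>)%VS -> exists2 v, v \in m & exists c, y = v + c *: x.
  by case/memv_addP => v vm [_ /vlineP[c ->] ->]; exists v => //; exists c.
have Hx' v : v \in m -> mbr x v \in m.
  by move=> /Hx; rewrite -memvN /mbr opprB.
exists (m + <[x]>)%VS; split.
- by rewrite subv_add mU -memvE.
- apply/eqP; rewrite eqn_leq; apply/andP; split.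
    apply: leq_trans (dimv_add_leqif _ _) _; rewrite dm dim_vline.
    by case: (x != 0); rewrite ?addn1 ?addn0.
  rewrite -dm ltnNge (geq_leqif (dimv_leqif_sup (addvSl m <[x]>))).
  by apply: contra xm => /(subv_trans (addvSr m <[x]>)); rewrite -memvE.
- move=> y z /memm' [v vm [c ->]] /memm' [w wm [d' ->]].
  have -> : mbr (v + c *: x) (w + d' *: x) = mbr v w + d' *: mbr v x + c *: mbr x w.
    rewrite /mbr !(mulrDl, mulrDr) -!(scalerAl, scalerAr) !scalerBr !scalerA.
    rewrite [d' * c]mulrC !opprD !addrA; move: (v * w) (w * v) (v * x) (x * v).
    move=> p1 p2 p3 p4; move: (x * w) (w * x) (_ *: (x * x)) => p5 p6 p7.
    by rewrite [LHS](ACl (1*5*2*7*3*6*(4*8))) /= subrr addr0.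
  apply: (subvP (addvSl m <[x]>)); apply: memvD; first apply: memvD; first exact: mbrm.
    exact/memvZ/Hx.
  exact/memvZ/Hx'.
exists (K * N)%N; last first.
  move=> s ss Hs; apply: (nil_words_adjoin HK Hx' xN K0 ss) => y /Hs; exact: memm'.
rewrite muln_gt0 K0 lt0n; apply: contraNneq xm => N0.
by move: xN; rewrite N0 expr0 => /eqP; rewrite oner_eq0.
Qed.
End Engel.

(** * Polynomial congruences and generalized eigenspaces *)

Section PolynomialCRT.
Variable F : fieldType.

Lemma coprimep_prod_XsubC_exp (s : seq F) a K : a \notin s ->
  coprimep (\prod_(b <- s) ('X - b%:P) ^+ K) (('X - a%:P) ^+ K).
Proof.
elim: s => [|b s IH]; first by rewrite big_nil coprime1p.
rewrite inE negb_or big_cons => /andP[ab /IH Hs]; rewrite coprimepMl Hs andbT.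
by apply/coprimep_expl/coprimep_expr; rewrite coprimep_XsubC root_XsubC.
Qed.

Lemma polynomial_crt (s : seq F) K (v : F -> F) : uniq s ->
  exists r : {poly F}, forall a, a \in s -> ('X - a%:P) ^+ K %| r - (v a)%:P.
Proof.
elim: s => [|a s IH] /=; first by exists 0.
case/andP => as_ /IH [r Hr].
have /Bezout_eq1_coprimepP [[u w] /= uw] := coprimep_prod_XsubC_exp K as_.
set m := \prod_(b <- s) _ in uw.
exists (r + m * (u * ((v a)%:P - r))) => b; rewrite inE => /predU1P[->|bs].
  have -> : r + m * (u * ((v a)%:P - r)) - (v a)%:P =
      (w * (r - (v a)%:P)) * ('X - a%:P) ^+ K.
    transitivity ((r - (v a)%:P) * (1 - u * m)); first by ring.
    by rewrite -uw; ring.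
  exact: dvdp_mull.
rewrite addrAC; apply: dvdp_add; first exact: Hr.
by apply: dvdp_mulr; rewrite /m (big_rem b) //= dvdp_mulr.
Qed.

Lemma prod_XsubC_exp_dvd (s : seq F) K p : uniq s ->
  (forall a, a \in s -> ('X - a%:P) ^+ K %| p) -> \prod_(a <- s) ('X - a%:P) ^+ K %| p.
Proof.
elim: s => [|a s IH] /=; first by rewrite big_nil dvd1p.
case/andP => as_ us H; rewrite big_cons mulrC Gauss_dvdp; last exact: coprimep_prod_XsubC_exp.
by rewrite IH ?H ?mem_head // => b bs; apply: H; rewrite inE bs orbT.
Qed.
End PolynomialCRT.

Section SpectralDecomposition.
Variables (F : closedFieldType) (n : nat).
Implicit Types x : 'M[F]_n.+1.

(** [P a] is the value at x of a polynomial congruent to 1 modulo (X - a)^(n+1) and to 0 at the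
    other eigenvalues. The list [s] retains only the eigenvalues with nonzero [P a], which makes
    that clause true by construction. *)
Lemma spectral_idempotents x : exists (s : seq F) (P : F -> 'M[F]_n.+1),
  [/\ uniq s, \sum_(a <- s) P a = 1,
      forall a b, a \in s -> b \in s -> P a * P b = if a == b then P a else 0,
      forall a, a \in s -> P a != 0 /\ (x - a%:M) ^+ n.+1 * P a = 0 &
      forall a, x * P a = P a * x].
Proof.
have [rs] := closed_field_poly_normal (char_poly x).
rewrite (monicP (char_poly_monic x)) scale1r => Ers.
have srs : size rs = n.+1.
  by have := size_char_poly x; rewrite Ers size_prod_XsubC => -[].
have vanish p : (forall a, a \in undup rs -> ('X - a%:P) ^+ n.+1 %| p) -> horner_mx x p = 0.
  move=> Hp; have Hd : char_poly x %| p.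
    apply: dvdp_trans (prod_XsubC_exp_dvd (undup_uniq rs) Hp).
    rewrite Ers -[X in X %| _](big_undup_iterop_count _ _ xpredT (fun z => 'X - z%:P)).
    elim: (undup rs) => [|a s IH]; first by rewrite !big_nil dvdpp.
    rewrite !big_cons; apply: dvdp_mul => //.
    by rewrite -[iterop _ _ _ _]/(('X - a%:P) ^+ count_mem a rs) dvdp_exp2l // -srs count_size.
  by case/dvdpP: Hd => q ->; rewrite rmorphM /= Cayley_Hamilton mulr0.
have He b : exists e : {poly F}, forall a, a \in undup rs ->
    ('X - a%:P) ^+ n.+1 %| e - ((a == b)%:R)%:P.
  exact: (polynomial_crt n.+1 (fun a => (a == b)%:R) (undup_uniq rs)).
have [e He'] := choice He.
pose P a := horner_mx x (e a).
have P0 a b : a \in undup rs -> b \in undup rs -> P a * P b = if a == b then P a else 0.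
  move=> Ha Hb; rewrite /P -rmorphM /=; apply/eqP; rewrite -subr_eq0.
  have -> : (if a == b then horner_mx x (e a) else 0) =
     horner_mx x (if a == b then e a else 0) by case: eqP; rewrite ?rmorph0.
  rewrite -rmorphB; apply/eqP; apply: vanish => c Hc.
  have : ('X - c%:P) ^+ n.+1 %| e a * (e b - ((c == b)%:R)%:P) by rewrite dvdp_mull // He'.
  case: (eqVneq c b) => [->|cb] /=.
    have -> : (if a == b then e a else 0) = e a * (a == b)%:R%:P.
      by case: eqP => _; rewrite ?mulr1 ?mulr0.
    case: (eqVneq a b) => [->|ab] /=; first by rewrite mulrBr.
    rewrite mulr0 subr0 => _; apply: dvdp_mulr.
    by have := He' a b Hb; rewrite eq_sym (negbTE ab) subr0.
  rewrite subr0; case: (eqVneq a b) => [ab|ab]; last by rewrite subr0.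
  move=> H; apply: dvdp_sub => //; have := He' a c Hc.
  by rewrite ab (negbTE cb) subr0.
exists [seq a <- undup rs | P a != 0], P; split.
- exact/filter_uniq/undup_uniq.
- rewrite big_filter.
  transitivity (\sum_(a <- undup rs) P a).
    by rewrite [RHS](bigID (fun a => P a != 0)) /= [X in _ + X]big1 ?addr0 // => a;
       rewrite negbK => /eqP.
  rewrite -rmorph_sum -(rmorph1 (horner_mx x)); apply/eqP; rewrite -subr_eq0 -rmorphB; apply/eqP.
  apply: vanish => a Ha; rewrite (bigD1_seq a) ?undup_uniq //= addrAC.
  apply: dvdp_add; first by have := He' a a Ha; rewrite eqxx.
  rewrite big_seq_cond; apply: (big_ind (fun p => ('X - a%:P) ^+ n.+1 %| p)) => //.
    by move=> p q; exact: dvdp_add.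
  move=> b /andP[Hb ba]; have := He' b a Ha.
  by rewrite eq_sym (negbTE ba) subr0.
- by move=> a b; rewrite !mem_filter => /andP[_ Ha] /andP[_ Hb]; exact: P0.
- move=> a; rewrite mem_filter => /andP[Pa Ha]; split=> //.
  have -> : x - a%:M = horner_mx x ('X - a%:P) by rewrite rmorphB /= horner_mx_X horner_mx_C.
  rewrite -rmorphXn -rmorphM; apply: vanish => b Hb.
  case: (eqVneq b a) => [->|ba]; first exact: dvdp_mulr.
  by apply: dvdp_mull; have := He' a b Hb; rewrite (negbTE ba) subr0.
- by move=> a; exact: (comm_mx_horner (e a) (erefl (x *m x))).
Qed.

(** A polynomial congruent to the constant [phi (c j)] modulo (X - c j)^K acts on [d j] as that
    scalar. With 0 as an additional node and [phi 0 = 0] it is divisible by X, which accounts for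
    the last factor [T]. *)
Lemma polynomial_on_generalized_eigenvectors m (T : 'M[F]_m.+1) (J : eqType) (I : seq J)
    (d : J -> 'rV[F]_m.+1) (c : J -> F) (phi : F -> F) K :
  phi 0 = 0 -> (0 < K)%N -> (forall j, d j *m (T - (c j)%:M) ^+ K = 0) ->
  exists Q, \sum_(j <- I) phi (c j) *: d j = (\sum_(j <- I) d j) *m horner_mx T Q *m T.
Proof.
move=> phi0 K0 Hd.
have [R HR] := polynomial_crt K phi (undup_uniq (0 :: map c I)).
have : 'X %| R.
  have : 0 \in undup (0 :: map c I) by rewrite mem_undup inE eqxx.
  move/HR; rewrite phi0 !subr0; apply: dvdp_trans.
  by case: K K0 {Hd HR} => // K _; rewrite exprS dvdp_mulr.
case/dvdpP => Q EQ; exists Q.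
rewrite -mulmxA -[_ *m T]/(_ * T) -{2}(horner_mx_X T) -rmorphM -EQ mulmx_suml.
apply: eq_big_seq => j jI.
have : ('X - (c j)%:P) ^+ K %| R - (phi (c j))%:P.
  by apply: HR; rewrite mem_undup inE map_f ?orbT.
case/dvdpP => q Eq; have -> : R = q * ('X - (c j)%:P) ^+ K + (phi (c j))%:P by rewrite -Eq subrK.
rewrite rmorphD rmorphM rmorphXn rmorphB /= horner_mx_X !horner_mx_C mulmxDr mul_mx_scalar.
have cq : comm_mx (horner_mx T q) ((T - (c j)%:M) ^+ K).
  have -> : T - (c j)%:M = horner_mx T ('X - (c j)%:P) by rewrite rmorphB /= horner_mx_X horner_mx_C.
  by rewrite -rmorphXn; exact: comm_horner_mx2.
by rewrite [horner_mx T q * _]cq mulmxA Hd mul0mx add0r.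
Qed.

Lemma horner_mx_stable m (T : 'M[F]_m.+1) (W : 'rV[F]_m.+1 -> Prop) Q v :
  subspace W -> (forall v, W v -> W (v *m T)) -> W v -> W (v *m horner_mx T Q).
Proof.
move=> HW HT Wv; elim/poly_ind: Q => [|Q c IH]; first by rewrite rmorph0 mulmx0; exact: subsp0.
rewrite rmorphD rmorphM /= horner_mx_X horner_mx_C mulmxDr mul_mx_scalar mulmxA.
by apply: subspD => //; [exact: HT | exact: subspZ].
Qed.
End SpectralDecomposition.

Lemma iter_derived_sub (F : fieldType) (L : lmodType F) (br : L -> L -> L) (g : L -> Prop) :
  subspace g -> (forall x y, g x -> g y -> g (br x y)) ->
  forall k x, iter k (derived_set br) g x -> g x.
Proof.
move=> Hg gbr; elim=> // k IH; apply: (span_min Hg) => _ [a [b [Ha [Hb ->]]]].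
by apply: gbr; apply: IH.
Qed.

Lemma derived_set_mono (F : fieldType) (L : lmodType F) (br : L -> L -> L) (g h : L -> Prop) :
  (forall x, g x -> h x) -> forall x, derived_set br g x -> derived_set br h x.
Proof.
move=> gh; apply: span_mono => _ [a [b [Ha [Hb ->]]]].
by exists a, b; split; [exact: gh | split; [exact: gh|]].
Qed.

(** * Cartan's criterion for solvability *)

Section CartanCriterion.
Variables (F : closedFieldType) (charF : [pchar F] =i pred0).

Lemma integer_functional_seq (s : seq F) a0 : uniq s -> a0 \in s -> a0 != 0 ->
  exists2 f : F -> int, exists2 a, a \in s & f a != 0 &
    forall q : F -> int, \sum_(a <- s) (q a)%:~R * a = 0 -> \sum_(a <- s) q a * f a = 0.
Proof.
move=> us a0s a00; have lt : (index a0 s < size s)%N by rewrite index_mem.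
have [|f [i fi] Hf] := @integer_functional _ charF _ (fun i : 'I_(size s) => s`_i) (Ordinal lt).
  by rewrite /= nth_index.
pose g a := oapp f 0 (insub (index a s)).
have gE (j : 'I_(size s)) : g s`_j = f j by rewrite /g index_uniq // valK.
exists g; first by exists s`_i; rewrite ?mem_nth // gE.
move=> q; rewrite (big_nth 0) big_mkord => /Hf H.
by rewrite (big_nth 0) big_mkord -[RHS]H; apply: eq_bigr => j _; rewrite gE.
Qed.

Section Nilpotency.
Variable n : nat.
Local Notation M := 'M[F]_n.+1.

(** The matrix on the right is ad x - (a - b) on row vectors. It sends the product to a difference
    of two products of the same kind, one with i raised and one with j raised, until one exponent
    reaches n + 1. *)
Lemma ad_generalized_eigenvector (x p q : M) (a b : F) k i j :
  (x - a%:M) ^+ n.+1 * p = 0 -> q * (x - b%:M) ^+ n.+1 = 0 ->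
  (n.+1 + n.+1 <= i + j + k)%N ->
  mxvec ((x - a%:M) ^+ i * p * (q * (x - b%:M) ^+ j)) *m
    (lin_mx (mulmx x) - lin_mx (mulmxr x) - (a - b)%:M) ^+ k = 0.
Proof.
move=> pa qb; elim: k i j => [|k IH] i j Hk.
  rewrite expr0 mulmx1; apply/eqP; rewrite mxvec_eq0; apply/eqP.
  case: (leqP n.+1 i) => [le|lt].
    by rewrite -(subnK le) exprD -mulrA -mulrA (mulrA _ p) pa mul0r mulr0.
  have le : (n.+1 <= j)%N.
    by rewrite addn0 in Hk; rewrite -(leq_add2l n.+1) (leq_trans Hk) // leq_add2r ltnW.
  by rewrite -(subnKC le) exprD [q * _]mulrA qb mul0r mulr0.
set w := (x - a%:M) ^+ i * p * (q * (x - b%:M) ^+ j).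
rewrite exprS -[_ * _]/(_ *m _) mulmxA.
have -> : mxvec w *m (lin_mx (mulmx x) - lin_mx (mulmxr x) - (a - b)%:M) =
    mxvec ((x - a%:M) * w) - mxvec (w * (x - b%:M)).
  rewrite !mulmxBr !mul_vec_lin mul_mx_scalar -linearZ -!linearB /=; congr mxvec.
  rewrite mulrBl mulrBr -[_ * x]/(w *m x) -[x * _]/(x *m w) -[a%:M * _]/(a%:M *m w).
  rewrite -[w * b%:M]/(w *m b%:M) mul_scalar_mx mul_mx_scalar scalerBl.
  move: (x *m w) (w *m x) (a *: w) (b *: w) => u1 u2 u3 u4.
  by rewrite !opprB !addrA [LHS](ACl (1*4*3*2)).
rewrite mulmxBl {}/w.
have -> : (x - a%:M) * ((x - a%:M) ^+ i * p * (q * (x - b%:M) ^+ j)) =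
    (x - a%:M) ^+ i.+1 * p * (q * (x - b%:M) ^+ j) by rewrite exprS !mulrA.
have -> : (x - a%:M) ^+ i * p * (q * (x - b%:M) ^+ j) * (x - b%:M) =
    (x - a%:M) ^+ i * p * (q * (x - b%:M) ^+ j.+1) by rewrite exprSr !mulrA.
by rewrite (IH i.+1 j) ?(IH i j.+1) ?subr0 //; lia.
Qed.

Variable G : M -> Prop.
Hypothesis HG : subspace G.
Hypothesis Gbr : forall u v, G u -> G v -> G (mbr u v).
Hypothesis Gtr : forall u v, G u -> G v -> \tr (u * v) = 0.

(** Suppose x has a nonzero eigenvalue. An integer functional f on the eigenvalues that respects
    their integer relations gives y, acting as f(a) on the generalized eigenspace of a. Then tr(x y)
    = 0 forces the sum of rank(P a) f(a)^2 to vanish. *)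
Lemma cartan_nilpotent x : lspan (fun z => exists u v, G u /\ G v /\ z = mbr u v) x ->
  exists k, x ^+ k = 0.
Proof.
move=> Dx.
have Gx : G x.
  by move: x Dx; apply: span_min => // z [u [v [Gu [Gv ->]]]]; exact: Gbr.
have [s [P [us Ps PP HP xP]]] := spectral_idempotents x.
case: (pselect (exists2 a0, a0 \in s & a0 != 0)) => [[a0 a0s a00]|Hs]; last first.
  exists n.+1; rewrite -[_ ^+ _]mulr1 -Ps mulr_sumr; apply: big1_seq => a /= as_.
  have a0 : a = 0 by apply: contrapT => /eqP a0; apply: Hs; exists a.
  by have [_] := HP a as_; rewrite a0 raddf0 subr0.
have [f [a1 a1s fa1] Hf] := integer_functional_seq us a0s a00.
have ind (a : F) (g : F -> int) : a \in s -> \sum_(c <- s) (c == a)%:R * g c = g a.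
  move=> as_; rewrite (bigD1_seq a) //= eqxx mul1r big1 ?addr0 // => c /negbTE ->.
  by rewrite mul0r.
have indF (a : F) : a \in s -> \sum_(c <- s) ((c == a)%:R : int)%:~R * c = a.
  move=> as_; rewrite (bigD1_seq a) //= eqxx mul1r big1 ?addr0 // => c /negbTE ->.
  by rewrite mul0r.
(* If a - b = a' - b', this is an integer relation among eigenvalues, so f(a) - f(b) = f(a') -
   f(b'). Thus [phi] is well defined on differences of eigenvalues. *)
have Hphi c : exists v : F, forall a b, a \in s -> b \in s -> a - b = c ->
    v = (f a)%:~R - (f b)%:~R.
  case: (pselect (exists a b, [/\ a \in s, b \in s & a - b = c])) => [|H]; last first.
    by exists 0 => a b as_ bs E; case: H; exists a, b.
  case=> a [b [as_ bs E]]; exists ((f a)%:~R - (f b)%:~R) => a' b' as' bs' E'.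
  pose q d : int := (d == a)%:R - (d == b)%:R - (d == a')%:R + (d == b')%:R.
  have := Hf q; have -> : \sum_(d <- s) (q d)%:~R * d = a - b - a' + b'.
    rewrite -(indF a) // -(indF b) // -(indF a') // -(indF b') //.
    rewrite -!sumrB -big_split /=; apply: eq_bigr => d _.
    by rewrite /q rmorphD !rmorphB /= mulrDl !mulrBl.
  have -> : \sum_(d <- s) q d * f d = f a - f b - f a' + f b'.
    rewrite -(ind a f) // -(ind b f) // -(ind a' f) // -(ind b' f) //.
    rewrite -!sumrB -big_split /=; apply: eq_bigr => d _.
    by rewrite /q mulrDl !mulrBl.
  have -> : a - b - a' + b' = 0 by transitivity ((a - b) - (a' - b')); [ring | rewrite E E' subrr].
  move=> /(_ erefl) E0; rewrite -!rmorphB /=; congr (_%:~R); apply/eqP.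
  by rewrite -subr_eq0 -E0; apply/eqP; ring.
have [phi phiE] := choice Hphi.
pose y := \sum_(a <- s) (f a)%:~R *: P a.
have yP a : a \in s -> y * P a = (f a)%:~R *: P a.
  move=> as_; rewrite mulr_suml (bigD1_seq a) //= -scalerAl PP // eqxx.
  rewrite big_seq_cond big1 ?addr0 // => b /andP[bs ba].
  by rewrite -scalerAl PP // (negbTE ba) scaler0.
have Py a : a \in s -> P a * y = (f a)%:~R *: P a.
  move=> as_; rewrite mulr_sumr (bigD1_seq a) //= -scalerAr PP // eqxx.
  rewrite big_seq_cond big1 ?addr0 // => b /andP[bs ba].
  by rewrite -scalerAr PP // eq_sym (negbTE ba) scaler0.
pose T : 'M[F]_((n + n * n.+1).+1) :=
  (lin_mx (mulmx x) - lin_mx (mulmxr x) : 'M_(n.+1 * n.+1)).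
(* The pieces P a d P b are generalized eigenvectors of ad x for a - b, and ad y multiplies them by
   phi(a - b). Hence ad y is a polynomial in ad x and preserves [G], although y itself need not lie
   in [G]. *)
have Gy d : G d -> G (mbr y d).
  move=> Gd; pose I := [seq (a, b) | a <- s, b <- s].
  pose dd (p : F * F) : 'rV[F]_((n + n * n.+1).+1) :=
    (mxvec (if (p.1 \in s) && (p.2 \in s) then P p.1 * (d * P p.2) else 0) : 'rV_(n.+1 * n.+1)).
  have Hdd p : dd p *m (T - (p.1 - p.2)%:M) ^+ (n.+1 + n.+1) = 0.
    case: p => a b; rewrite /dd /=; case: ifP => [/andP[as_ bs]|_]; last first.
      by rewrite raddf0 mul0mx.
    have := @ad_generalized_eigenvector x (P a) (d * P b) a b (n.+1 + n.+1) 0 0.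
    rewrite !expr0 mul1r mulr1; apply; first exact: (proj2 (HP a as_)).
      have cP : GRing.comm (x - b%:M) (P b).
        rewrite /GRing.comm mulrBl mulrBr xP; congr (_ - _); exact: (esym (scalar_mxC _ _)).
      by rewrite -mulrA (commrX n.+1 (commr_sym cP)) (proj2 (HP b bs)) mulr0.
    by rewrite add0n.
  have phi0 : phi 0 = 0 by rewrite (phiE 0 a1 a1) ?subrr.
  have [Q HQ] := polynomial_on_generalized_eigenvectors I phi0 (ltn0Sn _) Hdd.
  have Ed : \sum_(p <- I) dd p = (mxvec d : 'rV_(n.+1 * n.+1)).
    rewrite big_allpairs /= -[d in RHS]mul1r -[d in RHS]mulr1 -Ps mulr_suml linear_sum /=.
    apply: eq_big_seq => a as_; rewrite !mulr_sumr linear_sum.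
    by apply: eq_big_seq => b bs; rewrite /dd /= as_ bs.
  have Eyd : \sum_(p <- I) phi (p.1 - p.2) *: dd p = (mxvec (mbr y d) : 'rV_(n.+1 * n.+1)).
    rewrite big_allpairs /= -[d in RHS]mul1r -[d in RHS]mulr1 -Ps mulr_suml.
    have lmbr : linear (mbr y).
      move=> c u v; rewrite /mbr mulrDr mulrDl -scalerAr -scalerAl scalerBr opprD !addrA.
      by rewrite [LHS](ACl (1*3*2*4)).
    have mbr_sum (J : Type) (r : seq J) (E : J -> M) : mbr y (\sum_(j <- r) E j) = \sum_(j <- r) mbr y (E j).
      by rewrite /mbr mulr_sumr mulr_suml -sumrB.
    rewrite mbr_sum linear_sum; apply: eq_big_seq => a as_.
    rewrite !mulr_sumr mbr_sum linear_sum; apply: eq_big_seq => b bs.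
    rewrite /dd /= as_ bs (phiE _ a b) //.
    have -> : mbr y (P a * (d * P b)) = ((f a)%:~R - (f b)%:~R) *: (P a * (d * P b)).
      by rewrite /mbr !mulrA yP // -[_ * y]mulrA Py // -!scalerAl -scalerAr scalerBl.
    by rewrite linearZ.
  pose W (v : 'rV[F]_((n + n * n.+1).+1)) := G (vec_mx (v : 'rV_(n.+1 * n.+1))).
  have HW : subspace W.
    apply: (preim_subspace (g := fun v : 'rV[F]_(n.+1 * n.+1) => vec_mx v)) => // c u v.
    exact: linearP.
  have WT v : W v -> W (v *m T).
    rewrite /W => Gv; have -> : vec_mx (v *m T : 'rV_(n.+1 * n.+1)) = mbr x (vec_mx (v : 'rV_(n.+1 * n.+1))).
      by rewrite -[v *m T]/((v : 'rV_(n.+1 * n.+1)) *m (lin_mx (mulmx x) - lin_mx (mulmxr x))) mulmxBr !mul_rV_lin linearB /= !mxvecK.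
    exact: Gbr.
  have : W (mxvec (mbr y d) : 'rV_(n.+1 * n.+1)).
    rewrite -Eyd HQ Ed; refine (WT _ (horner_mx_stable Q HW WT _)).
    by change (G (vec_mx (mxvec d))); rewrite mxvecK.
  by change (G (vec_mx (mxvec (mbr y d))) -> G (mbr y d)); rewrite mxvecK.
have tr0 z : lspan (fun z => exists u v, G u /\ G v /\ z = mbr u v) z -> \tr (z * y) = 0.
  have W0 : subspace (fun z : M => \tr (z * y) = 0).
    split; first by rewrite mul0r raddf0.
    by move=> c u v Hu Hv; rewrite mulrDl -scalerAl linearD linearZ /= Hu Hv mulr0 addr0.
  move: z; apply: span_min W0 _ => z [u [v [Gu [Gv ->]]]].
  have := Gtr Gu (Gy v Gv); rewrite /mbr mulrBr raddfB /= => /eqP; rewrite subr_eq0 => /eqP E.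
  have E' : \tr (v * u * y) = \tr (u * (y * v)).
    by rewrite -mulrA -[v * _]/(v *m _) mxtrace_mulC -[_ *m v]/(u * y * v) mulrA.
  by rewrite mulrBl raddfB /= E' -mulrA E subrr.
have {}tr0 := tr0 x Dx.
(* On the generalized eigenspace of a, x is a plus a nilpotent, so tr(x y) is the sum of the q(a) a.
   Its vanishing makes q an integer relation; applying f gives a sum of nonnegative integers equal
   to 0, one of them positive. *)
pose q a : int := f a * (\rank (P a))%:R.
have Hq : \sum_(a <- s) (q a)%:~R * a = 0.
  transitivity (\tr (x * y)); last exact: tr0.
  rewrite mulr_sumr raddf_sum /=; apply: eq_big_seq => a as_.
  have [Pa0 HPa] := HP a as_.
  have idP : P a *m P a = P a by have := PP a a as_ as_; rewrite eqxx.
  rewrite -scalerAr linearZ /= /q rmorphM rmorph_nat -mulrA; congr (_ * _).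
  have -> : x * P a = a *: P a + (x - a%:M) * P a.
    by rewrite mulrBl -[a%:M * _]/(a%:M *m _) mul_scalar_mx addrC subrK.
  rewrite mxtraceD mxtraceZ (mxtrace_idem idP) (@mxtrace_nilp _ _ _ n.+1) ?addr0 1?mulrC //.
  have cP : GRing.comm (x - a%:M) (P a).
    rewrite /GRing.comm mulrBl mulrBr xP; congr (_ - _); exact: (esym (scalar_mxC _ _)).
  by rewrite exprMn_comm // [P a ^+ _]exprS mulrA HPa mul0r.
have /eqP := Hf q Hq; rewrite psumr_eq0.
  move/allP/(_ a1 a1s); rewrite /q mulrAC mulf_eq0 mulf_eq0 (negbTE fa1) /=.
  by rewrite pnatr_eq0 mxrank_eq0 (negbTE (proj1 (HP a1 a1s))).
by move=> a _; rewrite /q mulrAC mulr_ge0 // -expr2 sqr_ge0.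
Qed.
End Nilpotency.

Theorem cartan_solvable (L : lmodType F) (br : L -> L -> L) (g : L -> Prop) n
    (rho : L -> 'M[F]_n.+1) :
  subspace g -> (forall x y, g x -> g y -> g (br x y)) -> linear rho ->
  (forall x y, g x -> g y -> rho (br x y) = mbr (rho x) (rho y)) ->
  (forall x y, g x -> g y -> \tr (rho x * rho y) = 0) ->
  exists k, forall x, iter k (derived_set br) g x -> rho x = 0.
Proof.
move=> Hg gbr lrho rhobr rhotr; pose G m := exists2 x, g x & m = rho x.
have GS : subspace G.
  split.
    exists 0; first exact: subsp0.
    by have := lrho (-1) 0 0; rewrite scaler0 addr0 scaleN1r addNr.
  move=> a _ _ [x gx ->] [y gy ->]; exists (a *: x + y); last by rewrite lrho.
  exact: (proj2 Hg).
have Gbr u v : G u -> G v -> G (mbr u v).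
  by move=> [x gx ->] [y gy ->]; exists (br x y); [exact: gbr | rewrite rhobr].
have Gtr u v : G u -> G v -> \tr (u * v) = 0.
  by move=> [x gx ->] [y gy ->]; exact: rhotr.
have [U HU] := vspace_of_subspace
  (span_subspace (fun z => exists u v, G u /\ G v /\ z = mbr u v)).
have UG u : u \in U -> G u.
  by move/HU; apply: span_min => // _ [a [b [Ga [Gb ->]]]]; exact: Gbr.
have Ubr x y : x \in U -> y \in U -> mbr x y \in U.
  by move=> /UG Gx /UG Gy; apply/HU/span_incl; exists x, y.
have Unil x : x \in U -> exists k, x ^+ k = 0.
  by move/HU; exact: (cartan_nilpotent GS Gbr Gtr).
(* [U], the span of all brackets in rho(g), consists of nilpotents. Term j + 1 of the derived series
   is mapped into combinations of products of j + 1 elements of [U], which vanish for j = K. *)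
have [K HK] := engel Ubr Unil; exists K.+1 => x.
pose P j z := exists2 s : seq 'M[F]_n.+1, size s = j /\ (forall y, y \in s -> y \in U)
  & z = \prod_(y <- s) y.
have D1 j y : iter j.+1 (derived_set br) g y -> rho y \in U.
  move=> Dy; apply/HU.
  have {}Dy : derived_set br g y.
    case: j Dy => // j; apply: derived_set_mono => z; exact: (iter_derived_sub Hg gbr (k := j.+1)).
  move: y Dy; apply: span_min.
    by apply: (preim_subspace (g := rho)) => //; exact: span_subspace.
  move=> _ [a [b [ga [gb ->]]]]; rewrite rhobr //; apply: span_incl.
  by exists (rho a), (rho b); split; [exists a | split; [exists b|]].
have DP j y : iter j.+1 (derived_set br) g y -> lspan (P j.+1) (rho y).
  elim: j y => [|j IH] y Dy.
    apply: span_incl; exists [:: rho y]; last by rewrite big_seq1.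
    by split=> // z; rewrite inE => /eqP ->; exact: (D1 0%N).
  move: y Dy; apply: span_min.
    by apply: (preim_subspace (g := rho)) => //; exact: span_subspace.
  move=> _ [a [b [Da [Db ->]]]].
  have [ga gb] : g a /\ g b by split; exact: (iter_derived_sub Hg gbr (k := j.+1)).
  have Ub := D1 _ _ Db; rewrite rhobr //; apply: subspB; first exact: span_subspace.
    move: (rho a) (IH a Da); apply: span_min.
      apply: (preim_subspace (g := fun z => z * rho b)); last exact: span_subspace.
      by move=> c u v; rewrite mulrDl scalerAl.
    move=> _ [s [ss Hs] ->]; apply: span_incl; exists (rcons s (rho b)).
      split; first by rewrite size_rcons ss.
      by move=> z; rewrite mem_rcons inE => /orP[/eqP ->|/Hs].
    by rewrite -cats1 big_cat big_seq1.
  move: (rho a) (IH a Da); apply: span_min.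
    apply: (preim_subspace (g := fun z => rho b * z)); last exact: span_subspace.
    by move=> c u v; rewrite mulrDr scalerAr.
  move=> _ [s [ss Hs] ->]; apply: span_incl; exists (rho b :: s); last by rewrite big_cons.
  split; first by rewrite /= ss.
  by move=> z; rewrite inE => /orP[/eqP ->|/Hs].
move/DP; apply: (@span_min _ _ _ (fun z => z = 0)).
  by split=> // c a b -> ->; rewrite scaler0 addr0.
by move=> _ [s [ss Hs] ->]; apply: (nil_words_le HK) => //; rewrite ss.
Qed.
End CartanCriterion.

(** * Reductive subalgebras *)

Section LieBasics.
Variables (F : fieldType) (L : lmodType F) (br : L -> L -> L).
Hypothesis HL : lie_axioms br.

Lemma br_linl z : linear (br^~ z).
Proof. by case: HL => H _ a x y; exact: H. Qed.
Lemma br_linr z : linear (br z).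
Proof. by case: HL => _ [H _] a x y; exact: H. Qed.
Lemma brxx x : br x x = 0. Proof. by case: HL => _ [_ []]. Qed.
Lemma linear_0 (V W : lmodType F) (g : V -> W) : linear g -> g 0 = 0.
Proof. by move=> lg; have := lg (-1) 0 0; rewrite scaler0 addr0 scaleN1r addNr. Qed.
Lemma linear_D (V W : lmodType F) (g : V -> W) : linear g -> forall x y, g (x + y) = g x + g y.
Proof. by move=> lg x y; rewrite -[x]scale1r lg !scale1r. Qed.
Lemma linear_Z (V W : lmodType F) (g : V -> W) : linear g -> forall a x, g (a *: x) = a *: g x.
Proof. by move=> lg a x; rewrite -[a *: x]addr0 lg linear_0 // addr0. Qed.
Lemma linear_N (V W : lmodType F) (g : V -> W) : linear g -> forall x, g (- x) = - g x.
Proof. by move=> lg x; rewrite -scaleN1r linear_Z // scaleN1r. Qed.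
Lemma linear_B (V W : lmodType F) (g : V -> W) : linear g -> forall x y, g (x - y) = g x - g y.
Proof. by move=> lg x y; rewrite linear_D // linear_N. Qed.

Lemma brDl x y z : br (x + y) z = br x z + br y z. Proof. exact: (linear_D (br_linl z)). Qed.
Lemma brDr x y z : br z (x + y) = br z x + br z y. Proof. exact: (linear_D (br_linr z)). Qed.
Lemma brBl x y z : br (x - y) z = br x z - br y z. Proof. exact: (linear_B (br_linl z)). Qed.
Lemma br0l z : br 0 z = 0. Proof. exact: (linear_0 (br_linl z)). Qed.
Lemma br0r z : br z 0 = 0. Proof. exact: (linear_0 (br_linr z)). Qed.
Lemma brNr x z : br z (- x) = - br z x. Proof. exact: (linear_N (br_linr z)). Qed.

Lemma br_anti x y : br x y = - br y x.
Proof.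
have := brxx (x + y); rewrite brDl !brDr !brxx add0r addr0 => /eqP.
by rewrite addr_eq0 => /eqP.
Qed.

Lemma br_jacobi x y z : br x (br y z) = br (br x y) z + br y (br x z).
Proof.
have J : br x (br y z) + br y (br z x) + br z (br x y) = 0 by case: HL => _ [_ [_]].
rewrite (br_anti z (br x y)) (br_anti z x) brNr in J.
by apply/eqP; rewrite -subr_eq0 opprD addrA -J addrAC.
Qed.

Lemma ideal_subspace (h J : L -> Prop) : ideal_in br h J -> subspace J.
Proof. by case. Qed.

Lemma ideal_closed (h J : L -> Prop) x y : ideal_in br h J -> J x -> J y -> J (br x y).
Proof. by case=> _ [Jh Jbr] Jx Jy; apply: Jbr => //; exact: Jh. Qed.

Lemma derived_set_subspace (S : L -> Prop) : subspace (derived_set br S).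
Proof. exact: span_subspace. Qed.

Lemma derived_set_br (S : L -> Prop) x y : S x -> S y -> derived_set br S (br x y).
Proof. by move=> Sx Sy; apply: span_incl; exists x, y. Qed.

Lemma derived_set_min (S T : L -> Prop) : subspace T ->
  (forall x y, S x -> S y -> T (br x y)) -> forall x, derived_set br S x -> T x.
Proof. by move=> HT H; apply: (span_min HT) => _ [x [y [Sx [Sy ->]]]]; exact: H. Qed.

Lemma derived_ideal (h J : L -> Prop) :
  ideal_in br h J -> ideal_in br h (derived_set br J).
Proof.
move=> HJ; have [sJ [Jh Jbr]] := HJ; split; first exact: derived_set_subspace.
split=> [x|x y hx].
  move=> Dx; apply: Jh; move: x Dx; apply: (derived_set_min sJ) => a b Ja Jb; exact: (ideal_closed HJ).
move: y; apply: (@derived_set_min _ (fun y => derived_set br J (br x y))) => [|a b Ja Jb].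
  by apply: (preim_subspace (br_linr x)); exact: derived_set_subspace.
rewrite br_jacobi; apply: (subspD (derived_set_subspace J)); apply: derived_set_br => //;
  exact: Jbr.
Qed.

Lemma derived_set_sub (h : L -> Prop) : subalg br h -> forall x, derived_set br h x -> h x.
Proof. by case=> sh hbr x; apply: (derived_set_min sh hbr). Qed.

Lemma derived_set_ideal (h : L -> Prop) : subalg br h -> ideal_in br h (derived_set br h).
Proof.
move=> Hh; split; first exact: derived_set_subspace.
split=> [|x y hx /(derived_set_sub Hh) hy]; first exact: derived_set_sub.
exact: derived_set_br.
Qed.

Lemma perfect_iter (J : L -> Prop) : (forall x, J x -> derived_set br J x) ->
  forall k x, J x -> iter k (derived_set br) J x.
Proof.
move=> pJ; elim=> // k IH x /pJ; apply: derived_set_mono; exact: IH.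
Qed.
End LieBasics.

Section LinearCoordinates.
Variables (F : fieldType) (L : lmodType F).

(** The coordinates are built from functionals on [L] that separate [h], so that [c] is linear on
    all of [L] and not only on [h]. The matrices [ad x] then depend linearly on x in [L]. *)
Lemma fin_dim_linear_coords (h : L -> Prop) D (th : 'I_D -> L -> F^o) :
  fin_dim h -> (forall i, linear (th i)) ->
  (forall x, h x -> (forall i, th i x = 0) -> x = 0) ->
  exists d (v : 'I_d -> L) (c : L -> 'rV[F]_d), [/\ linear c, forall i, h (v i),
    forall x, h x -> x = \sum_i c x 0 i *: v i &
    forall u : 'rV[F]_d, c (\sum_i u 0 i *: v i) = u].
Proof.
move=> fh lth inj; have [d [v [c0 [hv hc c0K]]]] := fin_dim_basis fh.
pose B : 'M[F]_(d, D) := \matrix_(i, k) th k (v i).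
pose r x : 'rV[F]_D := \row_k th k x.
have rB (u : 'rV_d) : r (\sum_i u 0 i *: v i) = u *m B.
  apply/rowP => k; rewrite !mxE (linear_comb _ _ (lth k)).
  by apply: eq_bigr => i _; rewrite mxE.
have lr : linear r by move=> a x y; apply/rowP => k; rewrite !mxE lth.
have fB : row_free B.
  rewrite -kermx_eq0; apply/rowV0P => u /sub_kermxP uB.
  have E : \sum_i u 0 i *: v i = 0.
    apply: inj; first exact: (subsp_comb (fin_dim_subspace fh)).
    by move=> k; have /rowP/(_ k) := rB u; rewrite uB !mxE.
  apply/rowP => i; rewrite mxE -(c0K (fun j => u 0 j)) E.
  have <- : \sum_(j < d) (0 : F) *: v j = 0 by rewrite big1 // => j _; rewrite scale0r.
  by rewrite c0K.
have cK (u : 'rV_d) : r (\sum_i u 0 i *: v i) *m pinvmx B = u.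
  by rewrite rB -mulmxA mulmxVp // mulmx1.
exists d, v, (fun x => r x *m pinvmx B); split=> //.
  by move=> a x y; rewrite lr mulmxDl scalemxAl.
move=> x hx; have Ex : x = \sum_i (\row_j c0 x j) 0 i *: v i.
  by rewrite {1}(hc x hx); apply: eq_bigr => i _; rewrite mxE.
rewrite {1}Ex; apply: eq_bigr => i _; congr (_ *: _).
by rewrite [in RHS]Ex cK.
Qed.
End LinearCoordinates.

(** * The Killing form and the structure of a reductive Lie algebra *)

Section Reductive.
Variables (F : closedFieldType) (charF : [pchar F] =i pred0).
Variables (L : lmodType F) (br : L -> L -> L).
Hypothesis HL : lie_axioms br.
Variables (h : L -> Prop) (D : nat) (th : 'I_D -> L -> F^o).
Hypotheses (fh : fin_dim h) (sh : subalg br h) (rh : reductive br h).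
Hypotheses (lth : forall i, linear (th i))
  (inj_th : forall x, h x -> (forall i, th i x = 0) -> x = 0).

Let hbr x y : h x -> h y -> h (br x y). Proof. exact: (proj2 sh). Qed.
Let hs : subspace h. Proof. exact: (proj1 sh). Qed.

Lemma solvable_ideal_central J : ideal_in br h J -> solvable br J ->
  forall x, J x -> forall y, h y -> br y x = 0.
Proof. by move=> HJ sJ x Jx; have [] := rh HJ sJ Jx. Qed.

Lemma central_solvable (J : L -> Prop) :
  (forall x y, J x -> J y -> br x y = 0) -> solvable br J.
Proof.
move=> H; exists 1%N; apply: derived_set_min => //.
by split=> // a u v -> ->; rewrite scaler0 addr0.
Qed.

(* The second term of the upper central series is a solvable ideal, so it is the centre. *)
Lemma second_center x : h x -> (forall a, h a -> forall b, h b -> br b (br a x) = 0) ->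
  forall a, h a -> br a x = 0.
Proof.
move=> hx Hx a ha.
pose J y := h y /\ forall a, h a -> forall b, h b -> br b (br a y) = 0.
apply: (@solvable_ideal_central J) => //.
  split; first split.
  - by split; [exact: subsp0 | move=> u _ w _; rewrite (br0r HL) (br0r HL)].
  - move=> c u w [hu Hu] [hw Hw]; split; first exact: (proj2 hs).
    by move=> y hy z hz; rewrite (br_linr HL) (br_linr HL) Hu // Hw // scaler0 addr0.
  split=> [u []//|u w hu [hw Hw]]; split; first exact: hbr.
  by move=> y hy z hz; rewrite (Hw u hu y hy) (br0r HL).
exists 2%N; apply: derived_set_min.
  by split=> // c u w -> ->; rewrite scaler0 addr0.
have DJ u : derived_set br J u -> forall b, h b -> br b u = 0.
  apply: (@derived_set_min _ _ _ _ (fun u => forall b, h b -> br b u = 0)).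
    split=> [b _|c u1 u2 H1 H2 b hb]; first exact: (br0r HL).
    by rewrite (br_linr HL) H1 // H2 // scaler0 addr0.
  by move=> u1 u2 [h1 _] [_ H2] b hb; exact: H2.
move=> u1 u2 /DJ H1 D2; rewrite (br_anti HL) H1 ?oppr0 //.
move: u2 D2; apply: (derived_set_min hs) => w1 w2 [h1 _] [h2 _]; exact: hbr.
Qed.

Section Killing.
Variables (d : nat) (v : 'I_d.+1 -> L) (c : L -> 'rV[F]_d.+1).
Hypotheses (lc : linear c) (hv : forall i, h (v i))
  (hc : forall x, h x -> x = \sum_i c x 0 i *: v i)
  (cK : forall u : 'rV[F]_d.+1, c (\sum_i u 0 i *: v i) = u).

Definition opmx (E : L -> L) : 'M[F]_d.+1 := \matrix_(i, j) c (E (v j)) 0 i.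

Lemma opmx_comp E E' : linear E -> (forall x, h x -> h (E' x)) ->
  opmx (fun x => E (E' x)) = opmx E *m opmx E'.
Proof.
move=> lE hE'; apply/matrixP => i j; rewrite !mxE.
rewrite {1}(hc (hE' _ (hv j))) (linear_comb _ _ lE) (linear_comb _ _ lc) summxE.
by apply: eq_bigr => k _; rewrite !mxE mulrC.
Qed.

Lemma opmxB E E' : opmx (fun x => E x - E' x) = opmx E - opmx E'.
Proof. by apply/matrixP => i j; rewrite !mxE (linear_B lc) !mxE. Qed.

Definition ad x : 'M[F]_d.+1 := opmx (br x).

Lemma ad_linear : linear ad.
Proof. by move=> a x y; apply/matrixP => i j; rewrite !mxE (br_linl HL) lc !mxE. Qed.

Lemma ad_br x y : h x -> h y -> ad (br x y) = mbr (ad x) (ad y).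
Proof.
move=> hx hy; have {1}-> : ad (br x y) = opmx (fun z => br x (br y z) - br y (br x z)).
  by apply/matrixP => i j; rewrite !mxE (br_jacobi HL x) addrK.
rewrite (opmxB (fun z => br x (br y z)) (fun z => br y (br x z))).
rewrite (opmx_comp (br_linr HL x) (fun z hz => hbr hy hz)).
by rewrite (opmx_comp (br_linr HL y) (fun z hz => hbr hx hz)).
Qed.

Lemma ad_eq0 x : h x -> ad x = 0 -> forall y, h y -> br y x = 0.
Proof.
move=> hx /matrixP ax y hy; rewrite (br_anti HL) (hc hy) (linear_comb _ _ (br_linr HL x)).
rewrite big1 ?oppr0 // => i _; rewrite (hc (hbr hx (hv i))) big1 ?scaler0 // => j _.
by have := ax j i; rewrite !mxE => ->; rewrite scale0r.
Qed.

Lemma ad_central x : (forall y, h y -> br y x = 0) -> ad x = 0.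
Proof.
by move=> Hx; apply/matrixP => i j; rewrite !mxE (br_anti HL) Hx // oppr0 (linear_0 lc) mxE.
Qed.

Definition killing x y : F^o := \tr (ad x *m ad y).

Lemma killing_linr x : linear (killing x).
Proof. by move=> a y z; rewrite /killing ad_linear mulmxDr mxtraceD -scalemxAr mxtraceZ. Qed.
Lemma killing_linl y : linear (killing^~ y).
Proof. by move=> a x z; rewrite /killing ad_linear mulmxDl mxtraceD -scalemxAl mxtraceZ. Qed.
Lemma killingC x y : killing x y = killing y x.
Proof. exact: mxtrace_mulC. Qed.

Lemma killing_invariant x y z : h x -> h y -> h z ->
  killing (br x y) z = killing x (br y z).
Proof.
move=> hx hy hz; rewrite /killing !ad_br // /mbr -!mulmxE mulmxBl mulmxBr !raddfB /= -!mulmxA.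
by congr (_ - _); rewrite mxtrace_mulC mulmxA.
Qed.

(** Cartan's criterion for the adjoint representation makes some term of the derived series of [J]
    central. The next term vanishes, so [J] is solvable, hence central by reductivity. *)
Lemma killing_isotropic_ideal J : ideal_in br h J ->
  (forall x y, J x -> J y -> killing x y = 0) -> forall x, J x -> forall y, h y -> br y x = 0.
Proof.
move=> HJ Jk; have [sJ [Jh Jbr]] := HJ; apply: solvable_ideal_central => //.
have [|||||k Hk] := @cartan_solvable F charF L br J d ad => //.
- by move=> x y; exact: (ideal_closed HJ).
- exact: ad_linear.
- by move=> x y /Jh hx /Jh hy; exact: ad_br.
exists k.+1; apply: derived_set_min.
  by split=> // a u w -> ->; rewrite scaler0 addr0.
have Dh := iter_derived_sub sJ (fun x y Jx Jy => ideal_closed HJ Jx Jy).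
move=> u w Du Dw; apply: ad_eq0; [exact/Jh/(Dh k) | exact: Hk | exact/Jh/(Dh k)].
Qed.

Lemma killing_radical x : h x -> (forall y, h y -> killing x y = 0) ->
  forall y, h y -> br y x = 0.
Proof.
move=> hx Hx; pose J x := h x /\ forall y, h y -> killing x y = 0.
apply: (@killing_isotropic_ideal J) => //; last by move=> u w [_ Hu] [hw _]; exact: Hu.
split; first split.
- by split; [exact: subsp0 | move=> y _; rewrite (linear_0 (killing_linl y))].
- move=> a u w [hu Hu] [hw Hw]; split; first exact: (proj2 hs).
  by move=> y hy; rewrite killing_linl Hu // Hw // scaler0 addr0.
split=> [u []//|u w hu [hw Hw]]; split; first exact: hbr.
by move=> y hy; rewrite (br_anti HL) (linear_N (killing_linl y)) killing_invariant // Hw ?oppr0 //;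
  exact: hbr.
Qed.

Lemma represent_killing (g : L -> F^o) : linear g ->
  (forall w, h w -> (forall y, h y -> br y w = 0) -> g w = 0) ->
  exists2 u, h u & forall w, h w -> killing u w = g w.
Proof.
move=> lg Hg; apply: represent_functional => //; [exact: killing_linr|exact: killing_linl|].
move=> w hw Hw; apply: Hg => //; apply: killing_radical => // y hy.
by rewrite killingC; exact: Hw.
Qed.

(* A functional g on the centre, extended to h, gives the 2-cocycle g([a, b]) = kappa(D a, b);
   D is a derivation modulo the centre, and the cocycle is the coboundary of the element
   representing x |-> tr(D ad x). *)
Lemma derived_cap_center u : derived_set br h u -> (forall y, h y -> br y u = 0) -> u = 0.
Proof.
move=> Du zu; have hu : h u := derived_set_sub sh Du.
rewrite (hc hu); apply: big1 => i0 _; suff -> : c u 0 i0 = 0 by rewrite scale0r.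
pose g x : F^o := c x 0 i0.
have lg : linear g by move=> a x y; rewrite /g lc !mxE.
(* The functional y -> g([v_j, y]) vanishes on the centre, so the Killing form represents it; [Dv j]
   is the value of the map D at the basis vector v_j, and [E] below is its linear extension. *)
have HDv j : exists w, h w /\ forall y, h y -> killing w y = g (br (v j) y).
  have [||w hw Hw] := @represent_killing (fun y => g (br (v j) y)).
  - by move=> a x y; rewrite (br_linr HL) lg.
  - by move=> w hw Hw; rewrite Hw // (linear_0 lg).
  by exists w.
have [Dv HD] := choice HDv.
pose E x := \sum_j c x 0 j *: Dv j.
have lE : linear E.
  move=> a x y; rewrite /E scaler_sumr -big_split; apply: eq_bigr => j _.
  by rewrite lc !mxE scalerDl scalerA.
have hE x : h (E x) by apply: (subsp_comb hs) => j; exact: (proj1 (HD j)).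
have Ek a b : h a -> h b -> killing (E a) b = g (br a b).
  move=> ha hb; rewrite (linear_comb _ _ (killing_linl b)).
  rewrite {2}(hc ha) (linear_comb _ _ (br_linl HL b)) (linear_comb _ _ lg).
  by apply: eq_bigr => j _; rewrite (proj2 (HD j)).
have [||d0 hd0 Hd0] := @represent_killing (fun x => \tr (opmx E *m ad x)).
- by move=> a x y; rewrite ad_linear mulmxDr mxtraceD -scalemxAr mxtraceZ.
- by move=> w hw Hw; rewrite ad_central // mulmx0 mxtrace0.
have Hg a b : h a -> h b -> g (br a b) = killing d0 (br a b).
  move=> ha hb; rewrite -Ek // Hd0; last exact: hbr.
  (* The failure of [E] to be a derivation. By invariance of the form it has central values, so ad b
     kills it and it contributes nothing to the trace against ad b. *)
  pose Z x := E (br a x) - br a (E x) - br (E a) x.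
  have zZ x : h x -> forall y, h y -> br y (Z x) = 0.
    move=> hx; have hax := hbr ha hx; have hZ : h (Z x).
      by apply: subspB => //; [apply: subspB => //|]; apply: hbr.
    apply: killing_radical => // y hy.
    have k1 : killing (E (br a x)) y = g (br (br a x) y) by apply: Ek.
    have k2 : killing (br a (E x)) y = - g (br x (br a y)).
      rewrite (br_anti HL) (linear_N (killing_linl y)) killing_invariant // Ek //.
      exact: hbr.
    have k3 : killing (br (E a) x) y = g (br a (br x y)).
      by rewrite killing_invariant // Ek //; exact: hbr.
    rewrite !(linear_B (killing_linl y)) k1 k2 k3 (br_jacobi HL a x y) (linear_D lg) opprK.
    exact: subrr.
  have hZ x : h x -> h (Z x).
    by move=> hx; apply: subspB => //; [apply: subspB => //|]; apply: hbr => //; exact: hbr.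
  have EZ : opmx Z = opmx E *m ad a - ad a *m opmx E - ad (E a).
    transitivity (opmx (fun x => E (br a x) - br a (E x)) - ad (E a)); first exact: opmxB.
    rewrite (opmxB (fun x => E (br a x)) (fun x => br a (E x))).
    rewrite (opmx_comp lE (fun x hx => hbr ha hx)).
    by rewrite (opmx_comp (br_linr HL a) (fun x _ => hE x)).
  have bZ : ad b *m opmx Z = 0.
    rewrite -(opmx_comp (br_linr HL b) hZ).
    by apply/matrixP => i j; rewrite !mxE zZ // (linear_0 lc) mxE.
  rewrite /killing; have -> : ad (E a) = opmx E *m ad a - ad a *m opmx E - opmx Z.
    by rewrite EZ opprB addrCA subrr addr0.
  rewrite mulmxBl raddfB /= [\tr (opmx Z *m _)]mxtrace_mulC bZ mxtrace0 subr0.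
  rewrite ad_br // /mbr -!mulmxE mulmxBl mulmxBr !raddfB /= mulmxA; congr (_ - _).
  by rewrite -mulmxA mxtrace_mulC mulmxA.
have : g u = killing d0 u.
  move: u Du {hu zu}; apply: (@derived_set_min _ _ br h (fun u => g u = killing d0 u)) => //.
  by split=> [|a x y E1 E2]; rewrite ?(linear_0 lg) ?(linear_0 (killing_linr d0)) // lg
     killing_linr E1 E2.
by rewrite /killing (ad_central zu) mulmx0 mxtrace0.
Qed.

(** Invariance puts every [a, x] in the radical of the form, so x is in the second centre, which is
    the centre. *)
Lemma killing_orthogonal_derived x : h x ->
  (forall y, derived_set br h y -> killing x y = 0) -> forall y, h y -> br y x = 0.
Proof.
move=> hx Hx; apply: second_center => // a ha; apply: killing_radical; first exact: hbr.
move=> b hb; rewrite (br_anti HL) (linear_N (killing_linl b)) killing_invariant //.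
by rewrite Hx ?oppr0 //; exact: derived_set_br.
Qed.

(** The form is nondegenerate on [h, h], because an element of [h, h] orthogonal to it is central
    and hence 0. So x has an orthogonal projection s to [h, h], and x - s is central. *)
Lemma reductive_decomposition x : h x ->
  exists2 s, derived_set br h s & forall y, h y -> br y (x - s) = 0.
Proof.
move=> hx; have Dh := derived_set_sub sh.
have [|||||u Du Hu] := @represent_functional F L (derived_set br h) killing (killing x).
- by apply: fin_dim_sub fh _ _ => //; exact: derived_set_subspace.
- exact: killing_linr.
- exact: killing_linl.
- exact: killing_linr.
- move=> w Dw Hw; rewrite (_ : w = 0) ?(linear_0 (killing_linr x)) //.
  apply: derived_cap_center => //; apply: killing_orthogonal_derived; first exact: Dh.
  by move=> y Dy; rewrite killingC; exact: Hw.
exists u => //; apply: killing_orthogonal_derived; first by apply: subspB => //; exact: Dh.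
by move=> y Dy; rewrite (linear_B (killing_linl y)) Hu // subrr.
Qed.

(** The form is nondegenerate on [J, J], since its radical there is an isotropic ideal, hence
    central in [h, h]. The complement C of [J, J] inside J commutes with J by invariance, so it is
    an abelian ideal, central, and therefore 0. *)
Lemma reductive_perfect_ideal J : ideal_in br h J -> (forall x, J x -> derived_set br h x) ->
  forall x, J x -> derived_set br J x.
Proof.
move=> HJ JS u Ju; have [sJ [Jh Jbr]] := HJ.
have DJ := derived_ideal HL HJ; have [sDJ [DJh DJbr]] := DJ.
have subJ x : derived_set br J x -> J x.
  by move: x; apply: (derived_set_min sJ) => a b Ja Jb; exact: (ideal_closed HJ).
have nondeg w : derived_set br J w -> (forall y, derived_set br J y -> killing y w = 0) -> w = 0.
  move=> Dw Hw; apply: derived_cap_center; first exact/JS/subJ.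
  pose R x := derived_set br J x /\ forall y, derived_set br J y -> killing y x = 0.
  apply: (@killing_isotropic_ideal R) => //; last by move=> a b [Ha _] [_ Hb]; exact: Hb.
  split; first split.
  - by split; [exact: subsp0 | move=> y _; rewrite (linear_0 (killing_linr y))].
  - move=> a x z [Dx Hx] [Dz Hz]; split; first exact: (proj2 sDJ).
    by move=> y Dy; rewrite killing_linr Hx // Hz // scaler0 addr0.
  split=> [x [/DJh]//|x z hx [Dz Hz]]; split; first exact: DJbr.
  move=> y Dy; rewrite -killing_invariant ?Hz //; try exact: DJh.
  by rewrite (br_anti HL); apply: (subspN sDJ); exact: DJbr.
have [|||||u' Du' Hu'] := @represent_functional F L (derived_set br J) killing (killing u).
- by apply: fin_dim_sub fh _ _.
- exact: killing_linr.
- exact: killing_linl.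
- exact: killing_linr.
- by move=> w Dw Hw; rewrite (nondeg w Dw Hw) (linear_0 (killing_linr u)).
pose C x := J x /\ forall y, derived_set br J y -> killing x y = 0.
have CJ x y : C x -> J y -> br x y = 0.
  move=> [Jx Hx] Jy; apply: nondeg; first exact: derived_set_br.
  move=> z Dz; rewrite killingC killing_invariant; try exact: Jh; last exact/Jh/subJ.
  by apply: Hx; apply: derived_set_br => //; exact: subJ.
have HC : ideal_in br h C.
  split; first split.
  - by split; [exact: subsp0 | move=> y _; rewrite (linear_0 (killing_linl y))].
  - move=> a x z [Jx Hx] [Jz Hz]; split; first exact: (proj2 sJ).
    by move=> y Dy; rewrite killing_linl Hx // Hz // scaler0 addr0.
  split=> [x [/Jh]//|x z hx [Jz Hz]]; split; first exact: Jbr.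
  move=> y Dy; rewrite (br_anti HL) (linear_N (killing_linl y)) killing_invariant //.
  - by rewrite Hz ?oppr0 //; exact: DJbr.
  - exact: Jh.
  - exact: DJh.
have Cu : C (u - u').
  split; first by apply: subspB => //; exact: subJ.
  by move=> y Dy; rewrite (linear_B (killing_linl y)) Hu' // subrr.
suff E : u - u' = 0 by rewrite (_ : u = u') //; apply/eqP; rewrite -subr_eq0 E.
apply: derived_cap_center; first exact/JS/(proj1 Cu).
apply: (@solvable_ideal_central C) => //.
by apply: central_solvable => x y Cx [Jy _]; exact: CJ.
Qed.
End Killing.

Theorem reductive_structure :
  [/\ forall u, derived_set br h u -> (forall y, h y -> br y u = 0) -> u = 0,
      forall x, h x -> exists2 s, derived_set br h s & forall y, h y -> br y (x - s) = 0 &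
      forall J, ideal_in br h J -> (forall x, J x -> derived_set br h x) ->
        forall x, J x -> derived_set br J x].
Proof.
(* The zero algebra is treated apart, as matrices form a nonzero ring only in positive size. *)
have [[|d] [v [c [lc hv hc cK]]]] := fin_dim_linear_coords fh lth inj_th.
  have h0 x : h x -> x = 0 by move=> /hc ->; rewrite big_ord0.
  split=> [u /(derived_set_sub sh)/h0 //|x hx|J [sJ [Jh _]] _ x /Jh/h0 ->].
    exists 0; first exact: (subsp0 (derived_set_subspace _ _)).
    by move=> y _; rewrite (h0 x) // subr0 (br0r HL).
  exact: (subsp0 (derived_set_subspace _ _)).
split; [exact: (derived_cap_center lc hv hc) | exact: (reductive_decomposition lc hv hc)|].
exact: (reductive_perfect_ideal lc hv hc).
Qed.

(* A nonzero radical of the trace form on a perfect ideal would be solvable by Cartan's criterion. *)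
Theorem trace_form_nondegenerate n (rho : L -> 'M[F]_n.+1) J :
  linear rho -> (forall x y, h x -> h y -> rho (br x y) = mbr (rho x) (rho y)) ->
  ideal_in br h J -> (forall x, J x -> derived_set br h x) ->
  forall x, J x -> (forall y, J y -> \tr (rho x * rho y) = 0) -> rho x = 0.
Proof.
move=> lrho rhobr HJ JS x Jx Hx; have [sJ [Jh Jbr]] := HJ.
have [_ _ perf] := reductive_structure.
pose R x := J x /\ forall y, J y -> \tr (rho x * rho y) = 0.
have ltr y : linear (fun x => \tr (rho x * rho y) : F^o).
  by move=> a u w; rewrite lrho mulrDl mxtraceD -scalerAl mxtraceZ.
have HR : ideal_in br h R.
  split; first split.
  - by split; [exact: subsp0 | move=> y _; rewrite (linear_0 (ltr y))].
  - move=> a u w [Ju Hu] [Jw Hw]; split; first exact: (proj2 sJ).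
    by move=> y Jy; rewrite ltr Hu // Hw // scaler0 addr0.
  split=> [u [/Jh]//|u w hu [Jw Hw]]; split; first exact: Jbr.
  move=> y Jy; have hy := Jh _ Jy; have hw := Jh _ Jw.
  have <- : - \tr (rho w * rho (br u y)) = \tr (rho (br u w) * rho y).
    rewrite !rhobr // /mbr mulrBr mulrBl [\tr (_ - _)]raddfB [\tr (_ * _ - _)]raddfB /= !mulrA.
    have -> : \tr (rho u * rho w * rho y) = \tr (rho w * rho y * rho u).
      by rewrite -mulrA -[rho u * _]/(rho u *m _) mxtrace_mulC.
    exact: opprB.
  by rewrite Hw ?oppr0 //; exact: Jbr.
have [|||||k Hk] := @cartan_solvable F charF L br R n rho => //.
- exact: (ideal_subspace HR).
- by move=> u w Ru Rw; exact: (ideal_closed HR).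
- by move=> u w [Ju _] [Jw _]; apply: rhobr; exact: Jh.
- by move=> u w [_ Hu] [Jw _]; exact: Hu.
apply/Hk/perfect_iter => [u Ru|]; last by split.
by apply: perf => // w [/JS].
Qed.
End Reductive.

(** * Primitive idempotents of the enveloping algebra of a representation *)

Section FinitaryElements.
Variables (F : closedFieldType) (charF : [pchar F] =i pred0).
Local Notation R := (emx F).
Implicit Types a b e p q : R.

Lemma bounded_exp N a k : bounded N a -> bounded N (a ^+ k.+1).
Proof. by move=> Ha; elim: k => [|k IH]; rewrite ?expr1 // exprS; exact: bounded_mul. Qed.

Lemma trunc_exp N a k : bounded N a -> trunc N (a ^+ k.+1) = trunc N a ^+ k.+1.
Proof.
move=> Ha; elim: k => [|k IH]; first by rewrite !expr1.
by rewrite exprS (trunc_mull Ha (proj1 (bounded_exp k Ha))) IH [in RHS]exprS.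
Qed.

Lemma tr_nilpotent a k : fin a -> a ^+ k = 0 -> tr a = 0.
Proof.
move=> fa ak; have [N HN] := fin_bounded fa.
rewrite (trE HN); apply: (@mxtrace_nilp _ _ _ k.+1).
by rewrite -trunc_exp // exprSr ak mul0r linear0.
Qed.

Lemma tr_idempotent e : fin e -> e * e = e -> exists2 m : nat, tr e = m%:R & e != 0 -> (0 < m)%N.
Proof.
move=> fe ee; have [N HN] := fin_bounded fe.
exists (\rank (trunc N e)).
  by rewrite (trE HN) mxtrace_idem // -(trunc_mull HN fe) ee.
rewrite lt0n mxrank_eq0; apply: contra => /eqP e0; apply/eqP.
by apply: (trunc_inj HN (proj1 (bounded_sub _ N))); rewrite e0 linear0.
Qed.

Definition polynomial_in a p := exists m (c : 'I_m -> F), p = \sum_j c j *: a ^+ j.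

Lemma polynomial_in_comm a p : polynomial_in a p -> a * p = p * a.
Proof.
case=> m [c ->]; rewrite mulr_sumr mulr_suml; apply: eq_bigr => j _.
by rewrite -scalerAr -scalerAl -exprS exprSr.
Qed.

Lemma fin_idempotent a : fin a -> (forall k, a ^+ k.+1 != 0) ->
  exists2 p, polynomial_in a p & a * p != 0 /\ (a * p) * (a * p) = a * p.
Proof.
move=> fa na; have [N /(bounded_le (leqnSn N)) HN] := fin_bounded fa.
have [k|q qn0 qq] := @idempotent_polynomial F N (trunc N.+1 a).
  case: k => [|k]; first by rewrite expr0 oner_eq0.
  apply/negP => /eqP; rewrite -trunc_exp // => E; case/negP: (na k); apply/eqP.
  by apply: (trunc_inj (bounded_exp k HN) (proj1 (bounded_sub _ _))); rewrite E linear0.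
pose p := \sum_(j < size q) q`_j *: a ^+ j.
have Ep : a * p = \sum_(j < size q) q`_j *: a ^+ j.+1.
  by rewrite mulr_sumr; apply: eq_bigr => j _; rewrite -scalerAr -exprS.
have bp : bounded N.+1 (a * p).
  by rewrite Ep; apply: (subsp_comb (bounded_sub _ _)) => j; exact: bounded_exp.
have Et : trunc N.+1 (a * p) = trunc N.+1 a * horner_mx (trunc N.+1 a) q.
  have -> : horner_mx (trunc N.+1 a) q = \sum_(j < size q) q`_j *: trunc N.+1 a ^+ j.
    rewrite -[in LHS](coefK q) poly_def raddf_sum; apply: eq_bigr => j _.
    by rewrite /= horner_mxZ rmorphXn /= horner_mx_X.
  rewrite Ep linear_sum mulr_sumr.
  apply: eq_bigr => j _; rewrite linearZ /= trunc_exp //.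
  by rewrite -scalerAr -exprS.
exists p; first by exists (size q), (fun j => q`_j).
split.
  by apply: contra qn0 => /eqP E; rewrite -Et E linear0.
apply: (trunc_inj (bounded_mul bp bp) bp).
by rewrite (trunc_mull bp (proj1 bp)) Et -[_ *m _]/(_ * _) qq.
Qed.
End FinitaryElements.

Section WordAlgebra.
Variables (F : closedFieldType) (charF : [pchar F] =i pred0).
Variables (L : lmodType F) (br : L -> L -> L).
Hypothesis HL : lie_axioms br.
Local Notation R := (emx F).

Definition lie_rep (g : L -> R) : Prop :=
  [/\ linear g, forall x y, g (br x y) = g x * g y - g y * g x & forall x, fin (g x)].

Variable f : L -> R.
Hypothesis Hf : lie_rep f.

Definition fword (w : seq L) : R := \prod_(x <- w) f x.
Definition walg : R -> Prop := lspan (fun z => exists w, z = fword w).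
Definition walg_plus : R -> Prop := lspan (fun z => exists2 w, w != [::] & z = fword w).

Lemma walg_sub : subspace walg. Proof. exact: span_subspace. Qed.
Lemma walg_plus_sub : subspace walg_plus. Proof. exact: span_subspace. Qed.
Lemma walg_word w : walg (fword w). Proof. by apply: span_incl; exists w. Qed.
Lemma walg1 : walg 1. Proof. by have := walg_word [::]; rewrite /fword big_nil. Qed.
Lemma walg_f x : walg (f x). Proof. by have := walg_word [:: x]; rewrite /fword big_seq1. Qed.

Lemma mull_subspace (W : R -> Prop) c : subspace W -> subspace (fun a => W (a * c)).
Proof.
by apply: (preim_subspace (g := fun a : R => a * c)) => k x y; rewrite mulrDl scalerAl.
Qed.
Lemma mulr_subspace (W : R -> Prop) c : subspace W -> subspace (fun a => W (c * a)).
Proof.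
by apply: (preim_subspace (g := fun a : R => c * a)) => k x y; rewrite mulrDr scalerAr.
Qed.

Lemma walgM a b : walg a -> walg b -> walg (a * b).
Proof.
move=> Wa; move: b; apply: span_min; first exact/mulr_subspace/walg_sub.
move=> _ [w ->]; move: a Wa; apply: span_min; first exact/mull_subspace/walg_sub.
by move=> _ [w' ->]; have := walg_word (w' ++ w); rewrite /fword big_cat.
Qed.

Lemma walg_plusE b : walg_plus b -> walg b.
Proof. by apply: span_mono => _ [w _ ->]; exists w. Qed.

Lemma walg_plus_fin b : walg_plus b -> fin b.
Proof.
move: b; apply: span_min; first exact: fin_sub.
move=> _ [[//|x w] _ ->]; rewrite /fword big_cons; apply: fin_mull.
by case: Hf => _ _; apply.
Qed.

Lemma walg_plus_mul a x c : walg a -> walg c -> walg_plus (a * f x * c).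
Proof.
move=> Wa Wc; move: c Wc; apply: span_min; first exact/mulr_subspace/walg_plus_sub.
move=> _ [w ->]; move: a Wa; apply: span_min.
  exact: (mull_subspace (f x) (mull_subspace (fword w) walg_plus_sub)).
move=> _ [w' ->]; apply: span_incl; exists (w' ++ x :: w); last first.
  by rewrite /fword big_cat big_cons /= mulrA.
by case: w'.
Qed.

Definition wideal (X : L -> Prop) : R -> Prop :=
  lspan (fun z => exists a x c, [/\ walg a, X x, walg c & z = a * f x * c]).

Lemma wideal_sub X : subspace (wideal X). Proof. exact: span_subspace. Qed.
Lemma wideal_plus X b : wideal X b -> walg_plus b.
Proof.
move: b; apply: span_min; first exact: walg_plus_sub.
by move=> _ [a [x [c [Wa _ Wc ->]]]]; exact: walg_plus_mul.
Qed.
Lemma wideal_mulr X a b : walg a -> wideal X b -> wideal X (b * a).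
Proof.
move=> Wa; move: b; apply: span_min; first exact/mull_subspace/wideal_sub.
move=> _ [b [x [c [Wb Xx Wc ->]]]]; apply: span_incl; exists b, x, (c * a).
by split; rewrite ?mulrA //; exact: walgM.
Qed.

Lemma polynomial_in_walg a p : walg a -> polynomial_in a p -> walg p.
Proof.
move=> Wa [m [c ->]]; apply: (subsp_comb walg_sub) => j.
by elim: (j : nat) => [|k IH]; rewrite ?expr0 ?exprS; [exact: walg1 | exact: walgM].
Qed.

(** When every element of e BB e is a scalar multiple of e plus a nilpotent, p -> tr(e p) / n is
    multiplicative on e BB e. The last clause records this multiplicativity, which is how
    primitivity is used later. *)
Definition primitive e n :=
  [/\ walg_plus e, e * e = e, tr e = n%:R, (0 < n)%N &
      forall p q, walg p -> walg q -> n%:R * tr (e * p * e * q) = tr (e * p) * tr (e * q)].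

Section MinimalIdempotent.
Variables (X : L -> Prop) (e : R) (n : nat).
Hypotheses (Ie : wideal X e) (ee : e * e = e) (e0 : e != 0) (te : tr e = n%:R).
Hypothesis emin : forall e' m, wideal X e' -> e' * e' = e' -> e' != 0 -> tr e' = m%:R -> (n <= m)%N.

Let fe : fin e. Proof. exact/walg_plus_fin/(wideal_plus (X := X)). Qed.
Let We : walg e. Proof. exact/walg_plusE/(wideal_plus (X := X)). Qed.

Let n0 : (0 < n)%N.
Proof.
have [m tm m0] := tr_idempotent fe ee; move: tm; rewrite te => /eqP.
have := natr_eq0_pchar0 charF n; rewrite -[n]subn0; case: (n) te => // /esym te0 _ /eqP E.
by have := m0 e0; rewrite lt0n -(natr_eq0_pchar0 charF) -E eqxx.
Qed.

(** A non-nilpotent b has a nonzero idempotent e' = b q with q a polynomial in b. If e' differed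
    from e, then e' and e - e' would both have trace at least n with sum n. So e' = e and q inverts
    b. *)
Lemma corner_invertible p : walg p -> (exists k, (e * p * e) ^+ k.+1 = 0) \/
  exists2 q, walg q & e * p * e * q = e /\ q * (e * p * e) = e.
Proof.
move=> Wp; set b := e * p * e.
case: (pselect (exists k, b ^+ k.+1 = 0)) => [|nb]; [by left|right].
have Ib : wideal X b by apply: wideal_mulr We _; exact: wideal_mulr.
have fb : fin b by exact/walg_plus_fin/(wideal_plus (X := X)).
have [|q qb [bq0 bqbq]] := fin_idempotent fb.
  by move=> k; apply/negP => /eqP E; apply: nb; exists k.
have Wq : walg q by apply: polynomial_in_walg qb; exact/walg_plusE/(wideal_plus (X := X)).
have Cq := polynomial_in_comm qb.
exists q => //; rewrite -Cq.
suff : b * q = e by [].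
set e' := b * q in bq0 bqbq *.
have ee' : e * e' = e' by rewrite /e' /b !mulrA ee.
have e'e : e' * e = e' by rewrite /e' Cq /b -!mulrA ee.
have Ie' : wideal X e' by exact: wideal_mulr.
have Id : wideal X (e - e') by exact: (subspB (wideal_sub X)).
have dd : (e - e') * (e - e') = e - e'.
  by rewrite mulrBl !mulrBr ee ee' e'e bqbq subrr subr0.
have [m tm m0] := tr_idempotent (walg_plus_fin (wideal_plus Ie')) bqbq.
have [m' tm' m0'] := tr_idempotent (walg_plus_fin (wideal_plus Id)) dd.
apply/eqP; rewrite eq_sym -subr_eq0; apply: contraT => d0.
have l1 := emin Ie' bqbq bq0 tm; have l2 := emin Id dd d0 tm'.
have /eqP : (n%:R : F) = (m + m')%:R by rewrite natrD -tm -tm' -te linearB /= addrC subrK.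
rewrite -subr_eq0 -opprB -natrB; last by rewrite (leq_trans l1) ?leq_addr.
rewrite oppr_eq0 natr_eq0_pchar0 // subn_eq0 => l3.
have := leq_add l1 l2 => /leq_trans/(_ l3); rewrite -{3}[n]addn0 leq_add2l leqn0.
by rewrite (gtn_eqF n0).
Qed.

(** By Cayley-Hamilton on a truncation, the product of b - z e over eigenvalues z is 0. So some b -
    z e is not invertible in the corner, hence nilpotent. *)
Lemma corner_scalar p : walg p -> exists c k, (e * p * e - c *: e) ^+ k.+1 = 0.
Proof.
move=> Wp; set b := e * p * e.
have fb : fin b by apply: fin_mulr.
have [N1 H1] := fin_bounded fb; have [N2 H2] := fin_bounded fe.
pose N := (maxn N1 N2).
have bb : bounded N.+1 b by apply: bounded_le H1; rewrite leqW // leq_maxl.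
have be : bounded N.+1 e by apply: bounded_le H2; rewrite leqW // leq_maxr.
have [rs] := closed_field_poly_normal (char_poly (trunc N.+1 b)).
rewrite (monicP (char_poly_monic _)) scale1r => Ers.
have Eprod u (s : seq F) : bounded N.+1 u ->
    bounded N.+1 (u * \prod_(z <- s) (b - z%:A)) /\
    trunc N.+1 (u * \prod_(z <- s) (b - z%:A)) =
    trunc N.+1 u * \prod_(z <- s) (trunc N.+1 b - z%:M).
  elim: s u => [|z s IH] u bu; first by rewrite !big_nil !mulr1.
  have Eu : u * (b - z%:A) = u * b - z *: u by rewrite mulrBr -scalerAr mulr1.
  have bu' : bounded N.+1 (u * (b - z%:A)).
    rewrite Eu; apply: (subspB (bounded_sub _ _)); first exact: bounded_mul.
    exact: (subspZ (bounded_sub _ _)).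
  rewrite !big_cons !mulrA; have [H3 ->] := IH _ bu'; split=> //; congr (_ * _).
  rewrite Eu linearB linearZ /= (trunc_mull bu (proj1 bb)) mulrBr; congr (_ - _).
  by rewrite -[_ * _%:M]/(_ *m _%:M) mul_mx_scalar.
have Ee : e * \prod_(z <- rs) (b - z%:A) = 0.
  have [H3 H4] := Eprod e rs be; apply: (trunc_inj H3 (proj1 (bounded_sub _ _))).
  rewrite linear0 H4; suff -> : \prod_(z <- rs) (trunc N.+1 b - z%:M) = 0 by rewrite mulr0.
  have := Cayley_Hamilton (trunc N.+1 b); rewrite Ers rmorph_prod => <- /=.
  by apply: eq_bigr => z _; rewrite rmorphB /= horner_mx_X horner_mx_C.
have eb : e * b = b by rewrite /b !mulrA ee.
have be' : b * e = b by rewrite /b -!mulrA ee.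
apply: contrapT => H.
have inv z : exists2 q, walg q & q * (b - z *: e) = e.
  have Ez : b - z *: e = e * (p - z%:A) * e.
    by rewrite mulrBr mulrBl -scalerAr mulr1 -scalerAl ee.
  have Wz : walg (p - z%:A).
    by apply: (subspB walg_sub) => //; apply: (subspZ walg_sub); exact: walg1.
  have [[k Hk]|[q Wq [_ Hq]]] := corner_invertible Wz; last by exists q; rewrite ?Ez.
  by case: H; exists z, k; rewrite Ez.
have [q] : exists q, q * (e * \prod_(z <- rs) (b - z%:A)) = e.
  elim: (rs) => [|z s [q IH]]; first by exists e; rewrite big_nil mulr1.
  have [qz _ Hz] := inv z; exists (q * qz); rewrite big_cons -mulrA [e * _]mulrA.
  have -> : e * (b - z%:A) = b - z *: e by rewrite mulrBr eb -scalerAr mulr1.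
  have Eb : b - z *: e = (b - z *: e) * e by rewrite mulrBl be' -scalerAl ee.
  by rewrite [qz * _]mulrA Hz.
by rewrite Ee mulr0 => E; move: e0; rewrite -E eqxx.
Qed.

(** If b is nilpotent then b c is not invertible in the corner, for otherwise the powers of b could
    be cancelled down to e = 0. So b c is nilpotent as well and has trace 0. *)
Lemma corner_nil p q k : walg p -> walg q -> (e * p * e) ^+ k.+1 = 0 ->
  tr (e * p * e * (e * q * e)) = 0.
Proof.
move=> Wp Wq Hk; set b := e * p * e in Hk *.
have Wb : walg b by apply: walgM We; exact: walgM.
have Er : b * (e * q * e) = e * (p * e * q) * e by rewrite /b !mulrA -[_ * e * e]mulrA ee.
have [[j Hj]|[r Wr [Hr _]]] := corner_invertible (walgM (walgM Wp We) Wq).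
  by rewrite Er; apply: tr_nilpotent Hj; apply: fin_mulr.
case/negP: e0; apply/eqP; rewrite -Er -mulrA in Hr.
have be : b * e = b by rewrite /b -!mulrA ee.
elim: k Hk => [|k IH] Hk; first by rewrite -Hr -[b]expr1 Hk mul0r.
apply: IH; have -> : b ^+ k.+1 = b ^+ k.+1 * e by rewrite exprSr -mulrA be.
by rewrite -Hr mulrA -exprSr Hk mul0r.
Qed.

Lemma minimal_idempotent_primitive : primitive e n.
Proof.
split=> //; first exact: (wideal_plus Ie).
move=> p q Wp Wq; have [c [k Hk]] := corner_scalar Wp.
have cyc r : tr (e * r) = tr (e * r * e) by rewrite [RHS]trC !mulrA ee.
have tp : tr (e * p) = c * n%:R.
  have fz : fin (e * p * e - c *: e).
    by apply: (subspB (fin_sub _)); [apply: fin_mulr | apply: (subspZ (fin_sub _))].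
  have := tr_nilpotent fz Hk; rewrite linearB linearZ /= te -cyc => /eqP.
  by rewrite subr_eq0 => /eqP.
have Ez : e * p * e - c *: e = e * (p - c%:A) * e.
  by rewrite mulrBr mulrBl -scalerAr mulr1 -scalerAl ee.
have Wz : walg (p - c%:A).
  by apply: (subspB walg_sub) => //; apply: (subspZ walg_sub); exact: walg1.
rewrite Ez in Hk; have := corner_nil Wz Wq Hk.
have E1 : e * p * e * (e * q * e) = e * (p * e * q) * e by rewrite !mulrA -[_ * e * e]mulrA ee.
have E2 : e * (e * q * e) = e * q * e by rewrite !mulrA ee.
rewrite -Ez mulrBl -scalerAl E1 E2 linearB linearZ /= -!cyc => /eqP; rewrite subr_eq0 => /eqP E.
have -> : e * p * e * q = e * (p * e * q) by rewrite !mulrA.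
by rewrite E tp mulrCA mulrA.
Qed.
End MinimalIdempotent.

End WordAlgebra.

(** * Bounding the number of inequivalent primitive idempotents *)

Section InequivalentIdempotents.
Variables (F : closedFieldType) (charF : [pchar F] =i pred0).
Variables (L : lmodType F) (br : L -> L -> L) (f : L -> emx F).
Hypothesis Hf : lie_rep br f.
Local Notation R := (emx F).
Implicit Types e a b c : R.

Definition killed e (x : L) : Prop :=
  forall a c, walg f a -> walg f c -> tr (e * a * f x * c) = 0.

Definition inequivalent e e' : Prop :=
  forall a b, walg f a -> walg f b -> tr (e * a * e' * b) = 0.

Lemma inequivalent_sym e e' : inequivalent e e' -> inequivalent e' e.
Proof.
move=> H a b Wa Wb; rewrite -(H b a Wb Wa).
by rewrite -[e' * a * e * b]mulrA trC !mulrA.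
Qed.

Lemma trunc_mul_col N a b : fin a -> fin b -> a * eid F N = a ->
  trunc N (a * b) = trunc N a *m trunc N b.
Proof.
move=> fa fb aE; apply/matrixP => i j; rewrite !mxE.
have [M HM] := fin_bounded fa; rewrite (ent_mull _ _ HM fb).
have H k : (N <= k)%N -> ent a i k * ent b k j = 0.
  by move=> le; rewrite -aE ent_eidr // ltnNge le mul0r.
rewrite (@sum_widen F^o M N (fun k => ent a i k * ent b k j)) //.
  by apply: eq_bigr => k _; rewrite !mxE.
by move=> k Hk; rewrite (proj2 HM) ?mul0r //; right.
Qed.

Lemma tr_col N a : fin a -> a * eid F N = a -> tr a = \tr (trunc N a).
Proof.
move=> fa aE.
have E : tr a = tr (eid F N * a * eid F N).
  by rewrite -{1}aE trC -[in RHS]mulrA aE.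
rewrite E (trE (eid_bounded N fa)); apply: eq_bigr => i _.
by rewrite !mxE ent_eid // ltn_ord.
Qed.

(** Linearity extends the hypothesis to tr(H q(H)) = sum of n_i t_i q(t_i) with t_i = i + 1. Taking
    q as the characteristic polynomial times the product of X - t_j over j distinct from i shows
    that t_i is an eigenvalue. *)
Lemma power_sums_bound N k (H : 'M[F]_N.+1) (n : nat -> nat) :
  (forall i, (i < k)%N -> (0 < n i)%N) ->
  (forall m, \tr (H ^+ m.+1) = \sum_(i < k) (i.+1)%:R ^+ m.+1 * (n i)%:R) -> (k <= N.+1)%N.
Proof.
move=> n0 Htr; pose t i : F := (i.+1)%:R.
have tn0 i : t i != 0 by rewrite (natr_eq0_pchar0 charF).
have tinj i j : t i = t j -> i = j.
  wlog le : i j / (i <= j)%N => [hw|].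
    by case/orP: (leq_total i j) => le E; [|symmetry; symmetry in E]; exact: hw E.
  move=> /esym/eqP; rewrite /t -subr_eq0 -natrB ?ltnS // (natr_eq0_pchar0 charF) subSS subn_eq0.
  by move=> le'; apply/eqP; rewrite eqn_leq le le'.
have Hq q : \tr (H * horner_mx H q) = \sum_(i < k) (n i)%:R * (t i * q.[t i]).
  transitivity (\sum_(m < size q) q`_m * \tr (H ^+ m.+1)).
    rewrite -[in LHS](coefK q) poly_def raddf_sum mulr_sumr raddf_sum; apply: eq_bigr => m _.
    by rewrite /= horner_mxZ -scalerAr mxtraceZ rmorphXn /= horner_mx_X -exprS.
  under eq_bigr => m _ do rewrite Htr mulr_sumr.
  rewrite exchange_big /=; apply: eq_bigr => i _.
  rewrite horner_coef !mulr_sumr; apply: eq_bigr => m _.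
  by rewrite -/(t i) exprS; ring.
pose P := char_poly H.
have root_t i : (i < k)%N -> root P (t i).
  move=> ik; pose r := \prod_(j < k | j != i :> nat) ('X - (t j)%:P).
  have := Hq (P * r); rewrite rmorphM /= Cayley_Hamilton mul0r mulr0 mxtrace0.
  rewrite (bigD1 (Ordinal ik)) //= big1 ?addr0; last first.
    move=> j /negP ji; have ji' : (j != i :> nat) by apply/negP => /eqP E; apply: ji; apply/eqP/val_inj.
    rewrite hornerM [r.[_]](_ : _ = 0) ?mulr0 //.
    by rewrite horner_prod (bigD1 j) //= !hornerE subrr mul0r.
  move=> /esym/eqP; rewrite !mulf_eq0 (negbTE (tn0 i)) (natr_eq0_pchar0 charF).
  rewrite (gtn_eqF (n0 i ik)) /= hornerM mulf_eq0 => /orP[//|].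
  rewrite horner_prod; case/prodf_eq0 => j ji; rewrite !hornerE subr_eq0 => /eqP/tinj E.
  by move: ji; rewrite E eqxx.
have /max_poly_roots : P != 0 by apply/monic_neq0/char_poly_monic.
move=> /(_ [seq t i | i <- iota 0 k]); rewrite size_map size_iota size_char_poly ltnS; apply.
  by apply/allP => z /mapP[i]; rewrite mem_iota add0n => /andP[_ ik] ->; exact: root_t.
by rewrite map_inj_uniq ?iota_uniq.
Qed.

Definition independent_family (x : L) k (e : nat -> R) : Prop :=
  [/\ forall i, (i < k)%N -> exists n, primitive f (e i) n,
      forall i, (i < k)%N -> ~ killed (e i) x &
      forall i j, (i < k)%N -> (j < k)%N -> i != j -> inequivalent (e i) (e j)].

(* With T a weighted sum of the c_i e_i a_i, inequivalence makes the powers of (T f x) have the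
   power sums of k distinct nonzero numbers (with multiplicities) as traces, although f x has
   rank at most N + 1. *)
Theorem independent_family_bound x N k (e : nat -> R) : bounded N.+1 (f x) ->
  independent_family x k e -> (k <= N.+1)%N.
Proof.
move=> Hx [Hp Hk Hi].
have Hp' i : exists n, (i < k)%N -> primitive f (e i) n.
  by case: (ltnP i k) => [/Hp [n Hn]|_]; [exists n | exists 0%N].
have [n Hn] := choice Hp'.
(* The second factor is rescaled so that the trace is exactly n_i, which makes the recursion for the
   power sums close up. *)
have Hac i : exists p : R * R, (i < k)%N -> [/\ walg f p.1, walg f p.2 &
    tr (e i * p.1 * f x * p.2) = (n i)%:R].
  case: (ltnP i k) => [ik|_]; last by exists (0, 0).
  have [a [c [Wa Wc t0]]] : exists a c, [/\ walg f a, walg f c & tr (e i * a * f x * c) != 0].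
    apply: contrapT => H; apply: (Hk i ik) => a c Wa Wc; apply: contrapT => /eqP t0.
    by apply: H; exists a, c.
  exists (a, ((n i)%:R / tr (e i * a * f x * c)) *: c) => _; split=> //.
    exact: (subspZ (walg_sub f)).
  by rewrite /= -scalerAr linearZ; exact: divfK.
have [p Hpp] := choice Hac.
pose T := \sum_(i < k) (i.+1)%:R *: ((p i).2 * e i * (p i).1).
pose H := T * f x.
have We i : (i < k)%N -> walg f (e i) by move=> /Hn [We _ _ _ _]; exact: walg_plusE.
have WT : walg f T.
  apply: (subsp_comb (walg_sub f)) => i; have [Wa Wc _] := Hpp i (ltn_ord i).
  by apply: walgM => //; apply: walgM => //; exact: We.
have WH m : walg f (H ^+ m).
  elim: m => [|m IH]; first by rewrite expr0; exact: walg1.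
  by rewrite exprS; apply: walgM => //; apply: walgM => //; exact: walg_f.
(* Expanding one factor H, inequivalence removes all terms of T but the i-th, and primitivity of e_i
   splits the trace into n_i (from the first part) and the same expression with one power less. *)
have Hm m i : (i < k)%N ->
    tr (e i * (p i).1 * f x * H ^+ m * (p i).2) = (i.+1)%:R ^+ m * (n i)%:R.
  elim: m i => [|m IH] i ik.
    by have [_ _ E] := Hpp i ik; rewrite expr0 mulr1 mul1r.
  have [Wa Wc E] := Hpp i ik; have [_ _ _ ni mult] := Hn i ik.
  pose B j := (p j).1 * f x * H ^+ m * (p i).2.
  have WB j : (j < k)%N -> walg f (B j).
    move=> jk; have [Wj _ _] := Hpp j jk; apply: walgM => //; apply: walgM => //.
    by apply: walgM => //; exact: walg_f.
  have -> : e i * (p i).1 * f x * H ^+ m.+1 * (p i).2 =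
      \sum_(j < k) (j.+1)%:R *: (e i * ((p i).1 * f x * (p j).2) * e j * B j).
    rewrite exprS {1}/H {1}/T !mulr_suml mulr_sumr mulr_suml; apply: eq_bigr => j _.
    by rewrite -!scalerAl -scalerAr -scalerAl /B !mulrA.
  rewrite linear_sum (bigD1 (Ordinal ik)) //= big1 ?addr0; last first.
    move=> j /negP ji; rewrite linearZ /= (Hi i j) ?mulr0 //.
    - by apply/negP => /eqP E'; apply: ji; apply/eqP/val_inj.
    - apply: walgM; last by have [] := Hpp j (ltn_ord j).
      by apply: walgM => //; exact: walg_f.
    - exact: WB.
  rewrite linearZ /=; apply: (mulfI (x := (n i)%:R)).
    by rewrite (natr_eq0_pchar0 charF) -lt0n.
  rewrite mulrCA mult; last 2 first.
  - by apply: walgM => //; apply: walgM => //; exact: walg_f.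
  - exact: WB.
  by rewrite /B !mulrA E IH // exprS; ring.
have fx : fin (f x) by case: Hf.
have fH : fin H by exact: fin_mulr.
(* H has no entries in columns beyond N, so truncation is multiplicative on its powers and preserves
   their traces, although its rows need not be bounded by N + 1. *)
have HE : H * eid F N.+1 = H by rewrite /H -mulrA (eid_mulr Hx).
have fHm m : fin (H ^+ m.+1) by rewrite exprS; exact: fin_mull.
have HEm m : H ^+ m.+1 * eid F N.+1 = H ^+ m.+1 by rewrite exprSr -mulrA HE.
apply: (@power_sums_bound N k (trunc N.+1 H) n) => [i /Hn []//|m].
have <- : trunc N.+1 (H ^+ m.+1) = trunc N.+1 H ^+ m.+1.
  elim: m => [|m IH]; first by rewrite !expr1.
  by rewrite exprS trunc_mul_col // IH [in RHS]exprS.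
rewrite -tr_col // exprS {1}/H /T -mulrA mulr_suml linear_sum; apply: eq_bigr => i _.
rewrite -scalerAl linearZ /= [in RHS]exprS -[in RHS]mulrA -(Hm m i (ltn_ord i)).
by congr (_ * _); rewrite -!mulrA [in LHS]trC !mulrA.
Qed.
End InequivalentIdempotents.

(** * From the reductive subalgebras to their union *)

Section LocallyReductive.
Variables (F : closedFieldType) (charF : [pchar F] =i pred0).
Variables (L : lmodType F) (br : L -> L -> L).
Hypothesis HL : lie_axioms br.
Local Notation R := (emx F).
Variables (f : L -> R) (h : nat -> L -> Prop).
Hypotheses (Hf : lie_rep br f) (finj : injective f).
Hypothesis Hh : forall n, fin_dim (h n) /\ subalg br (h n) /\ reductive br (h n).
Hypothesis hS : forall n x, h n x -> h n.+1 x.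
Hypothesis hall : forall x, exists n, h n x.

Let fh n : fin_dim (h n). Proof. by case: (Hh n). Qed.
Let sh n : subalg br (h n). Proof. by case: (Hh n) => _ []. Qed.
Let rh n : reductive br (h n). Proof. by case: (Hh n) => _ []. Qed.

Lemma h_mono n m x : (n <= m)%N -> h n x -> h m x.
Proof. by move=> /subnK <-; elim: (m - n)%N => // k IH /IH; rewrite addSn; exact: hS. Qed.

Lemma rep_bounded g n : lie_rep br g -> exists N, forall x, h n x -> bounded N.+1 (g x).
Proof.
move=> [lg _ fg]; have [m [v Hv]] := fh n.
have [N HN] := choice (fun i : 'I_m => fin_bounded (fg (v i))).
exists (\max_i N i) => x /Hv [c ->]; rewrite (linear_comb _ _ lg).
apply: (subsp_comb (bounded_sub _ _)) => i; apply: bounded_le (HN i).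
by rewrite leqW // leq_bigmax.
Qed.

Lemma h_separated n : exists D (th : 'I_D -> L -> F^o), (forall i, linear (th i)) /\
  forall x, h n x -> (forall i, th i x = 0) -> x = 0.
Proof.
have [N HN] := rep_bounded n Hf; have [lf _ _] := Hf.
exists (N.+1 * N.+1)%N, (fun k x => mxvec (trunc N.+1 (f x)) 0 k); split.
  by move=> k a x y; rewrite lf linearP /= linearP /= !mxE.
move=> x hx H; apply: finj; rewrite (linear_0 lf).
apply: (trunc_inj (HN x hx) (proj1 (bounded_sub _ _))); rewrite linear0.
by apply/eqP; rewrite -mxvec_eq0; apply/eqP/rowP => k; rewrite H mxE.
Qed.

Lemma local_structure n :
  [/\ forall u, derived_set br (h n) u -> (forall y, h n y -> br y u = 0) -> u = 0,
      forall x, h n x -> exists2 s, derived_set br (h n) s & forall y, h n y -> br y (x - s) = 0 &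
      forall J, ideal_in br (h n) J -> (forall x, J x -> derived_set br (h n) x) ->
        forall x, J x -> derived_set br J x].
Proof.
have [D [th [lth inj]]] := h_separated n.
exact: (reductive_structure charF HL (fh n) (sh n) (@rh n) lth inj).
Qed.

Lemma derived_h_mono n m x : (n <= m)%N -> derived_set br (h n) x -> derived_set br (h m) x.
Proof. move=> le; apply: derived_set_mono => y; exact: h_mono. Qed.

Lemma derived_local x : derived br x -> exists n, derived_set br (h n) x.
Proof.
apply: (@derived_set_min _ _ _ _ (fun x => exists n, derived_set br (h n) x)) => [|a b _ _].
  split; first by exists 0%N; exact: (subsp0 (derived_set_subspace _ _)).
  move=> a u w [n Hu] [m Hw]; exists (maxn n m).
  apply: (proj2 (derived_set_subspace br (h (maxn n m)))).
    by apply: derived_h_mono Hu; rewrite leq_maxl.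
  by apply: derived_h_mono Hw; rewrite leq_maxr.
have [n Ha] := hall a; have [m Hb] := hall b; exists (maxn n m).
apply: derived_set_br; [apply: h_mono Ha | apply: h_mono Hb];
  by rewrite ?leq_maxl ?leq_maxr.
Qed.

Definition lideal (X : L -> Prop) : Prop := ideal_in br (fun _ => True) X.

Lemma local_ideal X n : lideal X ->
  ideal_in br (h n) (fun x => X x /\ derived_set br (h n) x).
Proof.
move=> [sX [_ Xbr]]; have [sD [Dh Dbr]] := derived_set_ideal (sh n).
split; first split.
- by split; exact: subsp0.
- by move=> a x y [Xx Dx] [Xy Dy]; split; [exact: (proj2 sX) | exact: (proj2 sD)].
split=> [x [_ /Dh]//|x y hx [Xy Dy]]; split; [exact: Xbr | exact: Dbr].
Qed.

Lemma local_perfect X n x : lideal X -> X x -> derived_set br (h n) x ->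
  derived_set br (fun y => X y /\ derived_set br (h n) y) x.
Proof.
move=> HX Xx Dx; have [_ _ H] := local_structure n.
by apply: (H _ (local_ideal n HX)) => // y [].
Qed.

Lemma ideal_perfect X x : lideal X -> (forall y, X y -> derived br y) -> X x ->
  derived_set br X x.
Proof.
move=> HX XS Xx; have [n Dx] := derived_local (XS _ Xx).
by apply: derived_set_mono (local_perfect HX Xx Dx) => y [].
Qed.

(** An element x of X lies in some [h_n, h_n]. The intersection of X with [h_n, h_n] is an ideal of
    the reductive algebra h_n, where the finite-dimensional statement applies. The representation
    need not be faithful. *)
Lemma rep_nondegenerate g X x : lie_rep br g -> lideal X -> (forall y, X y -> derived br y) ->
  X x -> (forall u, X u -> tr (g x * g u) = 0) -> g x = 0.
Proof.
move=> Hg HX XS Xx Hx; have [n Dx] := derived_local (XS _ Xx).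
have [D [th [lth inj]]] := h_separated n.
have [N HN] := rep_bounded n Hg; have [lg gbr fg] := Hg.
have Dh := derived_set_sub (sh n).
have lrho : linear (fun y => trunc N.+1 (g y)) by move=> a y z; rewrite lg linearP.
have rhobr y z : h n y -> h n z ->
    trunc N.+1 (g (br y z)) = mbr (trunc N.+1 (g y)) (trunc N.+1 (g z)).
  by move=> /HN Hy /HN Hz; rewrite gbr linearB /= (trunc_mull Hy (fg _)) (trunc_mull Hz (fg _)).
have E := @trace_form_nondegenerate F charF L br HL (h n) D th (fh n) (sh n) (@rh n) lth inj
  N _ _ lrho rhobr (local_ideal n HX).
apply: (trunc_inj (HN _ (Dh _ Dx)) (proj1 (bounded_sub _ _))); rewrite linear0.
apply: E => // [y [] //|u [Xu Du]].
have Bx := HN _ (Dh _ Dx); have Bu := HN _ (Dh _ Du).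
by rewrite -[_ * _]/(_ *m _) -(trunc_mull Bx (fg _)) -(trE (bounded_mul Bx Bu)) Hx.
Qed.

(** Nondegeneracy gives f(x) f(u) of nonzero trace. It is not nilpotent, so a polynomial multiple of
    it is a nonzero idempotent of the ideal, and one of least trace can be chosen. *)
Lemma primitive_exists X x : lideal X -> (forall y, X y -> derived br y) -> X x -> x != 0 ->
  exists e n, primitive f e n /\ wideal f X e.
Proof.
move=> HX XS Xx x0; have [lf _ ff] := Hf.
have [u Xu t0] : exists2 u, X u & tr (f x * f u) != 0.
  apply: contrapT => H; case/negP: x0; apply/eqP/finj; rewrite (linear_0 lf).
  apply: (rep_nondegenerate Hf HX XS Xx) => u Xu; apply: contrapT => /eqP t0.
  by apply: H; exists u.
pose a := f x * f u.
have Ia : wideal f X a.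
  apply: span_incl; exists 1, x, (f u); split=> //; [exact: walg1 | exact: walg_f|].
  by rewrite mul1r.
have fa : fin a by exact: fin_mull.
have [|p pa [ap0 apap]] := fin_idempotent fa.
  by move=> k; apply/negP => /eqP /(tr_nilpotent fa) E; move: t0; rewrite E eqxx.
have Wp : walg f p by apply: polynomial_in_walg pa; exact/walg_plusE/(wideal_plus Ia).
pose P m := `[< exists e, [/\ wideal f X e, e * e = e, e != 0 & tr e = m%:R] >].
have exP : exists m, P m.
  have [m tm _] := tr_idempotent (fin_mull p fa) apap.
  by exists m; apply/asboolP; exists (a * p); split=> //; exact: wideal_mulr.
case: (ex_minnP exP) => n /asboolP[e [Ie ee e0 te]] emin.
exists e, n; split=> //; apply: (minimal_idempotent_primitive charF Hf Ie ee e0 te).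
by move=> e' m Ie' ee' e0' te'; apply: emin; apply/asboolP; exists e'.
Qed.

Lemma killed_ideal e : lideal (killed f e).
Proof.
have [lf fbr _] := Hf; split; first split.
- by move=> a c _ _; rewrite (linear_0 lf) mulr0 mul0r linear0.
- move=> k x y Hx Hy a c Wa Wc.
  by rewrite lf mulrDr mulrDl -scalerAr -scalerAl linearP /= Hx // Hy // mulr0 addr0.
split=> // x y _ Hy a c Wa Wc; have Wx := walg_f f x.
rewrite fbr mulrBr mulrBl linearB /= !mulrA -[e * a * _]mulrA -[X in _ - tr X]mulrA.
by rewrite !Hy ?subrr //; exact: walgM.
Qed.

Lemma wideal_killed X e z a c : (forall x, X x -> killed f e x) -> wideal f X z ->
  walg f a -> walg f c -> tr (e * a * z * c) = 0.
Proof.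
move=> HX Iz Wa Wc; move: z Iz; apply: span_min.
  apply: (@preim_subspace F F^o R (fun t => t = 0) (fun z => tr (e * a * z * c))).
    by move=> k x y; rewrite mulrDr mulrDl -scalerAr -scalerAl linearP.
  by split=> // k x y -> ->; rewrite scaler0 addr0.
move=> _ [b [x [d [Wb Xx Wd ->]]]].
have -> : e * a * (b * f x * d) * c = e * (a * b) * f x * (d * c) by rewrite !mulrA.
by apply: (HX x Xx); exact: walgM.
Qed.

Lemma primitive_not_killed X e n : primitive f e n -> wideal f X e ->
  exists2 x, X x & ~ killed f e x.
Proof.
move=> [_ ee te n0 _] Ie; apply: contrapT => H.
have HX x : X x -> killed f e x by move=> Xx; apply: contrapT => nk; apply: H; exists x.
have := wideal_killed HX Ie (walg1 f) (walg1 f).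
by rewrite !mulr1 ee te => /eqP; rewrite (natr_eq0_pchar0 charF) gtn_eqF.
Qed.

Definition gen_ideal x y : Prop := forall J, lideal J -> J x -> J y.

Lemma gen_ideal_ideal x : lideal (gen_ideal x).
Proof.
split; first split.
- by move=> J [sJ _] _; exact: subsp0.
- move=> a u w Hu Hw J HJ Jx; have [sJ _] := HJ.
  by apply: (proj2 sJ); [exact: Hu | exact: Hw].
split=> // u w _ Hw J HJ Jx; have [_ [_ Jbr]] := HJ.
by apply: Jbr => //; exact: Hw.
Qed.

Lemma derived_lideal : lideal (derived br).
Proof. by apply: derived_set_ideal; split=> //; split. Qed.

Lemma maximal_family x : exists k e, independent_family f x k e /\
  forall e' n, primitive f e' n -> ~ killed f e' x -> exists2 i, (i < k)%N & ~ inequivalent f (e i) e'.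
Proof.
have [_ _ ff] := Hf; have [N /(bounded_le (leqnSn N)) HN] := fin_bounded (ff x).
pose P k := `[< exists e, independent_family f x k e >].
have P0 : exists k, P k by exists 0%N; apply/asboolP; exists (fun _ => 0); split.
have Pb k : P k -> (k <= N.+1)%N.
  by move=> /asboolP[e He]; exact: (independent_family_bound charF Hf HN He).
case: (ex_maxnP P0 Pb) => k /asboolP[e He] kmax; exists k, e; split=> // e' n pe' ke'.
apply: contrapT => H.
have {}H i : (i < k)%N -> inequivalent f (e i) e'.
  by move=> ik; apply: contrapT => H'; apply: H; exists i.
have [H1 H2 H3] := He.
suff /kmax : P k.+1 by rewrite ltnn.
apply/asboolP; exists (fun i => if i == k then e' else e i); split.
- move=> i; rewrite ltnS leq_eqVlt; case: eqP => [_ _|_ /= /H1 //]; by exists n.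
- by move=> i; rewrite ltnS leq_eqVlt; case: eqP => [_ _|_ /= /H2 //].
have lk i : (i < k.+1)%N -> i != k -> (i < k)%N by rewrite ltnS ltn_neqAle => -> ->.
move=> i j ik jk ij; case: (eqVneq i k) => [ei|ni]; case: (eqVneq j k) => [ej|nj].
- by move: ij; rewrite ei ej eqxx.
- by apply: inequivalent_sym; apply: H; exact: lk.
- by apply: H; exact: lk.
- by apply: H3 => //; exact: lk.
Qed.

Lemma detecting_family x : derived br x -> exists k e, independent_family f x k e /\
  forall Y, lideal Y -> (forall y, Y y -> gen_ideal x y) ->
    (forall i, (i < k)%N -> forall y, Y y -> killed f (e i) y) -> forall y, Y y -> y = 0.
Proof.
move=> Dx; have [k [e [He Hmax]]] := maximal_family x; exists k, e; split=> //.
move=> Y HY Yx HYk y Yy; apply: contrapT => /eqP y0.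
have YS z : Y z -> derived br z by move=> /Yx; apply => //; exact: derived_lideal.
have [e' [n [pe' Ie']]] := primitive_exists HY YS Yy y0.
have [z Yz nk] := primitive_not_killed pe' Ie'.
have [|i ik] := Hmax e' n pe'.
  by move=> kx; apply: nk; apply: (Yx _ Yz) kx; exact: killed_ideal.
by case=> a b Wa Wb; apply: wideal_killed Ie' _ _ => //; exact: HYk.
Qed.
End LocallyReductive.

(** * Representations attached to primitive idempotents *)

Section SequenceBuilding.
Variables (T : Type) (valid : seq T -> Prop) (task : nat -> seq T -> Prop).
Hypotheses (valid0 : valid [::])
  (extend : forall s k, valid s -> exists2 s', valid (s ++ s') & task k (s ++ s'))
  (keep : forall s s' k, valid (s ++ s') -> task k s -> task k (s ++ s')).

(** Extend the sequence stage by stage, performing task k at stage k; tasks once done stay done.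
    Either the length stabilizes, and one finite sequence fulfils everything, or the stages grow to
    an infinite sequence. The same scheme serves dual bases and Gram-Schmidt. *)
Lemma build_sequence : (exists2 s, valid s & forall k, task k s) \/
  exists t : nat -> T, forall N k, exists2 M, (N <= M)%N &
    valid (mkseq t M) /\ task k (mkseq t M).
Proof.
have ext1 (sk : seq T * nat) : exists s', valid sk.1 ->
    valid (sk.1 ++ s') /\ task sk.2 (sk.1 ++ s').
  case: (pselect (valid sk.1)) => [v|nv]; last by exists [::].
  by have [s' v' t'] := extend sk.2 v; exists s'.
have [ext Hext] := choice ext1.
pose st := fix st k := if k is k'.+1 then st k' ++ ext (st k', k') else [::].
have vst k : valid (st k) by elim: k => [//|k IH] /=; case: (Hext (st k, k) IH).
have tst k : task k (st k.+1) by have [_] := Hext (st k, k) (vst k).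
have pst k j : exists s', st (j + k)%N = st k ++ s'.
  elim: j => [|j [s' E]]; first by exists [::]; rewrite cats0.
  by exists (s' ++ ext (st (j + k)%N, (j + k)%N)); rewrite addSn /= E catA.
have tst' k j : (k < j)%N -> task k (st j).
  move=> /subnK <-; have [s' E] := pst k.+1 (j - k.+1)%N.
  by rewrite E; apply: keep => //; rewrite -E; exact: vst.
case: (pselect (exists K, forall j, size (st (j + K)%N) = size (st K))) => [[K HK]|H].
  left; exists (st K) => // k; have := tst' k (k.+1 + K)%N; rewrite leq_addr => /(_ isT).
  have [s' E] := pst K k.+1; have := HK k.+1; rewrite E size_cat => /eqP.
  by rewrite -[X in _ == X]addn0 eqn_add2l => /nilP ->; rewrite cats0.
right; have big N : exists k, (N <= size (st k))%N.
  elim: N => [|N [k Hk]]; first by exists 0%N.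
  apply: contrapT => H'; apply: H; exists k => j; have [s' E] := pst k j.
  apply/eqP; rewrite eqn_leq {2}E size_cat leq_addr andbT.
  by rewrite (leq_trans _ Hk) // leqNgt; apply/negP => lt; apply: H'; exists (j + k)%N.
have [kk Hkk] := choice (fun i => big i.+1).
have [x0 _] : exists x0 : T, True.
  by have := Hkk 0%N; case: (st (kk 0%N)) => // x0 _; exists x0.
have agree k j i : (i < size (st k))%N -> (i < size (st j))%N ->
    nth x0 (st k) i = nth x0 (st j) i.
  wlog kj : k j / (k <= j)%N.
    by move=> W; case/orP: (leq_total k j) => h h1 h2; [|symmetry]; apply: W.
  by move/subnK: kj => <- h1 _; have [s' ->] := pst k (j - k)%N; rewrite nth_cat h1.
exists (fun i => nth x0 (st (kk i)) i) => N k.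
have mk j : mkseq (fun i => nth x0 (st (kk i)) i) (size (st j)) = st j.
  apply: (@eq_from_nth _ x0); rewrite size_mkseq // => i ij.
  by rewrite nth_mkseq //; apply: agree.
have [j Hj] := big N; exists (size (st (k.+1 + j)%N)).
  by have [s' ->] := pst j k.+1; rewrite size_cat (leq_trans Hj) ?leq_addr.
by rewrite mk; split=> //; apply: tst'; rewrite leq_addr.
Qed.
End SequenceBuilding.

Section DualBases.
Variables (F : fieldType) (U V : lmodType F) (P : U -> Prop) (Q : V -> Prop).
Variables (B : U -> V -> F^o) (u : nat -> U) (v : nat -> V).
Hypotheses (sP : subspace P) (sQ : subspace Q).
Hypotheses (Bl : forall q, linear (B^~ q)) (Br : forall p, linear (B p)).
Hypotheses (Pu : forall k, P (u k)) (Qv : forall k, Q (v k)).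
Hypothesis spanu : forall p, P p -> exists K (c : nat -> F), forall q, Q q ->
  B p q = \sum_(k < K) c k * B (u k) q.
Hypothesis spanv : forall q, Q q -> exists K (c : nat -> F), forall p, P p ->
  B p q = \sum_(k < K) c k * B p (v k).

Let nthz (s : seq (U * V)) := nth (0, 0) s.
Let Bsuml s (c : U * V -> F) q :
  B (\sum_(z <- s) c z *: z.1) q = \sum_(z <- s) c z * B z.1 q.
Proof.
elim: s => [|z s IH]; first by rewrite !big_nil (linear_0 (Bl q)).
by rewrite !big_cons Bl IH.
Qed.
Let Bsumr s (c : U * V -> F) p :
  B p (\sum_(z <- s) c z *: z.2) = \sum_(z <- s) c z * B p z.2.
Proof.
elim: s => [|z s IH]; first by rewrite !big_nil (linear_0 (Br p)).
by rewrite !big_cons Br IH.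
Qed.

Let dual s := (forall i, P (nthz s i).1 /\ Q (nthz s i).2) /\
  forall i j, (i < size s)%N -> (j < size s)%N -> B (nthz s i).1 (nthz s j).2 = (i == j)%:R.
Let expl s p := forall q, Q q -> B p q = \sum_(z <- s) B p z.2 * B z.1 q.
Let expr s q := forall p, P p -> B p q = \sum_(z <- s) B p z.2 * B z.1 q.

Let dual_suml s c j : dual s -> (j < size s)%N ->
  \sum_(z <- s) c z * B z.1 (nthz s j).2 = c (nthz s j) :> F.
Proof.
move=> [_ Hd] js; rewrite (big_nth (0, 0)) (bigD1_seq j) ?mem_index_iota ?iota_uniq //=.
rewrite Hd // eqxx mulr1 big1_seq ?addr0 // => i /andP[ij].
by rewrite mem_index_iota /= => is_; rewrite Hd // (negPf ij) mulr0.
Qed.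
Let dual_sumr s c i : dual s -> (i < size s)%N ->
  \sum_(z <- s) c z * B (nthz s i).1 z.2 = c (nthz s i) :> F.
Proof.
move=> [_ Hd] js; rewrite (big_nth (0, 0)) (bigD1_seq i) ?mem_index_iota ?iota_uniq //=.
rewrite Hd // eqxx mulr1 big1_seq ?addr0 // => j /andP[ij].
by rewrite mem_index_iota /= => is_; rewrite Hd // eq_sym (negPf ij) mulr0.
Qed.

(** Residuals with respect to a finite dual family: the parts of p and q orthogonal to everything
    chosen so far. *)
Let resl s p := p - \sum_(z <- s) B p z.2 *: z.1.
Let resr s q := q - \sum_(z <- s) B z.1 q *: z.2.
Let resl_in s p : dual s -> P p -> P (resl s p).
Proof.
move=> [H _] Pp; apply: (subspB sP) => //; rewrite (big_nth (0, 0)) big_mkord.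
by apply: (subsp_comb sP) => i; case: (H i).
Qed.
Let resr_in s q : dual s -> Q q -> Q (resr s q).
Proof.
move=> [H _] Qq; apply: (subspB sQ) => //; rewrite (big_nth (0, 0)) big_mkord.
by apply: (subsp_comb sQ) => i; case: (H i).
Qed.
Let resl_dual s p j : dual s -> (j < size s)%N -> B (resl s p) (nthz s j).2 = 0.
Proof. by move=> Hs js; rewrite (linear_B (Bl _)) Bsuml (dual_suml (fun z => B p z.2)) // subrr. Qed.
Let resr_dual s q i : dual s -> (i < size s)%N -> B (nthz s i).1 (resr s q) = 0.
Proof. by move=> Hs js; rewrite (linear_B (Br _)) Bsumr (dual_sumr (fun z => B z.1 q)) // subrr. Qed.

Let dual_rcons s p q : dual s -> P p -> Q q -> (forall j, (j < size s)%N -> B p (nthz s j).2 = 0) ->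
  (forall i, (i < size s)%N -> B (nthz s i).1 q = 0) -> B p q = 1 -> dual (s ++ [:: (p, q)]).
Proof.
move=> [H1 H2] Pp Qq Hp Hq pq; rewrite cats1; split.
  move=> i; rewrite /nthz nth_rcons; case: ifP => _; first exact: H1.
  by case: ifP => _ //=; split; exact: subsp0.
have lk i : (i < (size s).+1)%N -> i != size s -> (i < size s)%N.
  by rewrite ltnS ltn_neqAle => -> ->.
move=> i j; rewrite size_rcons /nthz !nth_rcons => ik jk.
have [->|/(lk i ik) is_] := altP (i =P size s); have [->|/(lk j jk) js] := altP (j =P size s).
- by rewrite ltnn ?eqxx /= pq.
- by rewrite ltnn ?eqxx js /= (Hp _ js) gtn_eqF.
- by rewrite ltnn ?eqxx is_ /= (Hq _ is_) ltn_eqF.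
by rewrite is_ js (H2 _ _ is_ js).
Qed.

Let expl_keep s s' p : dual (s ++ s') -> expl s p -> expl (s ++ s') p.
Proof.
move=> [H1 H2] He q Qq; rewrite big_cat /= -He // [X in _ = _ + X]big1_seq ?addr0 // => z /= zs'.
set j := (size s + index z s')%N; have zE : z = nthz (s ++ s') j.
  by rewrite /nthz nth_cat ltnNge leq_addr /= addKn nth_index.
have js : (j < size (s ++ s'))%N by rewrite size_cat ltn_add2l index_mem.
rewrite {1}zE He; last by case: (H1 j).
rewrite (big_nth (0, 0)) big1_seq ?mul0r // => i /=; rewrite mem_index_iota /= => is_.
have Ei : nth (0, 0) s i = nthz (s ++ s') i by rewrite /nthz nth_cat is_.
rewrite Ei H2 //; last by rewrite size_cat ltn_addr.
by rewrite ltn_eqF ?mulr0 // ltn_addr.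
Qed.
Let expr_keep s s' q : dual (s ++ s') -> expr s q -> expr (s ++ s') q.
Proof.
move=> [H1 H2] He p Pp; rewrite big_cat /= -He // [X in _ = _ + X]big1_seq ?addr0 // => z /= zs'.
set j := (size s + index z s')%N; have zE : z = nthz (s ++ s') j.
  by rewrite /nthz nth_cat ltnNge leq_addr /= addKn nth_index.
have js : (j < size (s ++ s'))%N by rewrite size_cat ltn_add2l index_mem.
rewrite {2}zE He; last by case: (H1 j).
rewrite (big_nth (0, 0)) big1_seq ?mulr0 // => i /=; rewrite mem_index_iota /= => is_.
have Ei : nth (0, 0) s i = nthz (s ++ s') i by rewrite /nthz nth_cat is_.
rewrite Ei H2 //; last by rewrite size_cat ltn_addr.
by rewrite gtn_eqF ?mul0r // ltn_addr.
Qed.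

(** If the residual of p pairs nontrivially with some q, the residuals of p and q, suitably scaled,
    are a new dual pair that completes the expansion of p. Otherwise p is already expanded, up to
    the radical of the form. *)
Let expl_step s p : dual s -> P p -> exists2 s', dual (s ++ s') & expl (s ++ s') p.
Proof.
move=> Hs Pp; case: (pselect (exists2 q, Q q & B (resl s p) q != 0)) => [[q Qq q0]|H].
  set c := B (resl s p) q in q0.
  have E : B (resl s p) (resr s q) = c.
    rewrite (linear_B (Br _)) Bsumr (big_nth (0, 0)) big1_seq ?subr0 // => i /=.
    by rewrite mem_index_iota /= => is_; rewrite resl_dual ?mulr0.
  have Hd : dual (s ++ [:: (c^-1 *: resl s p, resr s q)]).
    apply: dual_rcons => //.
    - by apply: (subspZ sP); exact: resl_in.
    - exact: resr_in.
    - by move=> j js; rewrite (linear_Z (Bl _)) resl_dual ?scaler0.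
    - by move=> i is_; exact: resr_dual.
    by rewrite (linear_Z (Bl _)) E -[LHS]/(_ * _) mulVf.
  exists [:: (c^-1 *: resl s p, resr s q)] => // q1 Qq1.
  rewrite big_cat big_seq1 /= (linear_Z (Bl _)).
  have -> : B p (resr s q) = c.
    rewrite -E (linear_B (Bl _)) Bsuml [X in _ = _ - X]big1_seq ?subr0 // => z /= zs.
    by rewrite -(nth_index (0, 0) zs) resr_dual ?mulr0 ?index_mem.
  rewrite -[_ *: _]/(_ * _) mulrA mulfV // mul1r (linear_B (Bl _)) Bsuml.
  by rewrite addrC subrK.
exists [::]; rewrite cats0 // => q Qq; apply/eqP; rewrite -subr_eq0 -Bsuml -(linear_B (Bl _)).
by apply: contrapT => /negP q0; apply: H; exists q.
Qed.
Let expr_step s q : dual s -> Q q -> exists2 s', dual (s ++ s') & expr (s ++ s') q.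
Proof.
move=> Hs Qq.
have sumC p : \sum_(z <- s) B p z.2 * B z.1 q = \sum_(z <- s) B z.1 q * B p z.2.
  by apply: eq_bigr => z _; rewrite mulrC.
case: (pselect (exists2 p, P p & B p (resr s q) != 0)) => [[p Pp q0]|H].
  set c := B p (resr s q) in q0.
  have E : B (resl s p) (resr s q) = c.
    rewrite (linear_B (Bl _)) Bsuml (big_nth (0, 0)) big1_seq ?subr0 // => i /=.
    by rewrite mem_index_iota /= => is_; rewrite resr_dual ?mulr0.
  have Hd : dual (s ++ [:: (resl s p, c^-1 *: resr s q)]).
    apply: dual_rcons => //.
    - exact: resl_in.
    - by apply: (subspZ sQ); exact: resr_in.
    - by move=> j js; exact: resl_dual.
    - by move=> i is_; rewrite (linear_Z (Br _)) resr_dual ?scaler0.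
    by rewrite (linear_Z (Br _)) E -[LHS]/(_ * _) mulVf.
  exists [:: (resl s p, c^-1 *: resr s q)] => // p1 Pp1.
  rewrite big_cat big_seq1 /= (linear_Z (Br _)).
  have -> : B (resl s p) q = c.
    rewrite -E (linear_B (Br _)) Bsumr [X in _ = _ - X]big1_seq ?subr0 // => z /= zs.
    by rewrite -(nth_index (0, 0) zs) resl_dual ?mulr0 ?index_mem.
  rewrite -[_ *: _]/(_ * _) mulrAC mulVf // mul1r (linear_B (Br _)) Bsumr.
  by rewrite sumC addrC subrK.
exists [::]; rewrite cats0 // => p Pp; apply/eqP; rewrite -subr_eq0.
rewrite sumC -Bsumr -(linear_B (Br _)).
by apply: contrapT => /negP q0; apply: H; exists p.
Qed.

Definition dual_up_to (y : nat -> U) (x : nat -> V) (K : nat) p q : Prop :=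
  B p q = \sum_(k < K) B p (x k) * B (y k) q.

(** Alternating the expansion of u_k and v_k makes both families exhaust their sides. The finite
    alternative means that the form has finite rank. *)
Lemma dual_bases : exists (y : nat -> U) (x : nat -> V), (forall i, P (y i) /\ Q (x i)) /\
  ((exists D, forall p q, P p -> Q q -> dual_up_to y x D p q) \/
   [/\ forall i j, B (y i) (x j) = (i == j)%:R,
       forall p, P p -> exists K, forall q, Q q -> dual_up_to y x K p q &
       forall q, Q q -> exists K, forall p, P p -> dual_up_to y x K p q]).
Proof.
pose task k s := expl s (u k) /\ expr s (v k).
have [|||[s Hs Ht]|[t Ht]] := @build_sequence _ dual task.
- by split=> [i|//]; rewrite /nthz nth_nil; split; exact: subsp0.
- move=> s k Hs; have [s1 H1 E1] := expl_step Hs (Pu k); have [s2 H2 E2] := expr_step H1 (Qv k).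
  by exists (s1 ++ s2); rewrite catA //; split=> //; exact: expl_keep.
- by move=> s s' k Hs [E1 E2]; split; [exact: expl_keep | exact: expr_keep].
- exists (fun i => (nthz s i).1), (fun i => (nthz s i).2); split; first by case: Hs.
  left; exists (size s) => p q Pp Qq; rewrite /dual_up_to.
  have [K [c Hc]] := spanu Pp; rewrite Hc //.
  transitivity (\sum_(k < K) c k * \sum_(z <- s) B (u k) z.2 * B z.1 q).
    by apply: eq_bigr => k _; case: (Ht k) => [-> ].
  under eq_bigr do rewrite mulr_sumr; rewrite exchange_big /= (big_nth (0, 0)) big_mkord.
  apply: eq_bigr => l _; rewrite Hc; last by case: Hs => H _; case: (H l).
  by rewrite mulr_suml; apply: eq_bigr => k _; rewrite mulrA.
have nt M i : (i < M)%N -> nthz (mkseq t M) i = t i by move=> iM; rewrite /nthz nth_mkseq.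
have PQt i : P (t i).1 /\ Q (t i).2.
  by have [M iM [[HM _] _]] := Ht i.+1 0%N; have := HM i; rewrite nt.
exists (fun i => (t i).1), (fun i => (t i).2); split=> //.
have Hd i j : B (t i).1 (t j).2 = (i == j)%:R.
  have [M] := Ht (maxn i j).+1 0%N; rewrite gtn_max => /andP[iM jM] [[_ HM] _].
  by have := HM i j; rewrite size_mkseq !nt // => ->.
have sumt M p q : \sum_(z <- mkseq t M) B p z.2 * B z.1 q =
    \sum_(k < M) B p (t k).2 * B (t k).1 q.
  by rewrite big_map -[X in iota _ X]subn0 -/(index_iota _ _) big_mkord.
have pref M : dual (mkseq t M).
  split=> [i|i j]; last by rewrite size_mkseq => iM jM; rewrite !nt.
  case: (ltnP i M) => [iM|Mi]; last by rewrite /nthz nth_default ?size_mkseq //; split; exact: subsp0.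
  have [M' M'i [[HM _] _]] := Ht i.+1 0%N.
  by have := HM i; rewrite !nt.
have mono M M' : (M <= M')%N -> exists s', mkseq t M' = mkseq t M ++ s'.
  by move=> le; exists [seq t i | i <- iota M (M' - M)]; rewrite /mkseq -map_cat -{2}[M]add0n -iotaD subnKC.
right; split=> // [p Pp|q Qq].
  have [K [c Hc]] := spanu Pp.
  have [M HM] : exists M, forall k, (k < K)%N -> expl (mkseq t M) (u k).
    elim: (K) => [|K' [M HM]]; first by exists 0%N.
    have [M' MM' [_ [E _]]] := Ht M K'; exists M' => k; rewrite ltnS leq_eqVlt.
    case/orP=> [/eqP-> //|/HM E']; have [s' Es] := mono _ _ MM'.
    by rewrite Es; apply: expl_keep => //; rewrite -Es; exact: pref.
  exists M => q Qq; rewrite /dual_up_to Hc //.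
  under eq_bigr => k _ do rewrite (HM k (ltn_ord k) q Qq) sumt mulr_sumr.
  rewrite exchange_big; apply: eq_bigr => l _; rewrite /= Hc; last by case: (PQt l).
  by rewrite mulr_suml; apply: eq_bigr => k _; rewrite mulrA.
have [K [c Hc]] := spanv Qq.
have [M HM] : exists M, forall k, (k < K)%N -> expr (mkseq t M) (v k).
  elim: (K) => [|K' [M HM]]; first by exists 0%N.
  have [M' MM' [_ [_ E]]] := Ht M K'; exists M' => k; rewrite ltnS leq_eqVlt.
  case/orP=> [/eqP-> //|/HM E']; have [s' Es] := mono _ _ MM'.
  by rewrite Es; apply: expr_keep => //; rewrite -Es; exact: pref.
exists M => p Pp; rewrite /dual_up_to Hc //.
under eq_bigr => k _ do rewrite (HM k (ltn_ord k) p Pp) sumt mulr_sumr.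
rewrite exchange_big; apply: eq_bigr => l _; rewrite /= Hc; last by case: (PQt l).
by rewrite mulr_sumr; apply: eq_bigr => k _; rewrite mulrCA.
Qed.
End DualBases.

Section CountableSpan.
Variables (F : fieldType) (V : lmodType F).

Lemma nat_span (u : nat -> V) x : lspan (fun x => exists k, x = u k) x ->
  exists K (c : nat -> F), x = \sum_(k < K) c k *: u k.
Proof.
move: x; apply: span_min => [|_ [k ->]]; last first.
  exists k.+1, (fun j => (j == k)%:R); rewrite (bigD1 ord_max) //= eqxx scale1r.
  by rewrite big1 ?addr0 // => i; rewrite -val_eqE /= => /negPf ->; rewrite scale0r.
split; first by exists 0%N, (fun _ => 0); rewrite big_ord0.
move=> a _ _ [K [c ->]] [M [d ->]].
exists (maxn K M), (fun k => a * (if (k < K)%N then c k else 0) + if (k < M)%N then d k else 0).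
under [RHS]eq_bigr do rewrite scalerDl -scalerA.
rewrite big_split -scaler_sumr /=; congr (_ *: _ + _).
  rewrite (@sum_widen V (maxn K M) K (fun k => (if (k < K)%N then c k else 0) *: u k)).
  - by apply: eq_bigr => i _; rewrite ltn_ord.
  - by move=> k; rewrite geq_max => /andP[le _]; rewrite ltnNge le scale0r.
  - by move=> k le; rewrite ltnNge le scale0r.
rewrite (@sum_widen V (maxn K M) M (fun k => (if (k < M)%N then d k else 0) *: u k)).
- by apply: eq_bigr => i _; rewrite ltn_ord.
- by move=> k; rewrite geq_max => /andP[_ le]; rewrite ltnNge le scale0r.
- by move=> k le; rewrite ltnNge le scale0r.
Qed.
End CountableSpan.

Section PrimitiveDichotomy.
Variables (F : closedFieldType) (charF : [pchar F] =i pred0).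
Local Notation R := (emx F).

Lemma bounded_spanned (V : lmodType F) N (Y : V -> Prop) (phi : V -> R) :
  subspace Y -> linear phi -> (forall p, Y p -> bounded N (phi p)) ->
  exists r (u : 'I_r -> V), (forall j, Y (u j)) /\
    forall p, Y p -> exists c : 'I_r -> F, phi p = phi (\sum_j c j *: u j).
Proof.
move=> sY lphi HN.
have [|r [u [Yu Hu]]] := @finite_codim F V Y (N * N)%N
    (fun k p => mxvec (trunc N (phi p)) 0 k) sY.
  by move=> k a x y; rewrite lphi linearP /= linearP /= !mxE.
exists r, u; split=> // p Yp; have [c Hc] := Hu p Yp; exists c.
apply: (trunc_inj (HN _ Yp)); first by apply: HN; exact: (subsp_comb sY).
by apply: (can_inj mxvecK); apply/rowP => k; exact: Hc.
Qed.

(** The elements whose image is bounded by N have a finite-dimensional image. Generators of all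
    these images are numbered by pairs (N, j). *)
Lemma countable_spanned (V : lmodType F) (Y : V -> Prop) (phi : V -> R) :
  subspace Y -> linear phi -> (forall p, Y p -> fin (phi p)) ->
  exists2 u : nat -> V, forall k, Y (u k) &
    forall p, Y p -> exists K (c : nat -> F), phi p = phi (\sum_(k < K) c k *: u k).
Proof.
move=> sY lphi HY.
have H N : exists u : nat -> V, (forall k, Y (u k)) /\ forall p, Y p -> bounded N (phi p) ->
    exists r (c : 'I_r -> F), phi p = phi (\sum_j c j *: u j).
  pose YN p := Y p /\ bounded N (phi p).
  have sYN : subspace YN.
    split; first by split; [exact: subsp0 | rewrite (linear_0 lphi); exact: subsp0 (bounded_sub _ _)].
    move=> a x y [Yx Bx] [Yy By]; split; first exact: (proj2 sY).
    by rewrite lphi; exact: (proj2 (bounded_sub _ _)).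
  have [|r [u [Yu Hu]]] := @bounded_spanned V N YN phi sYN lphi; first by move=> p [].
  exists (fun k => if insub k is Some i then u i else 0); split.
    by move=> k; case: insubP => [i _ _|_]; [case: (Yu i) | exact: subsp0].
  move=> p Yp Bp; have [c ->] := Hu p (conj Yp Bp); exists r, c; congr phi.
  by apply: eq_bigr => j _; rewrite valK.
have [uu Huu] := choice H.
pose u k := if @unpickle (nat * nat)%type k is Some z then uu z.1 z.2 else 0.
exists u => [k|p Yp].
  by rewrite /u; case: unpickle => [z|]; [case: (Huu z.1) | exact: subsp0].
have [N HN] := fin_bounded (HY p Yp); have [_ /(_ p Yp HN) [r [c ->]]] := Huu N.
have [|K [d ->]] := @nat_span F V u (\sum_j c j *: uu N j); last by exists K, d.
apply: (subsp_comb (span_subspace _)) => j; apply: span_incl.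
by exists (pickle (N, j : nat)); rewrite /u pickleK.
Qed.

Variables (L : lmodType F) (br : L -> L -> L) (f : L -> R).
Hypotheses (HL : lie_axioms br) (Hf : lie_rep br f).
Variables (e : R) (n : nat).
Hypothesis He : primitive f e n.

Let n0 : n%:R != 0 :> F.
Proof. by rewrite (natr_eq0_pchar0 charF) -lt0n; case: He. Qed.
Let fe : fin e. Proof. by case: He => We _ _ _ _; exact: (walg_plus_fin Hf We). Qed.
Let We : walg f e. Proof. by case: He => /walg_plusE. Qed.
Let ee : e * e = e. Proof. by case: He. Qed.

Let B (p q : R) : F^o := n%:R^-1 * tr (e * p * q).
Let Bl q : linear (B^~ q).
Proof.
move=> a x y; rewrite /B mulrDr mulrDl -scalerAr -scalerAl linearP /= mulrDr; congr (_ + _).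
by rewrite -[RHS]/(_ * _) mulrCA.
Qed.
Let Br p : linear (B p).
Proof.
move=> a x y; rewrite /B mulrDr -scalerAr linearP /= mulrDr; congr (_ + _).
by rewrite -[RHS]/(_ * _) mulrCA.
Qed.

(** This is the primitivity of e; it makes q e p' act as an operator of rank one on the paired
    spaces. *)
Let Bmul p q p' q' : walg f p -> walg f q -> walg f p' -> walg f q' ->
  B p (q * e * p' * q') = B p q * B p' q'.
Proof.
move=> Wp Wq Wp' Wq'; have [_ _ _ _ H] := He; rewrite /B.
have := H (p * q) (p' * q') (walgM Wp Wq) (walgM Wp' Wq'); rewrite !mulrA => E.
have -> : tr (e * p * q * e * p' * q') = n%:R^-1 * (tr (e * p * q) * tr (e * p' * q')).
  by rewrite -E mulKf.
have AA (a b c : F) : a * (a * (b * c)) = a * b * a * c by ring.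
exact: AA.
Qed.

Let BA p a q : B (p * a) q = B p (a * q).
Proof. by rewrite /B !mulrA. Qed.

(* By primitivity (p, q) |-> tr (e p q) / n pairs e BB and BB e so that walg f acts on
   BB e modulo the radical, BB being walg f. In dual bases x, y of this pairing g s has entries
   tr (e y_k f(s) x_l) / n, and x_i e y_j acts as the matrix unit (i, j). *)
Theorem primitive_dichotomy :
  (exists D (th : 'I_D -> L -> F^o), (forall i, linear (th i)) /\
     forall x, killed f e x <-> forall i, th i x = 0) \/
  exists g, [/\ lie_rep br g, forall x, g x = 0 <-> killed f e x &
                forall i j, walg_plus g (eu F i j)].
Proof.
have [lf fbr ff] := Hf.
have [|||u Wu Hu] := @countable_spanned R (walg f) (fun p => e * p).
- exact: walg_sub.
- by move=> a x y; rewrite mulrDr scalerAr.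
- by move=> p _; exact: fin_mull.
have [|||v Wv Hv] := @countable_spanned R (walg f) (fun q => q * e).
- exact: walg_sub.
- by move=> a x y; rewrite mulrDl scalerAl.
- by move=> p _; exact: fin_mulr.
have [||y [x [Wyx Hyx]]] := @dual_bases F R R (walg f) (walg f) B u v
    (walg_sub f) (walg_sub f) Bl Br Wu Wv.
- move=> p Wp; have [K [c Hc]] := Hu p Wp; exists K, c => q _.
  rewrite {1}/B Hc -/(B _ q) (linear_comb _ _ (Bl q)); by [].
- move=> q Wq; have [K [c Hc]] := Hv q Wq; exists K, c => p _.
  have E r : B p r = n%:R^-1 * tr (p * (r * e)) by rewrite /B -mulrA trC !mulrA.
  by rewrite E Hc -E (linear_comb _ _ (Br p)).
have Wy i : walg f (y i) by case: (Wyx i).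
have Wx i : walg f (x i) by case: (Wyx i).
have killedB s : killed f e s <-> forall p q, walg f p -> walg f q -> B p (f s * q) = 0.
  split=> H p q Wp Wq; first by rewrite /B mulrA H // mulr0.
  by have /eqP := H p q Wp Wq; rewrite /B mulf_eq0 invr_eq0 (negPf n0) /= mulrA => /eqP.
case: Hyx => [[D HD]|[dual Hp Hq]]; [left|right].
  (* When the pairing has finite rank, the action of f(s) is determined by finitely many entries
     B(y_i, f(s) x_j), so the elements killed by e have finite codimension. *)
  exists (D * D)%N, (fun k s => mxvec (\matrix_(i < D, j < D) (B (y i) (f s * x j) : F)) 0 k).
  split.
    move=> k a s t.
    have -> : \matrix_(i < D, j < D) (B (y i) (f (a *: s + t) * x j) : F) =
        a *: (\matrix_(i < D, j < D) (B (y i) (f s * x j) : F)) +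
        \matrix_(i < D, j < D) (B (y i) (f t * x j) : F).
      by apply/matrixP => i j; rewrite !mxE lf mulrDl -scalerAl Br.
    by rewrite linearP /= !mxE.
  move=> s; rewrite killedB; split=> [H k|H p q Wp Wq].
    have -> : \matrix_(i < D, j < D) (B (y i) (f s * x j) : F) = 0.
      by apply/matrixP => i j; rewrite !mxE H.
    by rewrite linear0 mxE.
  have {}H (i j : 'I_D) : B (y i) (f s * x j) = 0.
    have /eqP : mxvec (\matrix_(i < D, j < D) (B (y i) (f s * x j) : F)) = 0.
      by apply/rowP => k; rewrite H mxE.
    by rewrite mxvec_eq0 => /eqP/matrixP/(_ i j); rewrite !mxE.
  have Ws := walg_f f s.
  rewrite -BA HD //; last exact: walgM.
  rewrite big1 // => i _; rewrite BA.
  have -> : B p (f s * x i) = 0.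
    rewrite HD //; last exact: walgM.
    by rewrite big1 // => j _; rewrite H mulr0.
  by rewrite mul0r.
(* As f(s) has finite rank, f(s) q e and e p f(s) range over finite-dimensional spaces. Expanding
   finitely many generators in the dual bases bounds the row index and the column index. *)
have Hfin s : fsupp (fun k l => B (y k) (f s * x l)).
  have Ws := walg_f f s.
  have [N HN] := fin_bounded (ff s); have [M HM] := fin_bounded fe.
  pose NM := maxn N M; have bs := bounded_le (leq_maxl N M) HN.
  have be := bounded_le (leq_maxr N M) HM.
  have sand (a b c : R) : bounded NM a -> bounded NM c -> bounded NM (a * b * c).
    move=> Ha Hc; have -> : a * b * c = eid F NM * (a * b * c) * eid F NM.
      by rewrite !mulrA (eid_mull Ha) -!mulrA (eid_mulr Hc).
    by apply: eid_bounded; apply/fin_mulr/(proj1 Hc).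
  have bse q : bounded NM (f s * q * e) := sand _ _ _ bs be.
  have bes p : bounded NM (e * p * f s) := sand _ _ _ be bs.
  have [|||r [w [Ww Hw]]] := @bounded_spanned R NM (walg f) (fun q => f s * q * e).
  - exact: walg_sub.
  - by move=> a p q; rewrite mulrDr mulrDl -scalerAr -scalerAl.
  - by move=> p _; exact: bse.
  have [|||r' [w' [Ww' Hw']]] := @bounded_spanned R NM (walg f) (fun p => e * p * f s).
  - exact: walg_sub.
  - by move=> a p q; rewrite mulrDr mulrDl -scalerAr -scalerAl.
  - by move=> p _; exact: bes.
  have [K HK] := choice (fun i => Hq (f s * w i) (walgM Ws (Ww i))).
  have [K' HK'] := choice (fun i => Hp (w' i * f s) (walgM (Ww' i) Ws)).
  exists (maxn (\max_i K i) (\max_i K' i)) => k l; rewrite !geq_max => -[]/andP[H1 H2].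
    have [c Hc] := Hw (x l) (Wx l).
    have E q : B (y k) (f s * q) = n%:R^-1 * tr (y k * (f s * q * e)).
      by rewrite /B -mulrA trC !mulrA.
    rewrite E Hc -E (linear_comb _ _ (_ : linear (fun q => B (y k) (f s * q)))); last first.
      by move=> a p q; rewrite mulrDr -scalerAr Br.
    rewrite big1 // => i _; rewrite HK // big1 ?scaler0 // => j _.
    rewrite dual gtn_eqF ?mul0r // (leq_trans _ H1) //.
    by rewrite (leq_trans (ltn_ord j)) // leq_bigmax.
  have [c Hc] := Hw' (y k) (Wy k).
  have E p : B p (f s * x l) = n%:R^-1 * tr (e * p * f s * x l).
    by rewrite /B !mulrA.
  rewrite E Hc -E (linear_comb _ _ (_ : linear (fun p => B p (f s * x l)))); last first.
    by move=> a p q; rewrite Bl.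
  rewrite big1 // => i _; rewrite -BA HK' // big1 ?scaler0 // => j _.
  rewrite dual ltn_eqF ?mulr0 // (leq_trans _ H2) //.
  by rewrite (leq_trans (ltn_ord j)) // leq_bigmax.
have [g Hg] := choice (fun s => let: ex_intro2 a fa Ea := fin_mx (Hfin s) in
   ex_intro (fun a => fin a /\ ent a = fun k l => B (y k) (f s * x l)) a (conj fa Ea)).
have fg s : fin (g s) by case: (Hg s).
have gE s k l : ent (g s) k l = B (y k) (f s * x l) by case: (Hg s) => _ ->.
have gmul s (a b : R) k l : walg f a -> fin b -> (forall m, ent b m l = B (y m) (a * x l)) ->
    ent (g s * b) k l = B (y k) (f s * a * x l).
  move=> Wa fb Eb; have [N HN] := fin_bounded (fg s).
  have [K HK] := Hq (a * x l) (walgM Wa (Wx l)).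
  rewrite (ent_mull _ _ (bounded_le (leq_maxl N K) HN) fb).
  rewrite -mulrA -BA HK; last exact: walgM (walg_f f s).
  rewrite (@sum_widen F (maxn N K) K (fun m => ent (g s) k m * ent b m l)).
  - by apply: eq_bigr => m _; rewrite gE Eb BA.
  - move=> m; rewrite geq_max => /andP[Nm _].
    by rewrite (proj2 HN) ?mul0r //; right.
  - move=> m Km; rewrite Eb HK // big1 ?mulr0 // => j _.
    by rewrite dual gtn_eqF ?mul0r // (leq_trans (ltn_ord j)).
have lg : linear g.
  move=> a s t; apply: ent_ext => //; first exact: (proj2 (fin_sub F)).
  by move=> k l; rewrite ent_lin !gE lf mulrDl -scalerAl Br.
have gbr s t : g (br s t) = g s * g t - g t * g s.
  apply: ent_ext => //; first by apply: (subspB (fin_sub F)); exact: fin_mull.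
  move=> k l; rewrite entB (gmul s (f t)) ?(gmul t (f s)) //; try exact: walg_f.
  by rewrite gE fbr mulrBl (linear_B (Br _)).
exists g; split=> //.
  move=> s; rewrite killedB; split=> [gs0 p q Wp Wq|H]; last first.
    by apply: ent_ext => // k l; rewrite gE H.
  have Ws := walg_f f s.
  have [K HK] := Hp (p * f s) (walgM Wp Ws); rewrite -BA HK // big1 // => i _.
  have [K' HK'] := Hp p Wp; rewrite BA HK'; last exact: walgM.
  by rewrite big1 ?mul0r // => j _; rewrite -gE gs0 mulr0.
have wordg w : w != [::] -> exists2 b : R, walg_plus g b &
    forall k l, ent b k l = B (y k) (fword f w * x l).
  move=> w0; exists (fword g w); first by apply: span_incl; exists w.
  elim: w w0 => // s [|t w] IH _ k l; first by rewrite /fword !big_seq1 gE.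
  have E w1 (f1 : L -> R) : fword f1 (s :: w1) = f1 s * fword f1 w1 by rewrite /fword big_cons.
  rewrite !E; apply: gmul; first exact: walg_word.
    by rewrite /fword big_cons; exact: fin_mull.
  by move=> m; rewrite IH.
have plusg a : walg_plus f a -> exists2 b : R, walg_plus g b &
    forall k l, ent b k l = B (y k) (a * x l).
  move: a; apply: span_min; last by move=> _ [w w0 ->]; exact: wordg.
  split; first by exists 0; [exact: subsp0 (walg_plus_sub g) |
     move=> k l; rewrite mul0r (linear_0 (Br _))].
  move=> a p q [b1 W1 H1] [b2 W2 H2]; exists (a *: b1 + b2).
    exact: (proj2 (walg_plus_sub g)).
  by move=> k l; rewrite ent_lin H1 H2 mulrDl -scalerAl Br.
(* The entries of x_i e y_j are B(y_k, x_i) B(y_j, x_l). Since e is a combination of nonempty words,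
   so is x_i e y_j, and its counterpart on the g side lies in [walg_plus g]. *)
move=> i j; have [|b Wb Hb] := plusg (x i * e * y j).
  have [We' _ _ _ _] := He; have Wxi := Wx i; have Wyj := Wy j.
  move: (e) We'; apply: span_min.
    exact: (mulr_subspace (x i) (mull_subspace (y j) (walg_plus_sub f))).
  move=> _ [[//|s w] _ ->]; rewrite /fword big_cons mulrA -[_ * _ * y j]mulrA.
  by apply: walg_plus_mul => //; apply: walgM => //; exact: walg_word.
suff -> : eu F i j = b by [].
apply: ent_ext => //; first by apply: (walg_plus_fin (br := br) (f := g)) Wb.
move=> k l; rewrite ent_eu Hb Bmul // !dual [l == j]eq_sym.
by case: (k == i); case: (j == l); rewrite /= ?mul1r ?mul0r ?mulr0.
Qed.
End PrimitiveDichotomy.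

(** * The image of an ideal in an infinite-dimensional factor *)

Section InfiniteFactor.
Variables (F : closedFieldType) (charF : [pchar F] =i pred0).
Variables (L : lmodType F) (br : L -> L -> L).
Hypothesis HL : lie_axioms br.
Local Notation R := (emx F).
Variables (f : L -> R) (h : nat -> L -> Prop).
Hypotheses (Hf : lie_rep br f) (finj : injective f).
Hypothesis Hh : forall n, fin_dim (h n) /\ subalg br (h n) /\ reductive br (h n).
Hypothesis hS : forall n x, h n x -> h n.+1 x.
Hypothesis hall : forall x, exists n, h n x.
Variables (g : L -> R).
Hypotheses (Hg : lie_rep br g) (geu : forall i j, walg_plus g (eu F i j)).

Let lg : linear g. Proof. by case: Hg. Qed.
Let gbr x y : g (br x y) = g x * g y - g y * g x. Proof. by case: Hg. Qed.
Let fg x : fin (g x). Proof. by case: Hg. Qed.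

(** Commuting g(y) to the left through a word changes it only by other elements of g(Y), so a g(y)
    has no rows beyond K for any a in [walg_plus g]. With a the matrix unit (K, p), row K of a g(y)
    is row p of g(y), which is therefore 0. *)
Lemma finite_image_ideal (Y : L -> Prop) K : (forall y, Y y -> bounded K (g y)) ->
  (forall s y, Y y -> exists2 y', Y y' & g (br s y) = g y') -> forall y, Y y -> g y = 0.
Proof.
move=> YK Ybr y Yy; apply: ent_ext => // p q; rewrite ent0.
have rows w : forall u v i j, Y u -> (K <= i)%N -> fin v -> ent (fword g w * g u * v) i j = 0.
  elim/last_ind: w => [|w s IH] u v i j Yu Ki fv.
    rewrite /fword big_nil mul1r (ent_mull _ _ (YK u Yu) fv) big1 // => k _.
    by rewrite (proj2 (YK u Yu)) ?mul0r //; left.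
  have [u' Yu' E] := Ybr s u Yu.
  have -> : fword g (rcons w s) * g u * v = fword g w * g u * (g s * v) + fword g w * g u' * v.
    by rewrite -E gbr /fword big_rcons /= mulrBr mulrBl !mulrA addrC subrK.
  by rewrite entD !IH ?addr0 //; exact: fin_mulr.
have {}rows a i j : walg_plus g a -> (K <= i)%N -> ent (a * g y) i j = 0.
  move=> Wa Ki; move: a Wa.
  apply: (@span_min _ _ _ (fun a => ent (a * g y) i j = 0)).
    split; first by rewrite mul0r.
    by move=> c a b Ha Hb; rewrite mulrDl -scalerAl ent_lin Ha Hb mulr0 addr0.
  move=> _ [w _ ->]; have [M HM] := fin_bounded (fg y).
  have -> : fword g w * g y = fword g w * g y * eid F M.
    by rewrite -mulrA (eid_mulr HM).
  by apply: rows => //; exact: (proj1 (bounded_eid F M)).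
by have := rows _ K q (geu K p) (leqnn K); rewrite ent_eul // eqxx mul1r.
Qed.

Definition far N z := forall i j, (i < N)%N -> (j < N)%N -> ent (g z) i j = 0.

Lemma far_le N M z : (N <= M)%N -> far M z -> far N z.
Proof. by move=> le H i j iN jN; apply: H; exact: leq_trans le. Qed.

Lemma far_sandwich N z a b : bounded N a -> bounded N b -> far N z -> a * g z * b = 0.
Proof.
move=> Ha Hb Hz; rewrite -(eid_mulr Ha) -(eid_mull Hb).
have -> : a * eid F N * g z * (eid F N * b) = a * (eid F N * g z * eid F N) * b.
  by rewrite !mulrA.
suff -> : eid F N * g z * eid F N = 0 by rewrite mulr0 mul0r.
apply: ent_ext => //; first by exact: fin_mulr (proj1 (bounded_eid F N)).
by move=> i j; rewrite ent_eid //; case: ifP => // /andP[iN jN]; rewrite Hz.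
Qed.

(* reversal is the graph of w_1 ... w_k |-> (-1)^k w_k ... w_1 on products of elements of g L. It
   may fail to be a function: that is the case of gl, and otherwise it is an involution. *)
Definition revpair w : R * R := (fword g w, (-1) ^+ size w *: fword g (rev w)).

Definition reversal (a b : R) : Prop :=
  lspan (fun z => exists2 w, w != [::] & z = revpair w) (a, b).

Lemma reversal_sub : subspace (fun z => reversal z.1 z.2).
Proof.
have H : subspace (lspan (fun z => exists2 w, w != [::] & z = revpair w)) by exact: span_subspace.
have E (z : R * R) : (z.1, z.2) = z by case: z.
by split=> [|c x y]; rewrite /reversal !E; [exact: subsp0 | exact: (proj2 H)].
Qed.

Lemma reversal_min (T : R * R -> Prop) : subspace T ->
  (forall w, w != [::] -> T (revpair w)) -> forall a b, reversal a b -> T (a, b).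
Proof. by move=> HT H a b; apply: (span_min HT) => _ [w w0 ->]; exact: H. Qed.

Lemma reversal_word w : w != [::] -> reversal (revpair w).1 (revpair w).2.
Proof. by move=> w0; apply: span_incl; exists w. Qed.

Lemma reversal_preim (phi : R * R -> R * R) : linear phi ->
  subspace (fun z => reversal (phi z).1 (phi z).2).
Proof. by move=> lphi; exact: (preim_subspace lphi reversal_sub). Qed.

Lemma reversalC a b : reversal a b -> reversal b a.
Proof.
apply: (@reversal_min (fun z => reversal z.2 z.1)) => [|w w0].
  by apply: (@reversal_preim (fun z => (z.2, z.1))).
have w0' : rev w != [::] by rewrite -size_eq0 size_rev size_eq0.
have := subspZ reversal_sub ((-1) ^+ size w) (reversal_word w0').
by rewrite /= size_rev revK scalerA -expr2 sqrr_sign scale1r.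
Qed.

Lemma reversalM a a' b b' : reversal a a' -> reversal b b' -> reversal (a * b) (b' * a').
Proof.
move=> Ha; apply: (@reversal_min (fun z => reversal (a * z.1) (z.2 * a'))) => [|v v0].
  apply: (@reversal_preim (fun z => (a * z.1, z.2 * a'))) => c x y /=.
  by apply: injective_projections; rewrite /= ?mulrDr ?mulrDl -?scalerAr -?scalerAl.
move: a a' Ha; apply: (@reversal_min (fun z => reversal (z.1 * _) (_ * z.2))) => [|w w0].
  apply: (@reversal_preim (fun z => (z.1 * (revpair v).1, (revpair v).2 * z.2))) => c x y /=.
  by apply: injective_projections; rewrite /= ?mulrDr ?mulrDl -?scalerAr -?scalerAl.
have wv0 : w ++ v != [::] by case: (w) w0.
have := reversal_word wv0; rewrite /revpair /= /fword rev_cat !big_cat size_cat /=.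
by rewrite exprD -scalerAr -scalerAl scalerA mulrC.
Qed.

Lemma reversal_fin a b : reversal a b -> fin a /\ fin b.
Proof.
apply: (@reversal_min (fun z => fin z.1 /\ fin z.2)) => [|w w0].
  by split=> // c x y [x1 x2] [y1 y2]; split; apply: (proj2 (fin_sub _)).
have w0' : rev w != [::] by rewrite -size_eq0 size_rev size_eq0.
have H v : v != [::] -> fin (fword g v).
  by case: v => // s v _; rewrite /fword big_cons; exact: fin_mull.
by split; [exact: H | apply: (subspZ (fin_sub _)); exact: H].
Qed.

Lemma reversal_total a : fin a -> exists b, reversal a b.
Proof.
move=> fa; have : walg_plus g a.
  have [N HN] := fin_bounded fa; rewrite (eu_decomp HN).
  apply: (subsp_sum (walg_plus_sub g)) => i _; exact: (subsp_comb (walg_plus_sub g)).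
move: a {fa}; apply: span_min => [|_ [w w0 ->]].
  split; first by exists 0; exact: (subsp0 reversal_sub).
  move=> c a a' [b Hb] [b' Hb']; exists (c *: b + b').
  exact: (proj2 reversal_sub c (a, b) (a', b')).
by exists (revpair w).2; exact: reversal_word.
Qed.

Lemma reversal_rep s : reversal (g s) (- g s).
Proof.
by have := @reversal_word [:: s] isT; rewrite /revpair /= /fword !big_seq1 expr1 scaleN1r.
Qed.

Variable X : L -> Prop.
Hypotheses (HX : lideal br X) (XS : forall x, X x -> derived br x).
Hypothesis X0 : exists2 x, X x & g x != 0.

Let sX : subspace X. Proof. by case: HX. Qed.
Let Xbr x y : X y -> X (br x y). Proof. by case: HX => _ [_ H]; exact: H. Qed.

(** T has finite rank on X modulo ker g; the image is placed inside one of the subalgebras h_M so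
    that their structure can be applied to it. *)
Let FR T := exists M, forall y, X y -> exists2 z, X z /\ derived_set br (h M) z & g (T y) = g z.

Lemma far_codim N : exists r (y : 'I_r -> L), (forall i, X (y i)) /\
  forall x, X x -> exists c, far N (x - \sum_i c i *: y i).
Proof.
have [|r [y [Xy Hy]]] := @finite_codim F L X (N * N)%N
    (fun k p => mxvec (trunc N (g p)) 0 k) sX.
  by move=> k a x y; rewrite lg linearP /= linearP /= !mxE.
exists r, y; split=> // x Xx; have [c Hc] := Hy x Xx; exists c => i j iN jN.
have /matrixP/(_ (Ordinal iN) (Ordinal jN)) : trunc N (g x) = trunc N (g (\sum_i c i *: y i)).
  by apply: (can_inj mxvecK); apply/rowP => k; exact: Hc.
by rewrite !mxE (linear_B lg) entB => ->; rewrite subrr.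
Qed.

(** The far elements have finite codimension in X and the trace form is nondegenerate on g(X), so
    their orthogonal is finite-dimensional modulo ker g. *)
Lemma finite_perp N : exists r (u : 'I_r -> L), (forall i, X (u i)) /\
  forall w, X w -> (forall z, X z -> far N z -> tr (g w * g z) = 0) ->
  exists c, g w = g (\sum_i c i *: u i).
Proof.
have [r [y [Xy Hy]]] := far_codim N.
pose P w := X w /\ forall z, X z -> far N z -> tr (g w * g z) = 0.
have ltr z : linear (fun w => tr (g w * g z) : F^o).
  by move=> a u w; rewrite lg mulrDl -scalerAl linearP.
have sP : subspace P.
  split; first split; first exact: subsp0.
    by move=> z _ _; rewrite (linear_0 lg) mul0r linear0.
  move=> a u w [Xu Hu] [Xw Hw]; split; first exact: (proj2 sX).
  by move=> z Xz fz; rewrite ltr Hu // Hw // scaler0 addr0.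
have [|k [u [Pu Hu]]] := @finite_codim F L P r (fun i w => tr (g w * g (y i))) sP.
  by move=> i; exact: ltr.
exists k, u; split=> [i|w Xw Hw]; first by case: (Pu i).
have [c Hc] := Hu w (conj Xw Hw); exists c.
have Pc : P (\sum_j c j *: u j) by exact: (subsp_comb sP).
have [Xd Hd] : P (w - \sum_j c j *: u j) by exact: (subspB sP).
apply/eqP; rewrite -subr_eq0 -(linear_B lg); apply/eqP.
apply: (rep_nondegenerate charF HL Hf finj Hh hS hall Hg HX XS Xd) => x Xx.
have [d Hd'] := Hy x Xx.
have := Hd _ (subspB sX Xx (subsp_comb sX d Xy)) Hd'.
rewrite (linear_B lg x) mulrBr linearB /= => /eqP; rewrite subr_eq0 => /eqP ->.
rewrite (linear_comb d y lg) mulr_sumr linear_sum big1 // => i _.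
rewrite -scalerAr linearZ /= (linear_B (ltr _)) -(Hc i) subrr; exact: mulr0.
Qed.

Lemma local_all x : X x -> exists M, forall M', (M <= M')%N -> X x /\ derived_set br (h M') x.
Proof.
move=> Xx; have [M Dx] := derived_local hS hall (XS Xx); exists M => M' le; split=> //.
exact: derived_h_mono Dx.
Qed.

Lemma local_subspace M : subspace (fun z => X z /\ derived_set br (h M) z).
Proof.
have sD := derived_set_subspace br (h M); split; first by split; exact: subsp0.
by move=> a x y [Xx Dx] [Xy Dy]; split; [exact: (proj2 sX) | exact: (proj2 sD)].
Qed.

Lemma local_family r (u : 'I_r -> L) : (forall i, X (u i)) ->
  exists M, forall i, X (u i) /\ derived_set br (h M) (u i).
Proof.
move=> Xu; have [M HM] := choice (fun i => local_all (Xu i)).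
exists (\max_i M i) => i; apply: HM; exact: leq_bigmax.
Qed.

Section NoFarProducts.
Hypothesis nofar : forall p q, exists N, forall z z', X z -> X z' -> far N z -> far N z' ->
  ent (g z * g z') p q = 0.

(* If z and z' are far then tr ([t, [s, z]] z') only involves entries of z z' and z' z, so ad t ad s
   maps a subspace of finite codimension into the orthogonal of another one. *)
Lemma double_ad_finite s t : FR (fun y => br t (br s y)).
Proof.
have [M1 H1] := fin_bounded (fg s); have [M2 H2] := fin_bounded (fg t).
pose M := maxn M1 M2; have bs := bounded_le (leq_maxl M1 M2) H1.
have bt := bounded_le (leq_maxr M1 M2) H2.
have [NN HNN] := choice (fun z : 'I_M * 'I_M => nofar z.1 z.2).
pose N := maxn M (\max_z NN z).
have MN : (M <= N)%N by exact: leq_maxl.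
have prod0 a z z' : bounded M a -> X z -> X z' -> far N z -> far N z' ->
    tr (a * (g z * g z')) = 0.
  move=> ba Xz Xz' fz fz'; rewrite -{1}(eid_mulr ba) -{1}(eid_mull ba).
  have -> : eid F M * a * eid F M * (g z * g z') = eid F M * (a * (eid F M * (g z * g z'))).
    by rewrite !mulrA.
  rewrite trC -mulrA; suff -> : eid F M * (g z * g z') * eid F M = 0 by rewrite mulr0 linear0.
  apply: ent_ext => //; first by apply: fin_mulr; exact: (proj1 (bounded_eid F M)).
  move=> i j; rewrite ent_eid; last exact: fin_mull.
  case: ifP => // /andP[iM jM]; apply: (HNN (Ordinal iM, Ordinal jM)) => //.
    by apply: far_le fz; rewrite leq_max leq_bigmax orbT.
  by apply: far_le fz'; rewrite leq_max leq_bigmax orbT.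
have [r [y [Xy Hy]]] := far_codim N; have [k [u [Xu Hu]]] := finite_perp N.
have [A HA] := local_family Xu.
have [A' HA'] := local_family (fun i => Xbr t (Xbr s (Xy i))).
exists (maxn A A') => x Xx; have [c Hc] := Hy x Xx.
set z := x - _ in Hc; have Xz : X z by apply: (subspB sX) => //; exact: (subsp_comb sX).
have [|d Hd] := Hu (br t (br s z)) (Xbr t (Xbr s Xz)).
  move=> z' Xz' fz'; rewrite !gbr.
  have E : g t * (g s * g z - g z * g s) - (g s * g z - g z * g s) * g t =
      g t * g s * g z + g z * g s * g t.
    rewrite mulrBr mulrBl !mulrA (far_sandwich (bounded_le MN bt) (bounded_le MN bs) Hc).
    by rewrite (far_sandwich (bounded_le MN bs) (bounded_le MN bt) Hc) subr0 sub0r opprK.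
  have bts := bounded_mul bt bs; have bst := bounded_mul bs bt.
  rewrite E mulrDl linearD /= -mulrA prod0 // add0r -!mulrA trC -!mulrA mulrA.
  exact: prod0.
exists (\sum_i d i *: u i + \sum_i c i *: br t (br s (y i))).
  apply: (subspD (local_subspace _)); apply: (subsp_comb (local_subspace _)) => i.
    have [H3 H4] := HA i; split=> //; apply: derived_h_mono H4 => //; exact: leq_maxl.
  have [H3 H4] := HA' i; split=> //; apply: derived_h_mono H4 => //; exact: leq_maxr.
rewrite (linear_D lg) -Hd -(linear_D lg); congr g.
have lT : linear (fun y => br t (br s y)) by move=> a v w; rewrite !(br_linr HL).
by rewrite -(linear_comb _ _ lT) -(linear_D lT) /z subrK.
Qed.

Lemma FR_lin a T T' : FR T -> FR T' -> FR (fun y => a *: T y + T' y).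
Proof.
move=> [M HM] [M' HM']; exists (maxn M M') => y Xy.
have [z [Xz Dz] E] := HM y Xy; have [z' [Xz' Dz'] E'] := HM' y Xy.
exists (a *: z + z'); last by rewrite !lg E E'.
apply: (proj2 (local_subspace _)); split=> //; [apply: derived_h_mono Dz | apply: derived_h_mono Dz'];
  by rewrite // ?leq_maxl ?leq_maxr.
Qed.

Lemma ad_finite s : derived br s -> FR (br s).
Proof.
apply: (@derived_set_min _ _ br (fun _ => True) (fun s => FR (br s))) => [|t1 t2 _ _].
  split; first by exists 0%N => y Xy; exists 0; rewrite ?(br0l HL) //; exact: (subsp0 (local_subspace _)).
  move=> a u w Hu Hw; have [M HM] := FR_lin a Hu Hw; exists M => y Xy.
  by rewrite (br_linl HL); exact: HM.
have [M HM] := FR_lin (-1) (double_ad_finite t1 t2) (double_ad_finite t2 t1).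
exists M => y Xy; have [z Hz E] := HM y Xy; exists z => //.
by rewrite -E /= (br_jacobi HL t1 t2 y) scaleN1r addrCA addNr addr0.
Qed.

(* Here ad x has finite rank on X modulo ker g for every x in X, so g X would contain a nonzero
   finite-dimensional ideal of g L, against the matrix units in walg_plus g. *)
Lemma no_far_products : False.
Proof.
have [x Xx gx0] := X0; have [m0 /(_ m0 (leqnn _)) [_ Dx]] := local_all Xx.
pose Xm m y := X y /\ derived_set br (h m) y.
have [M m0M HM] : exists2 M, (m0 <= M)%N & forall y u, Xm m0 y -> X u ->
    exists2 z, Xm M z & g (br y u) = g z.
  have [fh [sh _]] := Hh m0.
  have [|r [v Hv]] := fin_dim_sub fh (local_subspace m0).
    by move=> y [_]; exact: (derived_set_sub sh).
  have vX : forall i, Xm m0 (v i) := fin_dim_generator Hv.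
  have [MM HMM] := choice (fun i => ad_finite (XS (proj1 (vX i)))).
  exists (maxn m0 (\max_i MM i)) => [|y u /Hv [c ->] Xu]; first exact: leq_maxl.
  have [z Hz] := choice (fun i => let: ex_intro2 z Hz E := HMM i u Xu in
    ex_intro (fun z => (X z /\ derived_set br (h (MM i)) z) /\ g (br (v i) u) = g z) z (conj Hz E)).
  exists (\sum_i c i *: z i).
    apply: (subsp_comb (local_subspace _)) => i; have [[Xz Dz] _] := Hz i; split=> //.
    by apply: derived_h_mono Dz; rewrite // leq_max leq_bigmax orbT.
  rewrite (linear_comb _ _ (br_linl HL u)) !(linear_comb _ _ lg); apply: eq_bigr => i _.
  by case: (Hz i) => _ ->.
have XmM m y : (m <= M)%N -> Xm m y -> Xm M y.
  by move=> le [Xy Dy]; split=> //; exact: derived_h_mono Dy.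
(* [Y] collects the y in the local part of X whose brackets with all of X stay in that part modulo
   ker g. It is an ideal of h_M containing x, hence perfect. *)
pose Y y := Xm M y /\ forall u, X u -> exists2 z, Xm M z & g (br y u) = g z.
have sM := local_subspace M; have [fhM [shM _]] := Hh M.
have hXm s y : h M s -> Xm M y -> Xm M (br s y).
  by move=> hs Hy; have [_ [_ H]] := local_ideal Hh M HX; exact: H.
have HY : ideal_in br (h M) Y.
  split; first split.
  - split; first exact: subsp0.
    by move=> u _; exists 0; [exact: subsp0 | rewrite (br0l HL)].
  - move=> a y1 y2 [H1 H1'] [H2 H2']; split; first exact: (proj2 sM).
    move=> u Xu; have [z1 Hz1 E1] := H1' u Xu; have [z2 Hz2 E2] := H2' u Xu.
    by exists (a *: z1 + z2); [exact: (proj2 sM) | rewrite (br_linl HL) !lg E1 E2].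
  split=> [y [[_ Dy] _]|s y hs [Hy Hy']]; first exact: (derived_set_sub shM).
  split; first exact: hXm.
  move=> u Xu; have [z1 Hz1 E1] := Hy' u Xu; have [z2 Hz2 E2] := Hy' _ (Xbr s Xu).
  exists (br s z1 - z2); first by apply: (subspB sM) => //; exact: hXm.
  have -> : br (br s y) u = br s (br y u) - br y (br s u).
    by rewrite (br_jacobi HL s) addrK.
  by rewrite !(linear_B lg) E2 (gbr s (br y u)) (gbr s z1) E1.
have [_ _ perf] := local_structure charF HL Hf finj Hh M.
have {}perf y : Y y -> derived_set br Y y.
  by apply: perf => // z [[]].
have sY := ideal_subspace HY.
(* Writing y as brackets of elements of Y improves the target from the local part of X to Y itself.
   Applied once more to [s, [y1, y2]], whose Jacobi terms are brackets of Y with X, it gives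
   stability under all of L. *)
have YX y u : Y y -> X u -> exists2 z, Y z & g (br y u) = g z.
  move=> /perf; move: y; apply: (@derived_set_min _ _ br Y
    (fun y => X u -> exists2 z, Y z & g (br y u) = g z)) => [|y1 y2 H1 H2 Xu].
    split; first by exists 0; [exact: subsp0 | rewrite (br0l HL)].
    move=> a y1 y2 H1 H2 Xu; have [z1 Hz1 E1] := H1 Xu; have [z2 Hz2 E2] := H2 Xu.
    by exists (a *: z1 + z2); [exact: (proj2 sY) | rewrite (br_linl HL) !lg E1 E2].
  have [z1 Hz1 E1] := proj2 H1 u Xu; have [z2 Hz2 E2] := proj2 H2 u Xu.
  have hM z : Xm M z -> h M z by case=> _; exact: (derived_set_sub shM).
  have [_ [_ Ybr]] := HY.
  exists (- br z2 y1 + br z1 y2).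
    by apply: (subspD sY); [apply: (subspN sY)|]; apply: Ybr => //; exact: hM.
  have -> : br (br y1 y2) u = br y1 (br y2 u) - br y2 (br y1 u).
    by rewrite (br_jacobi HL y1) addrK.
  rewrite (linear_B lg (br y1 _)) (gbr y1 (br y2 u)) (gbr y2 (br y1 u)) E1 E2.
  by rewrite (linear_D lg (- br z2 y1)) (linear_N lg) (gbr z2) (gbr z1) !opprB.
have [N HN] := rep_bounded Hh M Hg.
case/negP: gx0; apply/eqP; apply: (@finite_image_ideal Y N.+1).
- by move=> y [[_ Dy] _]; apply: HN; exact: (derived_set_sub shM).
- move=> s y /perf; move: y; apply: (@derived_set_min _ _ br Y
    (fun y => exists2 z, Y z & g (br s y) = g z)) => [|y1 y2 H1 H2].
    split; first by exists 0; [exact: subsp0 | rewrite (br0r HL)].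
    move=> a y1 y2 [z1 Hz1 E1] [z2 Hz2 E2].
    by exists (a *: z1 + z2); [exact: (proj2 sY) | rewrite (br_linr HL) !lg E1 E2].
  have X1 := proj1 (proj1 H1); have X2 := proj1 (proj1 H2).
  have [z1 Hz1 E1] := YX _ _ H1 (Xbr s X2); have [z2 Hz2 E2] := YX _ _ H2 (Xbr s X1).
  exists (- z2 + z1); first by apply: (subspD sY) => //; exact: (subspN sY).
  rewrite (br_jacobi HL) (br_anti HL (br s y1)) !(linear_D lg) !(linear_N lg) E1 E2 //.
split; first exact: (XmM m0 x m0M (conj Xx Dx)).
by move=> u Xu; apply: HM.
Qed.
End NoFarProducts.

Lemma far_products : exists p q, forall N, exists z z',
  [/\ X z, X z', far N z, far N z' & ent (g z * g z') p q != 0].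
Proof.
apply: contrapT => H; apply: no_far_products => p q.
apply: contrapT => H1; apply: H; exists p, q => N; apply: contrapT => H2.
apply: H1; exists N => z z' Xz Xz' fz fz'; apply: contrapT => /eqP n0.
by apply: H2; exists z, z'.
Qed.

(* Iterated brackets with x far from everything in sight: all terms with x in the middle vanish. *)
Lemma reversal_ad a b : reversal a b -> exists N, forall x, X x -> far N x ->
  exists2 y, X y & g y = a * g x + g x * b.
Proof.
apply: (@reversal_min (fun z => exists N, forall x, X x -> far N x ->
  exists2 y, X y & g y = z.1 * g x + g x * z.2)).
  split.
    by exists 0%N => x _ _; exists 0; [exact: subsp0 | rewrite mul0r mulr0 addr0 (linear_0 lg)].
  move=> c u v [N HN] [M HM]; exists (maxn N M) => x Xx fx.
  have [y1 Xy1 E1] := HN x Xx (far_le (leq_maxl _ _) fx).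
  have [y2 Xy2 E2] := HM x Xx (far_le (leq_maxr _ _) fx).
  exists (c *: y1 + y2); first exact: (proj2 sX).
  rewrite lg E1 E2 /= mulrDl mulrDr scalerDr -scalerAr -scalerAl.
  by rewrite addrACA.
move=> w w0; have [N HN] : exists N, forall s, s \in w -> bounded N (g s).
  elim: (w) => [|s v [N HN]]; first by exists 0%N.
  have [M HM] := fin_bounded (fg s); exists (maxn N M) => t; rewrite inE => /orP[/eqP->|tv].
    by apply: bounded_le HM; exact: leq_maxr.
  by apply: bounded_le (HN t tv); exact: leq_maxl.
exists N => x Xx fx; rewrite /revpair /=.
elim: w w0 HN => // s [|t v] IH _ HN.
  exists (br s x); first exact: Xbr.
  by rewrite /= /fword !big_seq1 expr1 scaleN1r mulrN gbr.
have [|y Xy E] := IH isT.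
  by move=> t' Ht'; apply: HN; rewrite inE Ht' orbT.
exists (br s y); first exact: Xbr.
have bw u : u != [::] -> (forall t', t' \in u -> bounded N (g t')) -> bounded N (fword g u).
  elim: u => // t1 [|t2 u] IHu _ Hu.
    by rewrite /fword big_seq1; apply: Hu; rewrite inE.
  rewrite /fword big_cons; apply: bounded_mul; first by apply: Hu; rewrite inE eqxx.
  by apply: IHu => // t' Ht'; apply: Hu; rewrite inE Ht' orbT.
have bs : bounded N (g s) by apply: HN; rewrite inE eqxx.
have b1 : bounded N (fword g (t :: v)).
  by apply: bw => // t' Ht'; apply: HN; rewrite inE Ht' orbT.
have b2 : bounded N (fword g (rev (t :: v))).
  apply: bw; first by rewrite -size_eq0 size_rev.
  by move=> t' Ht'; apply: HN; rewrite inE -mem_rev Ht' orbT.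
set w := t :: v in E b1 b2 *.
rewrite gbr E mulrDr mulrDl -!scalerAr -!scalerAl !mulrA.
rewrite (far_sandwich bs b2 fx) (far_sandwich b1 bs fx) scaler0 addr0 add0r.
have E1 : fword g (s :: w) = g s * fword g w by rewrite /fword big_cons.
have E2 : fword g (rev (s :: w)) = fword g (rev w) * g s by rewrite /fword rev_cons big_rcons.
by rewrite E1 E2 [(-1) ^+ (size v).+2]exprS mulN1r scaleNr !mulrA.
Qed.

Definition degenerate_reversal := exists2 u, u != 0 & reversal u 0.

Lemma reversal_unique : ~ degenerate_reversal -> forall u v w, reversal u v -> reversal u w -> v = w.
Proof.
move=> Hns u v w Hv Hw; apply/eqP; rewrite -subr_eq0; apply: contrapT => /negP n0; apply: Hns.
exists (v - w) => //; apply: reversalC; rewrite -(subrr u).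
exact: (@subspB _ _ _ reversal_sub (_, _) (_, _) Hv Hw).
Qed.

(** Multiplying the pair (u, 0) on both sides by pairs starting with matrix units keeps 0 in second
    place and isolates one nonzero entry of u. *)
Lemma degenerate_full : degenerate_reversal -> forall i j, reversal (eu F i j) 0.
Proof.
move=> [u u0 Hu] i j; have [fu _] := reversal_fin Hu.
have [p [q upq]] : exists p q, ent u p q != 0.
  apply: contrapT => H; case/negP: u0; apply/eqP; apply: ent_ext => // p q.
  by apply: contrapT => /eqP upq; apply: H; exists p, q.
have [b Hb] := reversal_total (fin_eu F i p); have [c Hc] := reversal_total (fin_eu F q j).
have := reversalM (reversalM Hb Hu) Hc; rewrite eu_sandwich // mul0r mulr0.
move=> H; have := @subspZ _ _ _ reversal_sub (ent u p q)^-1 (_, _) H.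
by rewrite /= scalerA mulVf // scale1r scaler0.
Qed.

Lemma traceless_span (S : R -> Prop) : subspace S ->
  (forall i j, i != j -> S (eu F i j)) -> (forall i, S (eu F i i - eu F 0 0)) ->
  forall a, fin a -> S (a - tr a *: eu F 0 0).
Proof.
move=> sS S1 S2 a fa; have [N HN] := fin_bounded fa.
have -> : a - tr a *: eu F 0 0 =
    \sum_(i < N) \sum_(j < N) ent a i j *: (eu F i j - (i == j)%:R *: eu F 0 0).
  rewrite {1}(eu_decomp HN) (trE_fsupp (proj2 HN)) scaler_suml -sumrB.
  apply: eq_bigr => i _; under [RHS]eq_bigr do rewrite scalerBr.
  rewrite sumrB; congr (_ - _); rewrite (bigD1 i) //= eqxx scale1r big1 ?addr0 // => j.
  by rewrite eq_sym => /negPf ->; rewrite scale0r scaler0.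
apply: (subsp_sum sS) => i _; apply: (subsp_sum sS) => j _; apply: (subspZ sS).
have [<-|ij] := altP (i =P j); first by rewrite scale1r; exact: S2.
by rewrite scale0r subr0; exact: S1.
Qed.

Lemma image_subspace : subspace (fun a => exists2 x, X x & g x = a).
Proof.
split; first by exists 0; [exact: subsp0 | exact: linear_0].
move=> c a b [x Xx <-] [y Xy <-]; exists (c *: x + y); [exact: (proj2 sX) | exact: lg].
Qed.

(** With the reversals equal to 0, both e_ip g(z) and g(z') e_qj lie in g(X) for far z and z'. Their
    commutator is a nonzero multiple of e_ij when i and j differ, since then e_qj e_ip = 0. *)
Lemma degenerate_image : degenerate_reversal -> forall a, fin a -> tr a = 0 ->
  exists2 x, X x & g x = a.
Proof.
move=> Hsp a fa ta; have Hfull := degenerate_full Hsp.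
have sI := image_subspace; have [p [q Hpq]] := far_products.
have off i j : i != j -> exists2 x, X x & g x = eu F i j.
  move=> ij; have [N1 H1] := reversal_ad (Hfull i p).
  have [N2 H2] := reversal_ad (reversalC (Hfull q j)).
  have [z [z' [Xz Xz' fz fz' n0]]] := Hpq (maxn N1 N2).
  have [y1 Xy1 E1] := H1 z Xz (far_le (leq_maxl _ _) fz).
  have [y2 Xy2 E2] := H2 z' Xz' (far_le (leq_maxr _ _) fz').
  exists ((ent (g z * g z') p q)^-1 *: br y1 y2); first by apply: (subspZ sX); exact: Xbr.
  rewrite (linear_Z lg) gbr E1 E2 !mulr0 !mul0r addr0 add0r.
  have -> : eu F i p * g z * (g z' * eu F q j) = eu F i p * (g z * g z') * eu F q j.
    by rewrite !mulrA.
  rewrite eu_sandwich; last exact: fin_mull.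
  have -> : g z' * eu F q j * (eu F i p * g z) = g z' * (eu F q j * eu F i p) * g z.
    by rewrite !mulrA.
  by rewrite eu_mul eq_sym (negPf ij) scale0r mulr0 mul0r subr0 scalerA mulVf ?scale1r.
have diag i : exists2 x, X x & g x = eu F i i - eu F 0 0.
  case: i => [|i]; first by rewrite subrr; exact: (subsp0 sI).
  have [x Xx Ex] := off i.+1 0%N isT; have [y Xy Ey] := off 0%N i.+1 isT.
  by exists (br x y); [exact: Xbr | rewrite gbr Ex Ey !eu_mul !eqxx !scale1r].
by have := traceless_span sI off diag fa; rewrite ta scale0r subr0.
Qed.

Let skew a := exists2 b, reversal a b & exists2 x, X x & g x = a - b.

Lemma skew_subspace : subspace skew.
Proof.
split.
  exists 0; first exact: (subsp0 reversal_sub).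
  by exists 0; [exact: subsp0 | rewrite (linear_0 lg) subrr].
move=> c a a' [b Hb [x Xx E]] [b' Hb' [x' Xx' E']]; exists (c *: b + b').
  exact: (proj2 reversal_sub c (a, b) (a', b')).
exists (c *: x + x'); first exact: (proj2 sX).
by rewrite lg E E' scalerBr opprD addrACA.
Qed.

(* Bracket of a z + z a' with b' z' + z' b, where a' and b' are the reversals of a = eu i p and
   b = eu q j. *)
Lemma skew_products i j p q : exists N, forall z z', X z -> X z' -> far N z -> far N z' ->
  skew (ent (g z * g z') p q *: eu F i j - (j == i)%:R *: (g z' * eu F q p * g z)).
Proof.
set a := eu F i p; set b := eu F q j.
have [a' Ha] := reversal_total (fin_eu F i p); have [b' Hb] := reversal_total (fin_eu F q j).
have [fa fa'] := reversal_fin Ha; have [fb fb'] := reversal_fin Hb.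
rewrite -/a -/b in Ha Hb fa fb.
have [N1 H1] := reversal_ad Ha; have [N2 H2] := reversal_ad (reversalC Hb).
have [A1 B1] := fin_bounded fa; have [A2 B2] := fin_bounded fa'.
have [A3 B3] := fin_bounded fb; have [A4 B4] := fin_bounded fb'.
pose N := (N1 + N2 + A1 + A2 + A3 + A4)%N; exists N => z z' Xz Xz' fz fz'.
have {}B1 : bounded N a by apply: bounded_le B1; rewrite /N; lia.
have {}B2 : bounded N a' by apply: bounded_le B2; rewrite /N; lia.
have {}B3 : bounded N b by apply: bounded_le B3; rewrite /N; lia.
have {}B4 : bounded N b' by apply: bounded_le B4; rewrite /N; lia.
have [|y1 Xy1 E1] := H1 z Xz; first by apply: far_le fz; rewrite /N; lia.
have [|y2 Xy2 E2] := H2 z' Xz'; first by apply: far_le fz'; rewrite /N; lia.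
have rz := reversal_rep z; have rz' := reversal_rep z'.
have R1 := reversalM (reversalM Ha rz) (reversalM rz' Hb).
have R2 := reversalM (reversalM rz' (reversalM Hb Ha)) rz.
have Eab : a * g z * (g z' * b) = ent (g z * g z') p q *: eu F i j.
  rewrite -eu_sandwich; last exact: fin_mull.
  by rewrite !mulrA.
have Eba : b * a = (j == i)%:R *: eu F q p by rewrite /a /b eu_mul.
have -> : ent (g z * g z') p q *: eu F i j - (j == i)%:R *: (g z' * eu F q p * g z) =
    a * g z * (g z' * b) - g z' * (b * a) * g z.
  by rewrite Eab Eba -scalerAr -scalerAl.
exists (b' * - g z' * (- g z * a') - - g z * (a' * b' * - g z')).
  exact: (@subspB _ _ _ reversal_sub (_, _) (_, _) R1 R2).
exists (br y1 y2); first exact: Xbr.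
rewrite gbr E1 E2 !mulrDr !mulrDl !mulrA.
have -> : g z * a' * g z' * b = 0 by rewrite -!mulrA [a' * _]mulrA (far_sandwich B2 B3 fz') mulr0.
have -> : g z' * b * g z * a' = 0 by rewrite -!mulrA [b * _]mulrA (far_sandwich B3 B2 fz) mulr0.
rewrite (far_sandwich B1 B4 fz) (far_sandwich B4 B1 fz') !mul0r add0r !addr0 !add0r.
rewrite !(mulrN, mulNr, opprK) ?mulrA.
have rearrange (t1 t2 t3 t4 : R) : t1 + t2 - (t3 + t4) = t2 - t3 - (t4 - t1).
  by rewrite [t1 + _]addrC opprD opprB addrACA.
exact: rearrange.
Qed.

Lemma skew_image : ~ degenerate_reversal -> forall a, reversal a (- a) -> exists2 x, X x & g x = a.
Proof.
move=> Hns a Ha; have [fa _] := reversal_fin Ha.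
have uniq_rev := reversal_unique Hns.
have sS := skew_subspace; have [p [q Hpq]] := far_products.
have off i j : i != j -> skew (eu F i j).
  move=> ij; have [N HN] := skew_products i j p q; have [z [z' [Xz Xz' fz fz' n0]]] := Hpq N.
  have := HN z z' Xz Xz' fz fz'; rewrite eq_sym (negPf ij) scale0r subr0.
  by move=> /(subspZ sS (ent (g z * g z') p q)^-1); rewrite scalerA mulVf // scale1r.
(* The same z and z' are used for i and for 0: the extra term g(z') e_qp g(z) does not depend on i
   and cancels in the difference. *)
have diag i : skew (eu F i i - eu F 0 0).
  have [N HN] := skew_products i i p q; have [M HM] := skew_products 0 0 p q.
  have [z [z' [Xz Xz' fz fz' n0]]] := Hpq (maxn N M).
  have := HM z z' Xz Xz' (far_le (leq_maxr _ _) fz) (far_le (leq_maxr _ _) fz').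
  have := HN z z' Xz Xz' (far_le (leq_maxl _ _) fz) (far_le (leq_maxl _ _) fz').
  rewrite !eqxx !scale1r => S1 S2; have := subspB sS S1 S2.
  rewrite opprB addrA subrK -scalerBr.
  by move=> /(subspZ sS (ent (g z * g z') p q)^-1); rewrite scalerA mulVf // scale1r.
have [e' He] := reversal_total (fin_eu F 0 0); have [_ fe'] := reversal_fin He.
have ee' : e' * e' = e'.
  by have H := reversalM He He; rewrite eu_mul eqxx scale1r in H; exact: uniq_rev H He.
have [m tm _] := tr_idempotent fe' ee'.
(* This element is its own reversal, so its skew part is 0. As e' is an idempotent, its trace is a
   natural number m, and 1 + m is nonzero; subtracting traceless elements leaves e_00 itself. *)
have Ss : skew (eu F 0 0 + e').
  exists (e' + eu F 0 0).
    exact: (@subspD _ _ _ reversal_sub (_, _) (_, _) He (reversalC He)).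
  by exists 0; [exact: subsp0 | rewrite (linear_0 lg) [e' + _]addrC subrr].
have t0 : tr (eu F 0 0) = 1.
  by rewrite (trE_fsupp (proj2 (@bounded_eu F 1 0 0 isT isT))) big_ord1 ent_eu.
have S0 : skew (eu F 0 0).
  have fs : fin (eu F 0 0 + e') by exact: (subspD (fin_sub F)).
  have := subspB sS Ss (traceless_span sS off diag fs).
  rewrite opprB addrC subrK linearD /= t0 tm.
  have n0 : 1 + m%:R != 0 :> F by rewrite nat1r (natr_eq0_pchar0 charF).
  by move=> /(subspZ sS (1 + m%:R)^-1); rewrite scalerA mulVf // scale1r.
have [b Hb [x Xx Ex]] : skew a.
  by have := subspD sS (traceless_span sS off diag fa) (subspZ sS (tr a) S0); rewrite subrK.
have n2 : 2%:R != 0 :> F by rewrite (natr_eq0_pchar0 charF).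
exists (2%:R^-1 *: x); first exact: (subspZ sX).
rewrite (linear_Z lg) Ex (uniq_rev _ _ _ Hb Ha) opprK -mulr2n -scaler_nat scalerA mulVf //.
exact: scale1r.
Qed.
End InfiniteFactor.

(** * Normal form of an involution on finitary matrices *)

Section MatrixModel.
Variables (F : closedFieldType) (tau : emx F -> emx F) (P : (nat -> nat -> F) -> Prop).

(** [Phi] is an injective change of basis under which the elements with tau a = - a correspond
    exactly to the finitary matrices satisfying [P]. *)
Definition matrix_model : Prop := exists Phi : emx F -> nat -> nat -> F,
  (forall c a b i j, Phi (c *: a + b) i j = c * Phi a i j + Phi b i j) /\
  (forall a, fin a -> fsupp (Phi a)) /\
  (forall a b N i j, fin a -> fin b -> fsupp_lt N (Phi a) ->
     Phi (a * b) i j = mmul N (Phi a) (Phi b) i j) /\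
  (forall a, fin a -> (forall i j, Phi a i j = 0) -> a = 0) /\
  (forall a, fin a -> tau a = - a -> P (Phi a)) /\
  (forall A, fsupp A -> P A ->
     exists a, fin a /\ tau a = - a /\ forall i j, Phi a i j = A i j).
End MatrixModel.

Section Involution.
Variables (F : closedFieldType) (charF : [pchar F] =i pred0).
Local Notation R := (emx F).
Local Notation e := (eu F 0 0).
Implicit Types a b u v : R.
Variable tau : R -> R.
Hypotheses (tau_fin : forall a, fin a -> fin (tau a))
  (tau_lin : forall c a b, fin a -> fin b -> tau (c *: a + b) = c *: tau a + tau b)
  (tauM : forall a b, fin a -> fin b -> tau (a * b) = tau b * tau a)
  (tauK : forall a, fin a -> tau (tau a) = a).

Let fe : fin e. Proof. exact: fin_eu. Qed.
Let fin0 : fin (0 : R). Proof. exact: (subsp0 (fin_sub F)). Qed.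
Let tau0 : tau 0 = 0.
Proof. by have := tau_lin (-1) fin0 fin0; rewrite scaler0 addr0 scaleN1r addNr. Qed.
Let tauZ c a : fin a -> tau (c *: a) = c *: tau a.
Proof. by move=> fa; have := tau_lin c fa fin0; rewrite tau0 !addr0. Qed.
Let ee : e * e = e. Proof. by rewrite eu_mul eqxx scale1r. Qed.

(** Matrices supported in column 0 stand for column vectors, so that vectors and operators live in
    one ring and tau applies to both. *)
Let colv u := fin u /\ u * e = u.
Let colv_sub : subspace colv.
Proof.
split; first by split=> //; rewrite mul0r.
move=> c u v [fu Eu] [fv Ev]; split; first exact: (proj2 (fin_sub F)).
by rewrite mulrDl -scalerAl Eu Ev.
Qed.
Let colv_eu i : colv (eu F i 0).
Proof. by split=> //; rewrite eu_mul eqxx scale1r. Qed.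
Let colv_mull a u : colv u -> colv (a * u).
Proof. by move=> [fu Eu]; split; [exact: fin_mulr | rewrite -mulrA Eu]. Qed.

Let col_ext a b : fin a -> fin b -> (forall k, a * eu F k 0 = b * eu F k 0) -> a = b.
Proof.
move=> fa fb H; apply: ent_ext => // i k; have := congr1 (fun c => ent c i 0) (H k).
by rewrite !ent_eur // eqxx !mulr1.
Qed.

Let e' := tau e.
Let fe' : fin e'. Proof. exact: tau_fin. Qed.
Let e'e' : e' * e' = e'. Proof. by rewrite -tauM // ee. Qed.
(** tau carries the relation e r e = r_00 e over to e', so e' is again primitive. *)
Let corner r : fin r -> e' * r * e' = ent (tau r) 0 0 *: e'.
Proof.
move=> fr; rewrite -tauZ // -eu_sandwich; last exact: tau_fin.
rewrite tauM ?tauM ?tauK //; try exact: tau_fin; last by exact: fin_mull.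
by rewrite mulrA.
Qed.

(** As e' is primitive, it maps the column vectors onto a line; w spans it and is normalized to have
    entry 1 in a row p, which then reads off the coefficient. *)
Lemma involution_vector : exists p w, [/\ colv w, e' * w = w, ent w p 0 = 1 &
  forall x, colv x -> e' * x = x -> x = ent x p 0 *: w].
Proof.
have [i [p n0]] : exists i p, ent (e' * eu F i 0) p 0 != 0.
  apply: contrapT => H; have E : e' = 0.
    apply: ent_ext => // k l; rewrite ent0; apply: contrapT => /eqP n0; apply: H.
    by exists l, k; rewrite ent_eur // eqxx mulr1.
  have : ent e 0 0 = 0 by rewrite -[e]tauK // -/e' E tau0.
  by rewrite ent_eu => /eqP; rewrite oner_eq0.
pose w := (ent (e' * eu F i 0) p 0)^-1 *: (e' * eu F i 0).
have Vw : colv w by apply: (subspZ colv_sub); apply: colv_mull.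
have e'w : e' * w = w by rewrite /w -scalerAr mulrA e'e'.
have w1 : ent w p 0 = 1 by rewrite entZ mulVf.
exists p, w; split=> // x [fx xe] e'x; have [fw we] := Vw.
have Ew : eu F 0 p * w = e.
  apply: ent_ext => //; first exact: fin_mulr.
  move=> k l; rewrite ent_eul // -we ent_eur // w1 mul1r ent_eu.
  by case: (k == 0); case: (l == 0); rewrite /= ?mul1r ?mul0r.
have E : x = ent (tau (x * eu F 0 p)) 0 0 *: w.
  rewrite -[in RHS]e'w scalerAl -corner; last exact: fin_mull.
  by rewrite !mulrA e'x -[_ * e' * w]mulrA e'w -[x * _ * w]mulrA Ew xe.
by rewrite {1}E; congr (_ *: _); rewrite [in RHS]E entZ w1 mulr1.
Qed.
Variables (p : nat) (w : R).
Hypotheses (Vw : colv w) (e'w : e' * w = w) (w1 : ent w p 0 = 1)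
  (wP : forall x, colv x -> e' * x = x -> x = ent x p 0 *: w).

(** For columns u and v, tau(u) v lies in the line of w, and B(u, v) is its coefficient. This is the
    form for which tau is the adjoint. *)
Let B u v : F^o := ent (tau u * v) p 0.
Let BE u v : colv u -> colv v -> tau u * v = B u v *: w.
Proof.
move=> [fu ue] Vv; apply: wP; first exact: colv_mull.
by rewrite mulrA /e' -tauM // ue.
Qed.
Let Br u : linear (B u).
Proof. by move=> c v v'; rewrite /B mulrDr -scalerAr ent_lin. Qed.
Let Bl c u u' v : colv u -> colv u' -> B (c *: u + u') v = c * B u v + B u' v.
Proof. by move=> [fu _] [fu' _]; rewrite /B tau_lin // mulrDl -scalerAl ent_lin. Qed.
Let Badj a u v : fin a -> colv u -> B u (a * v) = B (tau a * u) v.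
Proof.
by move=> fa [fu _]; rewrite /B tauM ?tauK ?mulrA //; exact: tau_fin.
Qed.
Let Bnd u : colv u -> (forall v, colv v -> B u v = 0) -> u = 0.
Proof.
move=> Vu H; have [fu _] := Vu; rewrite -[u]tauK // (_ : tau u = 0) ?tau0 //.
apply: col_ext => //; first exact: tau_fin.
by move=> k; rewrite BE // H // scale0r mul0r.
Qed.

(** The sign of the form: tau w = ep w, and since tau is involutive, ep is 1 or -1. The first case
    leads to so, the second to sp. *)
Let ep := ent (tau w) p 0.
Let tauw : tau w = ep *: w.
Proof.
have [fw we] := Vw; apply: wP; last by rewrite /e' -tauM // we.
split; first exact: tau_fin.
by rewrite -[e]tauK // -tauM ?e'w.
Qed.
Let epP : ep = 1 \/ ep = -1.
Proof.
have [fw _] := Vw; have : ep ^+ 2 == 1.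
  have := congr1 (fun x => ent x p 0) (tauK fw).
  by rewrite /= tauw tauZ // tauw scalerA entZ w1 mulr1 => <-.
by rewrite sqrf_eq1 => /orP[/eqP|/eqP]; [left|right].
Qed.
Let Bsym u v : colv u -> colv v -> B v u = ep * B u v.
Proof.
move=> Vu Vv; have [fu _] := Vu; have [fv _] := Vv; have [fw _] := Vw.
have E : tau v * u = tau (tau u * v) by rewrite tauM ?tauK //; exact: tau_fin.
by rewrite {1}/B E BE // tauZ // tauw scalerA entZ w1 mulr1 mulrC.
Qed.

Section GramSchmidt.
Variables (ppi : nat -> nat) (eta : nat -> F).
Hypotheses (piK : involutive ppi) (eta2 : forall i, eta i * eta i = 1).

(** Orthonormal sequences are the case of the identity and constant 1, symplectic ones that of
    [partner] and [psign]. Closure under [ppi] of the index range keeps the form nondegenerate on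
    the span. *)
Definition normal_seq (s : seq R) : Prop :=
  (forall i, (i < size s)%N -> colv s`_i /\ (ppi i < size s)%N) /\
  forall i j, (i < size s)%N -> (j < size s)%N -> B s`_i s`_j = eta i * (j == ppi i)%:R.

Definition in_seq_span (s : seq R) v : Prop :=
  exists c : nat -> F, v = \sum_(i < size s) c i *: s`_i.

Definition orthogonal_to (s : seq R) r : Prop := forall i, (i < size s)%N -> B s`_i r = 0.

Lemma in_seq_span_cat s s' v : in_seq_span s v -> in_seq_span (s ++ s') v.
Proof.
move=> [c ->]; exists (fun i => if (i < size s)%N then c i else 0); rewrite size_cat big_split_ord /=.
rewrite [X in _ = _ + X]big1 ?addr0 => [|i _]; last by rewrite ltnNge leq_addr scale0r.
by apply: eq_bigr => i _; rewrite ltn_ord nth_cat ltn_ord.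
Qed.

Lemma in_seq_span_lin c s u v : in_seq_span s u -> in_seq_span s v -> in_seq_span s (c *: u + v).
Proof.
move=> [d ->] [d' ->]; exists (fun i => c * d i + d' i).
by rewrite scaler_sumr -big_split; apply: eq_bigr => i _; rewrite scalerDl scalerA.
Qed.

Lemma in_seq_span_nth s i : (i < size s)%N -> in_seq_span s s`_i.
Proof.
move=> is_; exists (fun j => (j == i)%:R); rewrite (bigD1 (Ordinal is_)) //= eqxx scale1r.
by rewrite big1 ?addr0 // => j; rewrite -val_eqE /= => /negPf ->; rewrite scale0r.
Qed.

Definition residual s v := v - \sum_(i < size s) (eta (ppi i) * B s`_(ppi i) v) *: s`_i.

Lemma residual_span s v : in_seq_span s (v - residual s v).
Proof. by exists (fun i => eta (ppi i) * B s`_(ppi i) v); rewrite /residual opprB addrCA subrr addr0. Qed.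

Lemma residual_colv s v : normal_seq s -> colv v -> colv (residual s v).
Proof.
move=> [Hs _] Vv; apply: (subspB colv_sub) => //; apply: (subsp_comb colv_sub) => i.
by case: (Hs i (ltn_ord i)).
Qed.

Lemma residual_orth s v : normal_seq s -> orthogonal_to s (residual s v).
Proof.
move=> [Hs Hd] j js; rewrite /residual (linear_B (Br _)) (linear_comb _ _ (Br _)).
have [_ pjs] := Hs j js.
rewrite (bigD1 (Ordinal pjs)) //= piK big1 => [|i]; last first.
  rewrite -val_eqE /= => /negPf ij; rewrite Hd // ij mulr0; exact: mulr0.
rewrite Hd // eqxx mulr1 addr0 -[_ *: _]/(_ * _) [X in _ - X]mulrAC eta2 mul1r.
exact: subrr.
Qed.

Hypothesis extend : forall s r, normal_seq s -> colv r -> orthogonal_to s r -> r != 0 ->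
  exists2 s', normal_seq (s ++ s') & in_seq_span (s ++ s') r.

Lemma normal_basis : exists t : nat -> R, [/\ forall i, colv (t i),
  forall i j, B (t i) (t j) = eta i * (j == ppi i)%:R &
  forall v, colv v -> exists K, v = \sum_(i < K) (eta (ppi i) * B (t (ppi i)) v) *: t i /\
    forall i, (K <= i)%N -> B (t (ppi i)) v = 0].
Proof.
have [|||[s [Hs _] Ht]|[t Ht]] := @build_sequence R normal_seq (fun k s => in_seq_span s (eu F k 0)).
- by split.
- move=> s k Hs; have Vr := residual_colv Hs (colv_eu k).
  have Es s' : in_seq_span (s ++ s') (residual s (eu F k 0)) -> in_seq_span (s ++ s') (eu F k 0).
    move=> H; rewrite -[eu F k 0](subrK (residual s (eu F k 0))) -[X in X + _]scale1r.
    by apply: in_seq_span_lin => //; apply: in_seq_span_cat; exact: residual_span.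
  have [r0|r0] := eqVneq (residual s (eu F k 0)) 0.
    exists [::]; rewrite ?cats0 //; have := Es [::]; rewrite cats0; apply.
    rewrite r0; exists (fun _ => 0); rewrite big1 // => i _; exact: scale0r.
  have [s' Hs' H] := extend Hs Vr (residual_orth _ Hs) r0.
  by exists s' => //; exact: Es.
- by move=> s s' k _; exact: in_seq_span_cat.
(* The finite alternative is impossible: all columns e_k0 would lie in the span of finitely many
   bounded vectors. *)
- have [N HN] : exists N, forall i, (i < size s)%N -> bounded N s`_i.
    elim: (s) (fun i is_ => proj1 (Hs i is_)) => [|u s' IH] H; first by exists 0%N.
    have [|N HN] := IH; first by move=> i is_; exact: (H i.+1).
    have [fu _] := H 0%N isT; have [M HM] := fin_bounded fu; exists (maxn M N) => -[|i] is_ /=.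
      by apply: bounded_le HM; exact: leq_maxl.
    by apply: bounded_le (HN i is_); exact: leq_maxr.
  have [c E] := Ht N; have := congr1 (fun a => ent a N 0) E; rewrite /= ent_eu !eqxx ent_sum.
  rewrite big1 => [/eqP|i _]; first by rewrite oner_eq0.
  by rewrite entZ (proj2 (HN i (ltn_ord i))) ?mulr0 //; left.
have nt M i : (i < M)%N -> (mkseq t M)`_i = t i by move=> iM; rewrite nth_mkseq.
have Vt i : colv (t i).
  have [M iM [[HM _] _]] := Ht i.+1 0%N.
  by have := HM i; rewrite size_mkseq nt // => /(_ iM) [].
have Bt i j : B (t i) (t j) = eta i * (j == ppi i)%:R.
  have [M] := Ht (maxn i j).+1 0%N; rewrite gtn_max => /andP[iM jM] [[_ HM] _].
  by have := HM i j; rewrite size_mkseq !nt // => ->.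
exists t; split=> // v Vv.
have [M [c Ev]] : exists M, exists c : nat -> F, v = \sum_(i < M) c i *: t i.
  have [fv ve] := Vv; have [N HN] := fin_bounded fv.
  have -> : v = \sum_(i < N) ent v i 0 *: eu F i 0.
    apply: ent_ext => //; first by apply: (subsp_comb (fin_sub F)).
    move=> k l; rewrite -{1}ve ent_eur // ent_sum.
    case: (ltnP k N) => kN; last first.
      rewrite (proj2 HN) ?mul0r; last by left.
      by rewrite big1 // => i _; rewrite entZ ent_eu gtn_eqF ?mulr0 // (leq_trans _ kN).
    rewrite (bigD1 (Ordinal kN)) //= big1 => [|i].
      by rewrite entZ ent_eu eqxx addr0.
    by rewrite -val_eqE /= entZ ent_eu eq_sym => /negPf ->; rewrite mulr0.
  have [x Hx] := choice (fun i => let: ex_intro2 M _ (conj _ (ex_intro c E)) := Ht 0%N i in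
    ex_intro (fun z : nat * (nat -> F) => eu F i 0 = \sum_(j < size (mkseq t z.1)) z.2 j *: (mkseq t z.1)`_j) (M, c) E).
  have {}Hx i : lspan (fun x => exists k, x = t k) (eu F i 0).
    rewrite (Hx i) size_mkseq; apply: (subsp_comb (span_subspace _)) => j.
    by apply: span_incl; exists j; rewrite nt.
  by apply: nat_span; apply: (subsp_comb (span_subspace _)).
have Bv i : B (t (ppi i)) v = if (i < M)%N then eta (ppi i) * c i else 0.
  rewrite Ev (linear_comb _ _ (Br _)); case: (ltnP i M) => iM.
    rewrite (bigD1 (Ordinal iM)) //= big1 => [|j].
      by rewrite Bt piK eqxx mulr1 addr0; exact: mulrC.
    rewrite -val_eqE /= => /negPf ji; rewrite Bt piK ji mulr0; exact: mulr0.
  rewrite big1 // => j _; rewrite Bt piK ltn_eqF ?(leq_trans (ltn_ord j)) // mulr0; exact: mulr0.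
exists M; split=> [|i Mi]; last by rewrite Bv ltnNge Mi.
by rewrite {1}Ev; apply: eq_bigr => i _; rewrite Bv ltn_ord mulrA eta2 mul1r.
Qed.

Definition skew_cond (A : nat -> nat -> F) : Prop :=
  forall i j, eta i * A (ppi i) j = - ep * (eta j * A (ppi j) i).

Lemma normal_form : matrix_model tau skew_cond.
Proof.
have [t [Vt Bt Ht]] := normal_basis.
pose Phi a k l : F := eta (ppi k) * B (t (ppi k)) (a * t l).
have linPhi c a b i j : Phi (c *: a + b) i j = c * Phi a i j + Phi b i j.
  rewrite /Phi mulrDl -scalerAl Br mulrDr; congr (_ + _); exact: mulrCA.
have act a l : exists K, a * t l = \sum_(k < K) Phi a k l *: t k /\
    forall k, (K <= k)%N -> Phi a k l = 0.
  have [K [E H]] := Ht _ (colv_mull a (Vt l)); exists K; split=> // k Kk.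
  by rewrite /Phi H // mulr0.
have PhiB a i j : eta i * Phi a (ppi i) j = B (t i) (a * t j).
  by rewrite /Phi piK mulrA eta2 mul1r.
have sandw i j u : colv u -> eu F i j * u = ent u j 0 *: eu F i 0.
  by move=> [fu ue]; rewrite -eu_sandwich // -mulrA ue.
have coordE j v : colv v -> ent v j 0 = B (tau (w * eu F 0 j)) v.
  move=> Vv; have [_ we] := Vw.
  rewrite /B (tauK (fin_mulr w (fin_eu F 0 j))) -mulrA (sandw 0 j v Vv) -scalerAr we entZ w1.
  by rewrite mulr1.
have rowfin i : exists K, forall k, (K <= k)%N -> B (t (ppi k)) (eu F i 0) = 0.
  by have [K [_ H]] := Ht _ (colv_eu i); exists K.
have colfin j : exists K, forall l, (K <= l)%N -> ent (t l) j 0 = 0.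
  have Vu : colv (tau (w * eu F 0 j)).
    split; first by apply: tau_fin; exact: fin_mulr.
    rewrite -[e in X in X = _]tauK // -tauM //; last by exact: fin_mulr.
    by rewrite mulrA e'w.
  have [K [_ H]] := Ht _ Vu; exists (\max_(k < K) (ppi k).+1) => l Kl.
  rewrite coordE // Bsym // -[l in B (t l)]piK H ?mulr0 // leqNgt; apply/negP => lK.
  have := leq_trans (leq_bigmax (Ordinal lK)) Kl.
  by rewrite /= piK ltnn.
have [KK HKK] := choice rowfin; have [LL HLL] := choice colfin.
have fsuppPhi a : fin a -> fsupp (Phi a).
  move=> fa; have [N HN] := fin_bounded fa.
  exists (maxn (\max_(i < N) KK i) (\max_(i < N) LL i)) => k l; rewrite !geq_max => H.
  rewrite /Phi {1}(eu_decomp HN) mulr_suml.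
  rewrite (big_morph _ (linear_D (Br _)) (linear_0 (Br _))) big1 ?mulr0 // => i _.
  rewrite mulr_suml (big_morph _ (linear_D (Br _)) (linear_0 (Br _))) big1 // => j _.
  rewrite -scalerAl sandw // !(linear_Z (Br _)).
  case: H => /andP[Hk Hl].
    by rewrite HKK ?scaler0 //; apply: leq_trans Hk; exact: leq_bigmax.
  by rewrite HLL ?scale0r ?scaler0 //; apply: leq_trans Hl; exact: leq_bigmax.
have mulPhi a b N i j : fin a -> fin b -> fsupp_lt N (Phi a) ->
    Phi (a * b) i j = mmul N (Phi a) (Phi b) i j.
  move=> fa fb HN; have [K [E H]] := act b j.
  rewrite {1}/Phi -mulrA E mulr_sumr.
  rewrite (big_morph _ (linear_D (Br _)) (linear_0 (Br _))) mulr_sumr /mmul.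
  rewrite (@sum_widen F N K (fun k => Phi a i k * Phi b k j)).
  - apply: eq_bigr => k _; rewrite -scalerAr (linear_Z (Br _)) -[_ *: _]/(_ * _).
    by rewrite mulrCA mulrC.
  - by move=> k Nk; rewrite HN ?mul0r //; right.
  - by move=> k Kk; rewrite H // mulr0.
have injPhi a : fin a -> (forall i j, Phi a i j = 0) -> a = 0.
  move=> fa H; apply: col_ext => // k; have [K [E _]] := Ht _ (colv_eu k).
  rewrite E mulr_sumr mul0r big1 // => i _; have [K' [E' _]] := act a i.
  by rewrite -scalerAr E' big1 ?scaler0 // => j _; rewrite H scale0r.
exists Phi; split=> //; split=> //; split=> //; split=> //; split.
  move=> a fa Ha i j; rewrite !PhiB Badj // Ha mulNr -scaleN1r.
  have := @Bl (-1) (a * t i) 0 (t j) (colv_mull a (Vt i)) (subsp0 colv_sub).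
  rewrite addr0 => ->; rewrite {2}/B tau0 mul0r ent0 addr0 mulN1r mulNr; congr (- _).
  by rewrite Bsym //; exact: colv_mull.
move=> A [N HN] PA.
(* These operators are the matrix units for the basis t: they send t_l to t_k and all other basis
   vectors to 0. *)
pose T k l := eta (ppi l) *: (t k * eu F 0 p * tau (t (ppi l))).
have wE u : colv u -> u * eu F 0 p * w = u.
  by move=> [fu ue]; rewrite -mulrA sandw // w1 scale1r.
have TE k l m : T k l * t m = (m == l)%:R *: t k.
  rewrite /T -scalerAl -[_ * tau _ * _]mulrA BE // Bt piK -scalerAr wE // scalerA.
  by rewrite mulrA eta2 mul1r.
pose a := \sum_(k < N) \sum_(l < N) A k l *: T k l.
have fa : fin a.
  apply: (subsp_sum (fin_sub F)) => k _; apply: (subsp_comb (fin_sub F)) => l.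
  by apply: (subspZ (fin_sub F)); apply: fin_mull; exact: fin_mulr.
have Ea m : a * t m = \sum_(k < N) A k m *: t k.
  rewrite mulr_suml; apply: eq_bigr => k _; rewrite mulr_suml.
  have [mN|Nm] := ltnP m N; last first.
    rewrite HN ?scale0r; last by right.
    by rewrite big1 // => l _; rewrite -scalerAl TE gtn_eqF ?scale0r ?scaler0 // (leq_trans _ Nm).
  rewrite (bigD1 (Ordinal mN)) //= big1 => [|l].
    by rewrite -scalerAl TE eqxx scale1r addr0.
  by rewrite -val_eqE -scalerAl TE eq_sym /= => /negPf ->; rewrite scale0r scaler0.
have PhiA i m : Phi a i m = A i m.
  rewrite /Phi Ea (linear_comb _ _ (Br _)) mulr_sumr.
  have [iN|Ni] := ltnP i N; last first.
    rewrite HN; last by left.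
    by rewrite big1 // => k _; rewrite Bt piK ltn_eqF ?(leq_trans _ Ni) // mulr0 scaler0 mulr0.
  rewrite (bigD1 (Ordinal iN)) //= big1 => [|k].
    by rewrite Bt piK eqxx mulr1 addr0 -[_ *: _]/(_ * _) mulrCA eta2 mulr1.
  by rewrite -val_eqE /= Bt piK => /negPf ->; rewrite mulr0 scaler0 mulr0.
exists a; split=> //; split=> //; apply/eqP; rewrite -addr_eq0; apply/eqP.
apply: injPhi => [|i j]; first by apply: (subspD (fin_sub F)) => //; exact: tau_fin.
have E0 : eta (ppi i) * Phi (tau a + a) i j = 0.
  rewrite -[i in Phi _ i]piK PhiB mulrDl (linear_D (Br _)) (Badj _ (tau_fin fa)) //.
  rewrite tauK // Bsym //; last exact: colv_mull.
  by rewrite -!PhiB !PhiA (PA (ppi i) j) mulNr subrr.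
by rewrite -[LHS]mul1r -(eta2 (ppi i)) -mulrA E0 mulr0.
Qed.
End GramSchmidt.

Lemma sqrt_exists (c : F) : exists d, d * d = c.
Proof.
have [d] := @solve_monicpoly F 2 (fun i => if i == 0 then c else 0) isT.
by rewrite !big_ord_recl big_ord0 /= mul0r !addr0 expr0 mulr1 expr2; exists d.
Qed.

Let n2 : 2%:R != 0 :> F. Proof. by rewrite (natr_eq0_pchar0 charF). Qed.

Let nz_witness s ppi eta r : involutive ppi -> (forall i, eta i * eta i = 1) ->
  normal_seq ppi eta s -> colv r -> orthogonal_to s r -> r != 0 ->
  exists u, [/\ colv u, orthogonal_to s u & B r u != 0].
Proof.
move=> piK eta2 Hs Vr Hr r0.
have [u Vu n0] : exists2 u, colv u & B r u != 0.
  apply: contrapT => H; case/negP: r0; apply/eqP; apply: Bnd => // v Vv.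
  by apply: contrapT => /eqP n0; apply: H; exists v.
exists (residual ppi eta s u); split.
- exact: residual_colv.
- exact: residual_orth.
rewrite /residual (linear_B (Br _)) (linear_comb _ _ (Br _)) big1 ?subr0 // => i _.
have [Hs1 _] := Hs; have [Vi _] := Hs1 i (ltn_ord i).
by rewrite (Bsym Vi Vr) (Hr _ (ltn_ord i)) mulr0 scaler0.
Qed.

Section Orthogonal.
Hypothesis ep1 : ep = 1.

Let BC u v : colv u -> colv v -> B v u = B u v.
Proof. by move=> Vu Vv; rewrite Bsym // ep1 mul1r. Qed.

Let normal := normal_seq id (fun _ => 1 : F).

Let append s u : normal s -> colv u -> orthogonal_to s u -> B u u != 0 ->
  exists2 v, normal (s ++ [:: v]) & exists c, u = c *: v /\ forall x, B v x = c^-1 * B u x.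
Proof.
move=> [H1 H2] Vu Hu n0; have [c Ec] := sqrt_exists (B u u).
have c0 : c != 0 by apply: contraNneq n0 => c0; rewrite -Ec c0 mul0r.
have Vv : colv (c^-1 *: u) by exact: (subspZ colv_sub).
have BZ x : B (c^-1 *: u) x = c^-1 * B u x.
  have := Bl c^-1 x Vu (subsp0 colv_sub).
  by rewrite addr0 [B 0 x]/B tau0 mul0r ent0 addr0.
have BZr x : B x (c^-1 *: u) = c^-1 * B x u by exact: (linear_Z (Br x)).
exists (c^-1 *: u); last by exists c; rewrite scalerA mulfV // scale1r.
have lk i : (i < (size s).+1)%N -> i != size s -> (i < size s)%N.
  by rewrite ltnS ltn_neqAle => -> ->.
rewrite cats1; split=> [i is_|i j]; rewrite ?size_rcons.
  rewrite size_rcons in is_; split=> //; rewrite nth_rcons.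
  have [->|/(lk i is_) is'] := altP (i =P size s); first by rewrite ltnn.
  by rewrite is'; case: (H1 i is').
move=> ik jk; rewrite !nth_rcons.
have [->|/(lk i ik) is_] := altP (i =P size s); have [->|/(lk j jk) js] := altP (j =P size s).
- by rewrite ltnn ?eqxx BZ BZr -Ec mulKf // mulVf // ?eqxx mul1r.
- by rewrite ltnn js BZ BC ?(Hu _ js) ?mulr0 ?(ltn_eqF js) ?mulr0 //; case: (H1 j js).
- by rewrite ltnn is_ BZr (Hu _ is_) ?eqxx /= [size s == i]eq_sym (ltn_eqF is_) !mulr0.
by rewrite is_ js (H2 _ _ is_ js).
Qed.

Let extend s r : normal s -> colv r -> orthogonal_to s r -> r != 0 ->
  exists2 s', normal (s ++ s') & in_seq_span (s ++ s') r.
Proof.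
move=> Hs Vr Hr r0; have last_span s0 v : in_seq_span (s0 ++ [:: v]) v.
  have := @in_seq_span_nth (s0 ++ [:: v]) (size s0); rewrite size_cat addn1 leqnn => /(_ isT).
  by rewrite nth_cat ltnn subnn.
have spanZ s0 c v : in_seq_span s0 v -> in_seq_span s0 (c *: v).
  by move=> H; have := in_seq_span_lin (c - 1) H H; rewrite -[X in _ + X]scale1r -scalerDl subrK.
have [brr|] := eqVneq (B r r) 0; last first.
  move=> n0; have [v Hv [c [-> _]]] := append Hs Vr Hr n0.
  by exists [:: v] => //; exact: spanZ.
have idK : involutive (@id nat) by [].
have [u [Vu Hu n0]] := nz_witness idK (fun _ => mulr1 1) Hs Vr Hr r0.
(* Here r is isotropic. Either u is anisotropic, or B(u + r, u + r) = 2 B(u, r) is nonzero. The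
   resulting t also pairs nontrivially with r. *)
have [t [Vt Ht tt tr0]] : exists t, [/\ colv t, orthogonal_to s t, B t t != 0 & B t r != 0].
  have [buu|nuu] := eqVneq (B u u) 0; last by exists u; split=> //; rewrite BC.
  exists (1 *: u + r); split.
  - exact: (proj2 colv_sub).
  - by move=> i is_; rewrite Br Hu // Hr // scaler0 addr0.
  - rewrite Bl // !Br buu brr scaler0 !add0r addr0 mul1r [B u r]BC //.
    by rewrite -[1 *: _]/(1 * _) mul1r -mulr2n -mulr_natl mulf_neq0.
  - by rewrite Bl // brr addr0 mul1r BC.
have [v Hv [c [Et Bv]]] := append Hs Vt Ht tt.
have c0 : c != 0 by apply: contraNneq tt => c0; rewrite Et c0 scale0r (linear_0 (Br _)).
have [Hv1 Hv2] := Hv.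
have [Vv _] : colv (s ++ [:: v])`_(size s) /\ True.
  by split=> //; case: (Hv1 (size s)); rewrite ?size_cat ?addn1.
rewrite nth_cat ltnn subnn /= in Vv.
have bvv : B v v = 1.
  have := Hv2 (size s) (size s); rewrite size_cat addn1 leqnn => /(_ isT isT).
  by rewrite nth_cat ltnn subnn /= eqxx mulr1.
have vr0 : B v r != 0 by rewrite Bv mulf_neq0 // invr_eq0.
(* Since B(r, r) = 0 and B(v, v) = 1, one gets B(r1, r1) = - B(v, r)^2, which is nonzero. So r1 can
   be appended after v, and r lies in the span of the two. *)
pose r1 := - B v r *: v + r.
have Vr1 : colv r1 by exact: (proj2 colv_sub).
have Hr1 : orthogonal_to (s ++ [:: v]) r1.
  move=> i; rewrite size_cat addn1 ltnS leq_eqVlt nth_cat => /orP[/eqP->|is_].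
    by rewrite ltnn subnn /= Br bvv -[_ *: _]/(_ * _) mulr1 addNr.
  rewrite is_ Br Hr // addr0.
  have := Hv2 i (size s); rewrite size_cat addn1 ltnS ltnW // leqnn => /(_ isT isT).
  rewrite !nth_cat is_ ltnn subnn /= => ->.
  by rewrite [size s == i]eq_sym (ltn_eqF is_) mulr0 scaler0.
have n1 : B r1 r1 != 0.
  rewrite Bl // !Br bvv brr addr0 [B r v]BC // -![_ *: _]/(_ * _) mulr1 addNr mulr0 add0r.
  by rewrite mulf_neq0 // oppr_eq0.
have [v1 Hv1' [c1 [Er1 _]]] := append Hv Vr1 Hr1 n1.
exists ([:: v] ++ [:: v1]); rewrite catA //.
have -> : r = B v r *: v + r1 by rewrite /r1 scaleNr addrA subrr add0r.
apply: in_seq_span_lin; first exact/in_seq_span_cat/last_span.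
by rewrite Er1; apply: spanZ; exact: last_span.
Qed.

Lemma orthogonal_model : matrix_model tau (fun A => forall i j, A j i = - A i j).
Proof.
have [|||Phi [H1 [H2 [H3 [H4 [H5 H6]]]]]] := @normal_form id (fun _ => 1).
- by [].
- by move=> i; rewrite mulr1.
- exact: extend.
exists Phi; do 4 (split=> //); split=> [a fa Ha i j|A fA HA].
  by have := H5 a fa Ha j i; rewrite ep1 !mul1r mulN1r.
by apply: H6 => // i j; rewrite ep1 !mul1r mulN1r.
Qed.
End Orthogonal.

Section Symplectic.
Hypothesis epN1 : ep = -1.

Let BC u v : colv u -> colv v -> B v u = - B u v.
Proof. by move=> Vu Vv; rewrite Bsym // epN1 mulN1r. Qed.

Let Bxx u : colv u -> B u u = 0.
Proof.
move=> Vu; have /eqP := BC Vu Vu; rewrite -addr_eq0 -mulr2n -mulr_natl mulf_eq0 (negPf n2).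
by move=> /eqP.
Qed.

Let partnerK : involutive partner.
Proof.
by move=> [|k] //; rewrite /partner /=; case ok: (odd k); rewrite /= ?ok //=; case: k ok => //= k ->.
Qed.
Let psign2 i : psign F i * psign F i = 1.
Proof. by rewrite /psign; case: ifP; rewrite ?mulr1 // mulrNN mulr1. Qed.
Let normal := normal_seq partner (psign F).

Let extend s r : normal s -> colv r -> orthogonal_to s r -> r != 0 ->
  exists2 s', normal (s ++ s') & in_seq_span (s ++ s') r.
Proof.
move=> Hs Vr Hr r0.
have [u0 [Vu0 Hu0 n0]] := nz_witness partnerK psign2 Hs Vr Hr r0.
pose u := (B r u0)^-1 *: u0.
have Vu : colv u by exact: (subspZ colv_sub).
have Hu : orthogonal_to s u by move=> i is_; rewrite (linear_Z (Br _)) Hu0 // scaler0.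
have bru : B r u = 1 by rewrite (linear_Z (Br _)) -[LHS]/(_ * _) mulVf.
have [H1 H2] := Hs.
(* [partner] exchanges 2m and 2m + 1, so a sequence closed under it has even length; the new pair r,
   u occupies the next two places. *)
have ev : odd (size s) = false.
  apply/negP => od; have sp : (0 < size s)%N by case: (size s) od.
  have [|_] := H1 (size s).-1; first by rewrite prednK.
  by rewrite /partner -[in odd _](prednK sp) /= in od *; rewrite (negPf od) prednK // ltnn.
have pn : partner (size s) = (size s).+1 by rewrite /partner ev.
have pn1 : partner (size s).+1 = size s by rewrite /partner /= ev.
have sz : size (s ++ [:: r; u]) = (size s).+2 by rewrite size_cat addn2.
have cases i : (i < (size s).+2)%N -> [\/ (i < size s)%N, i = size s | i = (size s).+1].
  by rewrite !ltnS leq_eqVlt ltnS leq_eqVlt => /orP[/eqP->|/orP[/eqP->|is_]];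
    [constructor 3|constructor 2|constructor 1].
have n_r : nth 0 (s ++ [:: r; u]) (size s) = r by rewrite nth_cat ltnn subnn.
have n_u : nth 0 (s ++ [:: r; u]) (size s).+1 = u.
  by rewrite nth_cat ltnNge leqnSn /= subSnn.
have n_s i : (i < size s)%N -> nth 0 (s ++ [:: r; u]) i = s`_i by move=> is_; rewrite nth_cat is_.
exists [:: r; u]; last first.
  by have := @in_seq_span_nth (s ++ [:: r; u]) (size s); rewrite sz n_r; apply; lia.
split=> [i|i j]; rewrite sz.
  case/cases=> [is_|->|->]; rewrite ?n_r ?n_u ?n_s ?pn ?pn1 //.
  by have [Vi pis] := H1 i is_; split=> //; lia.
have pne k : (k < size s)%N -> (partner k < size s)%N by move=> /H1 [].
have psn : psign F (size s) = 1 by rewrite /psign ev.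
have psn1 : psign F (size s).+1 = -1 by rewrite /psign /= ev.
have neq k l : (k < l)%N -> (k == l) = false by move=> lt; rewrite ltn_eqF.
case/cases=> [is_|->|->]; case/cases=> [js|->|->];
  rewrite ?n_r ?n_u ?(n_s _ is_) ?(n_s _ js) ?pn ?pn1 ?psn ?psn1 ?eqxx.
- exact: H2.
- by rewrite Hr // eq_sym neq ?mulr0 //; exact: pne.
- by rewrite Hu // eq_sym neq ?mulr0 //; have := pne i is_; lia.
- by rewrite BC ?Hr ?oppr0 ?neq ?mulr0 //; [lia | case: (H1 j js)].
- by rewrite Bxx // neq ?mulr0.
- by rewrite bru mulr1.
- by rewrite BC ?Hu ?oppr0 ?neq ?mulr0 //; case: (H1 j js).
- by rewrite BC // bru mulr1.
- by rewrite Bxx // eq_sym neq ?mulr0.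
Qed.

Lemma symplectic_model :
  matrix_model tau (fun A => forall i j, psign F i * A (partner i) j = psign F j * A (partner j) i).
Proof.
have [|||Phi [H1 [H2 [H3 [H4 [H5 H6]]]]]] := @normal_form partner (psign F).
- exact: partnerK.
- exact: psign2.
- exact: extend.
exists Phi; do 4 (split=> //); split=> [a fa Ha i j|A fA HA].
  by have := H5 a fa Ha i j; rewrite epN1 opprK mul1r.
by apply: H6 => // i j; rewrite epN1 opprK mul1r.
Qed.
End Symplectic.

Lemma involution_model_of_vector :
  matrix_model tau (fun A => forall i j, A j i = - A i j) \/
  matrix_model tau (fun A => forall i j, psign F i * A (partner i) j = psign F j * A (partner j) i).
Proof. by case: epP => H; [left; exact: orthogonal_model | right; exact: symplectic_model]. Qed.
End Involution.

Theorem involution_model (F : closedFieldType) (charF : [pchar F] =i pred0)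
    (tau : emx F -> emx F) :
  (forall a, fin a -> fin (tau a)) ->
  (forall c a b, fin a -> fin b -> tau (c *: a + b) = c *: tau a + tau b) ->
  (forall a b, fin a -> fin b -> tau (a * b) = tau b * tau a) ->
  (forall a, fin a -> tau (tau a) = a) ->
  matrix_model tau (fun A => forall i j, A j i = - A i j) \/
  matrix_model tau (fun A => forall i j, psign F i * A (partner i) j = psign F j * A (partner j) i).
Proof.
move=> H1 H2 H3 H4; have [p [w [Hw ew w1 wP]]] := involution_vector H1 H2 H3 H4.
exact: (involution_model_of_vector charF H1 H2 H3 H4 Hw ew w1 wP).
Qed.

(** * Minimal ideals *)

Section MinimalIdeals.
Variables (F : closedFieldType) (charF : [pchar F] =i pred0).
Variables (L : lmodType F) (br : L -> L -> L).
Hypothesis HL : lie_axioms br.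
Local Notation R := (emx F).
Variables (f : L -> R) (h : nat -> L -> Prop).
Hypotheses (Hf : lie_rep br f) (finj : injective f).
Hypothesis Hh : forall n, fin_dim (h n) /\ subalg br (h n) /\ reductive br (h n).
Hypothesis hS : forall n x, h n x -> h n.+1 x.
Hypothesis hall : forall x, exists n, h n x.

Lemma ideal_cap J J' : lideal br J -> lideal br J' -> lideal br (fun x => J x /\ J' x).
Proof.
move=> [sJ [_ HJ]] [sJ' [_ HJ']]; split; first split.
- by split; exact: subsp0.
- by move=> a x y [H1 H2] [H3 H4]; split; [exact: (proj2 sJ) | exact: (proj2 sJ')].
by split=> // x y _ [H1 H2]; split; [exact: HJ | exact: HJ'].
Qed.

Lemma zero_subspace : subspace (fun x : L => x = 0).
Proof. by split=> // a x y -> ->; rewrite scaler0 addr0. Qed.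

Lemma abelian_ideal_zero J : lideal br J -> (forall y, J y -> derived br y) ->
  (forall a b, J a -> J b -> br a b = 0) -> forall x, J x -> x = 0.
Proof.
move=> HJ JS ab x /(ideal_perfect charF HL Hf finj Hh hS hall HJ JS).
by move: x; apply: derived_set_min => //; exact: zero_subspace.
Qed.

Lemma ideal_brl J x y : lideal br J -> J x -> J (br x y).
Proof.
move=> [sJ [_ HJ]] Jx; rewrite (br_anti HL); apply: (subspN sJ); exact: HJ.
Qed.

(** For every ideal X inside [L, L] not killed by g, the image g(X) contains all traceless matrices,
    or all skew elements of the reversal, and g maps [L, L] into the same set. So all such ideals
    have the image of [L, L]. *)
Lemma image_constant g X : lie_rep br g -> (forall i j, walg_plus g (eu F i j)) ->
  lideal br X -> (forall y, X y -> derived br y) -> (exists2 x, X x & g x != 0) ->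
  forall d, derived br d -> exists2 x, X x & g x = g d.
Proof.
move=> Hg geu HX XS X0 d Dd; have [lg gbr fg] := Hg.
case: (pselect (degenerate_reversal g)) => Hs; last first.
  apply: (skew_image charF HL Hf finj Hh hS hall Hg geu HX XS X0 Hs); exact: reversal_rep.
apply: (degenerate_image charF HL Hf finj Hh hS hall Hg geu HX XS X0 Hs) => //.
move: d Dd; apply: derived_set_min => [|a b _ _].
  by apply: (@preim_subspace F F^o L (fun t => t = 0) (fun x => tr (g x))) => [a x y|];
    [rewrite lg linearP | split=> // a x y -> ->; rewrite scaler0 addr0].
by rewrite gbr linearB /= trC subrr.
Qed.

Definition minimal_ideal (Y : L -> Prop) : Prop :=
  [/\ lideal br Y, forall y, Y y -> derived br y, exists2 y, Y y & y != 0 &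
      forall J, lideal br J -> (forall y, J y -> Y y) -> (exists2 y, J y & y != 0) ->
      forall y, Y y -> J y].

(** In the infinite case a nonzero ideal J inside Y has the same image as [L, L], and injectivity on
    Y gives J = Y, so Y is minimal itself. In the finite case Y is finite-dimensional and a nonzero
    ideal with fewest generators is minimal. *)
Lemma minimal_of_detected Y e n : lideal br Y -> (forall y, Y y -> derived br y) ->
  (exists2 y, Y y & y != 0) -> primitive f e n -> (forall y, Y y -> killed f e y -> y = 0) ->
  exists2 Z, minimal_ideal Z & forall z, Z z -> Y z.
Proof.
move=> HY YS Y0 pe inj; have sY := ideal_subspace HY.
case: (primitive_dichotomy charF Hf pe) => [[D [th [lth Hth]]]|[g [Hg Hk geu]]]; last first.
  exists Y => //; split=> // J HJ JY [x Jx x0] y Yy.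
  have [lg _ _] := Hg.
  have [|z Jz E] := image_constant Hg geu HJ (fun z Jz => YS _ (JY _ Jz)) _ (YS y Yy).
    exists x => //; apply/negP => /eqP/Hk kx; case/negP: x0; apply/eqP.
    by apply: inj kx; exact: JY.
  suff -> : y = z by [].
  apply/eqP; rewrite -subr_eq0; apply/eqP/inj; first by apply: (subspB sY) => //; exact: JY.
  by apply/Hk; rewrite (linear_B lg) E subrr.
have fY : fin_dim Y.
  by apply: (fin_dim_of_injective sY lth) => y Yy Hy; apply: inj => //; apply/Hth.
pose P m := `[< exists Z, [/\ lideal br Z, forall z, Z z -> Y z, exists2 z, Z z & z != 0 &
   spanned m Z] >].
have exP : exists m, P m by have [m HS] := fY; exists m; apply/asboolP; exists Y.
case: (ex_minnP exP) => m /asboolP[Z [HZ ZY Z0 spZ]] mmin; exists Z => //; split=> //.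
  by move=> z /ZY; exact: YS.
move=> J HJ JZ J0 y Zy; apply: contrapT => nJ.
have [m' _ [spJ lt]] := spanned_sub spZ (ideal_subspace HJ) JZ.
have : (m <= m')%N.
  by apply: mmin; apply/asboolP; exists J; split=> // z Jz; exact/ZY/JZ.
by rewrite leqNgt lt //; exists y.
Qed.

Lemma minimal_exists J : lideal br J -> (forall y, J y -> derived br y) ->
  (exists2 y, J y & y != 0) -> exists2 Z, minimal_ideal Z & forall z, Z z -> J z.
Proof.
move=> HJ JS [x Jx x0].
have [k [e [[He _ _] Hdet]]] := detecting_family charF HL Hf finj Hh hS hall (JS x Jx).
(* Choose a nonzero ideal Y detected by as few members of the family as possible. For an e_i that
   detects Y, the part of Y killed by e_i would have smaller support, so it is 0 and e_i is faithful
   on Y. *)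
pose supp (Y : L -> Prop) := [set i : 'I_k | `[< exists2 y, Y y & ~ killed f (e i) y >]].
pose good Y := [/\ lideal br Y, forall y, Y y -> gen_ideal br x y & exists2 y, Y y & y != 0].
pose P m := `[< exists2 Y, good Y & #|supp Y| = m >].
have exP : exists m, P m.
  exists #|supp (gen_ideal br x)|; apply/asboolP; exists (gen_ideal br x) => //.
  by split=> //; [exact: gen_ideal_ideal | exists x].
case: (ex_minnP exP) => m /asboolP[Y [HY Yx Y0] Em] mmin.
have YJ y : Y y -> J y by move=> /Yx; apply.
have suppS Y' Y'' : (forall y, Y' y -> Y'' y) -> supp Y' \subset supp Y''.
  move=> S; apply/subsetP => i; rewrite !inE => /asboolP[y Yy ky]; apply/asboolP.
  by exists y => //; exact: S.
have good_supp Y' : lideal br Y' -> (forall y, Y' y -> Y y) -> (exists2 y, Y' y & y != 0) ->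
    supp Y' = supp Y.
  move=> HY' S Y'0; apply/eqP; rewrite eqEcard suppS //= Em; apply: mmin; apply/asboolP.
  by exists Y' => //; split=> // y /S/Yx.
have [i ki] : exists i, i \in supp Y.
  apply: contrapT => H; have [y Yy /eqP y0] := Y0; apply: y0.
  apply: (Hdet Y HY Yx) => // i ik z Yz; apply: contrapT => nk; apply: H.
  by exists (Ordinal ik); rewrite inE; apply/asboolP; exists z.
have [n pe] := He i (ltn_ord i).
have [|Z mZ ZY] := @minimal_of_detected Y (e i) n HY (fun y Yy => JS y (YJ y Yy)) Y0 pe.
  move=> y Yy ky; apply: contrapT => /eqP y0.
  have := good_supp _ (ideal_cap HY (killed_ideal Hf (e i))) (fun z => @proj1 _ _).
  move=> /(_ (ex_intro2 _ _ y (conj Yy ky) y0)) E.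
  by move: ki; rewrite -E inE => /asboolP[z [_ kz]].
by exists Z => // z /ZY/YJ.
Qed.

(** The elements of [L, L] commuting with all minimal ideals form an ideal J. A minimal ideal inside
    J would commute with itself, hence be 0, so J = 0; and every [a, x] lies in J. *)
Lemma commutes_minimal_central x :
  (forall Y, minimal_ideal Y -> forall y, Y y -> br x y = 0) -> center br x.
Proof.
move=> Hx a; pose J d := derived br d /\ forall Y, minimal_ideal Y -> forall y, Y y -> br d y = 0.
have brJ b d : (forall Y, minimal_ideal Y -> forall y, Y y -> br d y = 0) ->
    forall Y, minimal_ideal Y -> forall y, Y y -> br (br b d) y = 0.
  move=> Hd Y mY y Yy; have [[_ [_ HY]] _ _ _] := mY.
  have -> : br (br b d) y = br b (br d y) - br d (br b y).
    by rewrite (br_jacobi HL b) addrK.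
  by rewrite !(Hd Y mY) ?(br0r HL) ?subrr //; exact: HY.
have HJ : lideal br J.
  have [sD [_ HD]] := derived_lideal br; split; first split.
  - by split; [exact: subsp0 | move=> Y mY y _; exact: br0l].
  - move=> c d1 d2 [D1 H1] [D2 H2]; split; first exact: (proj2 sD).
    by move=> Y mY y Yy; rewrite (br_linl HL) (H1 Y) // (H2 Y) // scaler0 addr0.
  by split=> // b d _ [Dd Hd]; split; [exact: HD | exact: brJ].
have J0 d : J d -> d = 0.
  move=> Jd; apply: contrapT => /eqP d0.
  have [|Z mZ ZJ] := minimal_exists HJ (fun z => @proj1 _ _); first by exists d.
  have [HZ ZS [z Zz z0] _] := mZ; case/negP: z0; apply/eqP.
  by apply: (abelian_ideal_zero HZ ZS _ Zz) => u v /ZJ[_ Hu] Zv; exact: Hu mZ _ Zv.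
by apply: J0; split; [exact: derived_set_br | exact: brJ].
Qed.
End MinimalIdeals.

(** * The target Lie algebra attached to a minimal ideal *)

Section SubBracket.
Variables (F : fieldType) (V : lmodType F) (bV : V -> V -> V) (Y : V -> Prop).
Hypotheses (HV : lie_axioms bV) (sY : subspace Y) (Ybr : forall x y, Y x -> Y y -> Y (bV x y)).

Definition sub_bracket (a b : sub_lmod (Subsp sY)) : sub_lmod (Subsp sY) :=
  @sl_mk _ _ (Subsp sY) _ (Ybr (sl_valP a) (sl_valP b)).

Lemma sub_lie_axioms : lie_axioms sub_bracket.
Proof.
split=> [c x y z|]; first by apply: sl_inj; rewrite sl_lin /= ?sl_lin (br_linl HV).
split=> [c x y z|]; first by apply: sl_inj; rewrite sl_lin /= ?sl_lin (br_linr HV).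
split=> [x|x y z]; apply: sl_inj; first by rewrite /= (brxx HV) ?sl_0.
have D (u v : sub_lmod (Subsp sY)) : sl_val (u + v) = sl_val u + sl_val v.
  by rewrite -[u]scale1r sl_lin !scale1r.
by rewrite !D sl_0 /=; case: HV => _ [_ [_]].
Qed.

Lemma sub_fin_dim : fin_dim Y -> fin_dim (fun _ : sub_lmod (Subsp sY) => True).
Proof.
move=> [n [v Hv]].
have Yv := fin_dim_generator Hv.
exists n, (fun i => @sl_mk _ _ (Subsp sY) _ (Yv i)) => x; split=> // _.
have [c E] := (Hv (sl_val x)).1 (sl_valP x); exists c; apply: sl_inj.
by rewrite (linear_comb _ _ (@sl_lin _ _ (Subsp sY))).
Qed.
End SubBracket.

Lemma commutator_lie (F : closedFieldType) : lie_axioms (fun a b : emx F => a * b - b * a).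
Proof.
split=> [c x y z|].
  by rewrite mulrDl mulrDr -scalerAl -scalerAr scalerBr opprD addrACA.
split=> [c x y z|].
  by rewrite mulrDl mulrDr -scalerAl -scalerAr scalerBr opprD addrACA.
split=> [x|x y z]; first exact: subrr.
rewrite !mulrBr !mulrBl !mulrA.
have E (t1 t2 t3 t4 t5 t6 : emx F) : t1 - t2 - (t3 - t4) + (t3 - t5 - (t6 - t2)) +
    (t6 - t4 - (t1 - t5)) = 0.
  by rewrite !opprB !addrA (ACl ((1*12)*(2*7)*(3*10)*(4*5)*(6*11)*(8*9)))/= !(subrr, addNr, addr0).
exact: E.
Qed.

Lemma reversal_involution (F : closedFieldType) (L : lmodType F) (br : L -> L -> L)
    (g : L -> emx F) : lie_rep br g -> (forall i j, walg_plus g (eu F i j)) ->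
  ~ degenerate_reversal g -> exists tau : emx F -> emx F,
  [/\ forall a, fin a -> fin (tau a),
      forall c a b, fin a -> fin b -> tau (c *: a + b) = c *: tau a + tau b,
      forall a b, fin a -> fin b -> tau (a * b) = tau b * tau a,
      forall a, fin a -> tau (tau a) = a &
      forall a b, fin a -> (reversal g a b <-> b = tau a)].
Proof.
move=> Hg geu Hs.
have tot a : exists b, fin a -> reversal g a b.
  case: (pselect (fin a)) => [fa|nfa]; last by exists 0.
  by have [b Hb] := reversal_total geu fa; exists b.
have [tau Ht] := choice tot; exists tau.
have uniq_rev := reversal_unique Hs.
have tfin a : fin a -> fin (tau a) by move=> /Ht /(reversal_fin Hg) [].
split=> //.
- move=> c a b fa fb; apply: uniq_rev (Ht _ (proj2 (fin_sub F) c _ _ fa fb)) _.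
  exact: (proj2 (reversal_sub g) c (_, _) (_, _) (Ht a fa) (Ht b fb)).
- move=> a b fa fb; apply: uniq_rev (Ht _ (fin_mull b fa)) _.
  exact: reversalM (Ht a fa) (Ht b fb).
- move=> a fa; apply: uniq_rev (Ht _ (tfin a fa)) _; exact: reversalC (Ht a fa).
- by move=> a b fa; split=> [H|->]; [exact: uniq_rev H (Ht a fa) | exact: Ht].
Qed.

Section Components.
Variables (F : closedFieldType) (charF : [pchar F] =i pred0).
Variables (L : lmodType F) (br : L -> L -> L).
Hypothesis HL : lie_axioms br.
Local Notation R := (emx F).
Variables (f : L -> R) (h : nat -> L -> Prop).
Hypotheses (Hf : lie_rep br f) (finj : injective f).
Hypothesis Hh : forall n, fin_dim (h n) /\ subalg br (h n) /\ reductive br (h n).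
Hypothesis hS : forall n x, h n x -> h n.+1 x.
Hypothesis hall : forall x, exists n, h n x.

(** Preimages of derived elements are required in Y itself: such elements lie in [L, L] and are
    invisible to the components of the other minimal ideals, which makes the final map onto the
    direct sum of derived algebras. *)
Definition component (Y : L -> Prop) : Prop :=
  exists (G : lmodType F) (brG : G -> G -> G) (phi : L -> G),
  [/\ lie_axioms brG,
      is_gl_inf brG \/ is_so_inf brG \/ is_sp_inf brG \/ fd_simple brG &
      [/\ linear phi, forall x y, phi (br x y) = brG (phi x) (phi y),
          forall x, phi x = 0 <-> forall y, Y y -> br x y = 0 &
          forall z, derived brG z -> exists2 x, Y x & phi x = z]].

Variable Y : L -> Prop.
Hypothesis mY : minimal_ideal br Y.

Let HY : lideal br Y. Proof. by case: mY. Qed.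
Let sY : subspace Y. Proof. by case: HY. Qed.
Let YS y : Y y -> derived br y. Proof. by case: mY => _ H _ _; exact: H. Qed.
Let Ymul x y : Y y -> Y (br x y). Proof. by case: HY => _ [_ H]; exact: H. Qed.
Let Ybr x y : Y x -> Y y -> Y (br x y). Proof. by move=> _; exact: Ymul. Qed.
Let Y0 : exists2 y, Y y & y != 0. Proof. by case: mY. Qed.

Lemma minimal_centerless y : Y y -> (forall u, Y u -> br y u = 0) -> y = 0.
Proof.
move=> Yy Hy; apply: contrapT => /eqP y0; have [_ _ _ Ymin] := mY.
pose J y := Y y /\ forall u, Y u -> br y u = 0.
have HJ : lideal br J.
  split; first split.
  - by split; [exact: subsp0 | move=> u _; exact: br0l].
  - move=> c d1 d2 [D1 H1] [D2 H2]; split; first exact: (proj2 sY).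
    by move=> u Yu; rewrite (br_linl HL) H1 // H2 // scaler0 addr0.
  split=> // b d _ [Dd Hd]; split; first exact: Ymul.
  move=> u Yu; have -> : br (br b d) u = br b (br d u) - br d (br b u).
    by rewrite (br_jacobi HL b) addrK.
  by rewrite !Hd ?(br0r HL) ?subrr //; exact: Ymul.
have YJ u : Y u -> J u.
  by move: u; apply: Ymin => // [u []//|]; exists y.
case/negP: y0; apply/eqP.
by apply: (abelian_ideal_zero charF HL Hf finj Hh hS hall HY YS) Yy => a b /YJ[_ Ha]; exact: Ha.
Qed.

(** The y with the same action on Y as x is unique because Y has trivial centre, so x -> y is a
    homomorphism onto Y. As L acts through Y, ideals of Y are ideals of L, and minimality becomes
    simplicity in the finite-dimensional case. *)
Lemma inner_component : (forall x, exists2 y, Y y & forall u, Y u -> br (x - y) u = 0) ->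
  let brG := @sub_bracket _ _ br Y sY Ybr in
  is_so_inf brG \/ is_sp_inf brG \/ fin_dim Y -> component Y.
Proof.
move=> inner brG kind; have LG := sub_lie_axioms HL sY Ybr.
have [pp Hp] := choice (fun x => let: ex_intro2 y Hy E := inner x in
  ex_intro (fun y => Y y /\ forall u, Y u -> br (x - y) u = 0) y (conj Hy E)).
have Yp x : Y (pp x) by case: (Hp x).
have pE x u : Y u -> br x u = br (pp x) u.
  by move=> Yu; apply/eqP; rewrite -subr_eq0 -(brBl HL); case: (Hp x) => _ ->.
have puniq x y : Y y -> (forall u, Y u -> br x u = br y u) -> pp x = y.
  move=> Yy Hy; apply/eqP; rewrite -subr_eq0; apply/eqP/minimal_centerless.
    exact: (subspB sY).
  by move=> u Yu; rewrite (brBl HL) -pE // Hy // subrr.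
have pid y : Y y -> pp y = y by move=> Yy; exact: puniq.
exists (sub_lmod (Subsp sY)), brG, (fun x => @sl_mk _ _ (Subsp sY) _ (Yp x)).
split=> //; last split.
- case: kind => [|[|fY]]; [by right; left | by right; right; left | right; right; right].
  split; first exact: sub_fin_dim.
  split.
    have [y Yy y0] := Y0; apply: contrapT => H; case/negP: y0; apply/eqP.
    apply: (abelian_ideal_zero charF HL Hf finj Hh hS hall HY YS) Yy => a b Ya Yb.
    apply: contrapT => n0; apply: H.
    exists (@sl_mk _ _ (Subsp sY) _ Ya), (@sl_mk _ _ (Subsp sY) _ Yb).
    by move=> /(congr1 (@sl_val _ _ _)); rewrite sl_0.
  move=> J [sJ [_ HJ]]; case: (pselect (forall x, J x -> x = 0)) => [|nz]; [by left|right].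
  have [x0 Jx0 n0] : exists2 x, J x & x <> 0.
    apply: contrapT => H; apply: nz => x Jx; apply: contrapT => n0.
    by apply: H; exists x.
  pose J' y := exists2 x, J x & sl_val x = y.
  have HJ' : lideal br J'.
    split; first split.
    - by exists 0; [exact: subsp0 | exact: sl_0].
    - move=> c _ _ [x Jx <-] [z Jz <-]; exists (c *: x + z); [exact: (proj2 sJ) | exact: sl_lin].
    split=> // a _ _ [x Jx <-]; exists (brG (@sl_mk _ _ (Subsp sY) _ (Yp a)) x); first exact: HJ.
    by rewrite /= -pE //; exact: (sl_valP x).
  have [_ _ _ Ymin] := mY.
  move=> y; have [||x Jx E] := Ymin J' HJ' _ _ _ (sl_valP y).
  - by move=> _ [x _ <-]; exact: (sl_valP x).
  - exists (sl_val x0); first by exists x0.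
    by apply/eqP => E; apply: n0; apply: sl_inj; rewrite sl_0.
  by rewrite -(sl_inj E).
- move=> c x y; apply: sl_inj; rewrite sl_lin /=; apply: puniq.
    exact: (proj2 sY).
  by move=> u Yu; rewrite !(br_linl HL) -!pE.
- move=> x y; apply: sl_inj => /=; apply: puniq; first exact: Ybr.
  have E a b u : br (br a b) u = br a (br b u) - br b (br a u).
    by rewrite (br_jacobi HL a) addrK.
  by move=> u Yu; rewrite !E -!pE //; exact: Ymul.
- move=> x; split=> [/(congr1 (@sl_val _ _ _)) /= E y Yy|H].
    by rewrite pE // E ?sl_0 (br0l HL).
  by apply: sl_inj; rewrite sl_0 /=; apply: puniq; [exact: subsp0 | move=> u Yu; rewrite H // (br0l HL)].
move=> z _; exists (sl_val z); first exact: (sl_valP z).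
by apply: sl_inj => /=; apply: pid; exact: (sl_valP z).
Qed.

(** A primitive e taken from BB f(Y) BB does not kill all of Y, so by minimality the part of Y it
    kills is 0. *)
Lemma minimal_detected : exists e n, [/\ primitive f e n, wideal f Y e &
  forall y, Y y -> killed f e y -> y = 0].
Proof.
have [y0 Yy0 n0] := Y0; have [_ _ _ Ymin] := mY.
have [e [n [pe Ie]]] := primitive_exists charF HL Hf finj Hh hS hall HY YS Yy0 n0.
have [x Yx nk] := primitive_not_killed charF pe Ie.
exists e, n; split=> // y Yy ky; apply: contrapT => /eqP yn0; apply: nk.
have := Ymin _ (ideal_cap HY (killed_ideal Hf e)) (fun z => @proj1 _ _).
by move=> /(_ (ex_intro2 _ _ y (conj Yy ky) yn0) x Yx) [].
Qed.

Lemma matrix_iso g tau (P : (nat -> nat -> F) -> Prop) :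
  lie_rep br g -> (forall y, Y y -> g y = 0 -> y = 0) ->
  (forall y, tau (g y) = - g y) ->
  (forall a, fin a -> tau a = - a -> exists2 y, Y y & g y = a) ->
  matrix_model tau P -> iso_to_mat (@sub_bracket _ _ br Y sY Ybr) P.
Proof.
move=> [lg gbr fg] inj skew surj [Phi [H1 [H2 [H3 [H4 [H5 H6]]]]]].
have PhiB a b i j : Phi (a - b) i j = Phi a i j - Phi b i j.
  by rewrite -scaleN1r addrC H1 mulN1r addrC.
exists (fun y => Phi (g (sl_val y))); split; [split; [|split] | split; [|split]].
- by move=> c x y i j; rewrite sl_lin lg H1.
- by move=> x; exact: H2.
- by move=> x y N Hx Hy i j; rewrite /= gbr PhiB !(H3 _ _ N).
- move=> x y E; apply: sl_inj; apply/eqP; rewrite -subr_eq0; apply/eqP/inj.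
    exact: (subspB sY (sl_valP x) (sl_valP y)).
  rewrite (linear_B lg); apply: H4; first exact: (subspB (fin_sub F)).
  by move=> i j; rewrite PhiB E subrr.
- by move=> x; apply: H5; [exact: fg | exact: skew].
move=> A fA PA; have [a [fa [ta Ha]]] := H6 A fA PA; have [y Yy E] := surj a fa ta.
by exists (@sl_mk _ _ (Subsp sY) _ Yy) => i j; rewrite /= E.
Qed.

Let fin_closed (a b : R) : fin a -> fin b -> fin (a * b - b * a).
Proof. by move=> fa fb; apply: (subspB (fin_sub F)); exact: fin_mull. Qed.

Lemma gl_inf_model : is_gl_inf (@sub_bracket _ _ (fun a b : R => a * b - b * a) _ (fin_sub F) fin_closed).
Proof.
exists (fun y => ent (sl_val y)); split; [split; [|split] | split; [|split]].
- by move=> c x y i j; rewrite sl_lin ent_lin.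
- by move=> x; have [N [_ HN]] := fin_bounded (sl_valP x); exists N.
- move=> x y N Hx Hy i j; have fx := sl_valP x; have fy := sl_valP y.
  by rewrite /= entB (ent_mull _ _ (conj fx Hx) fy) (ent_mull _ _ (conj fy Hy) fx).
- by move=> x y E; apply: sl_inj; apply: ent_ext; [exact: (sl_valP x) | exact: (sl_valP y) | rewrite E].
- by [].
move=> A fA _; have [a fa E] := fin_mx fA.
by exists (@sl_mk _ _ (Subsp (fin_sub F)) _ fa) => i j; rewrite /= E.
Qed.

Theorem minimal_component : component Y.
Proof.
have [e [n [pe _ inj]]] := minimal_detected.
case: (primitive_dichotomy charF Hf pe) => [[D [th [lth Hth]]]|[g [Hg Hk geu]]].
  have fY : fin_dim Y.
    by apply: (fin_dim_of_injective sY lth) => y Yy Hy; apply: inj => //; apply/Hth.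
  apply: inner_component; last by right; right.
  have [lf fbr ff] := Hf; move=> x.
  have ltr v : linear (fun w => tr (f v * f w) : F^o).
    by move=> a u w; rewrite lf mulrDr -scalerAr linearP.
  have ltl w : linear (fun v => tr (f v * f w) : F^o).
    by move=> a u v; rewrite lf mulrDl -scalerAl linearP.
  (* y is the orthogonal projection of x to Y for the trace form. By invariance [x - y, u] is
     orthogonal to Y for u in Y, hence 0. *)
  have [|y Yy Hy] := @represent_functional F L Y (fun u w => tr (f u * f w))
      (fun w => tr (f x * f w)) fY ltr ltl (ltr x).
    move=> w Yw Hw; have -> : f w = 0; last by rewrite mulr0 linear0.
    apply: (rep_nondegenerate charF HL Hf finj Hh hS hall Hf HY YS Yw) => u Yu.
    by rewrite trC; exact: Hw.
  exists y => // u Yu; apply: finj; rewrite (linear_0 lf).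
  apply: (rep_nondegenerate charF HL Hf finj Hh hS hall Hf HY YS (Ymul _ Yu)) => w Yw.
  have -> : tr (f (br (x - y) u) * f w) = tr (f (x - y) * f (br u w)).
    rewrite !fbr mulrBl mulrBr !linearB /= !mulrA.
    have -> : tr (f u * f (x - y) * f w) = tr (f (x - y) * f w * f u).
      by rewrite -[f u * _ * _]mulrA [LHS]trC.
    by [].
  by rewrite (linear_B (ltl _)) Hy ?subrr //; exact: Ymul.
have [lg gbr fg] := Hg.
have ginj y : Y y -> g y = 0 -> y = 0 by move=> Yy /Hk; exact: inj.
have Yg : exists2 y, Y y & g y != 0.
  by have [y Yy y0] := Y0; exists y => //; apply: contraNneq y0 => /(ginj y Yy) ->.
case: (pselect (degenerate_reversal g)) => Hs.
  have Hsurj := degenerate_image charF HL Hf finj Hh hS hall Hg geu HY YS Yg Hs.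
  exists (sub_lmod (Subsp (fin_sub F))),
    (@sub_bracket _ _ (fun a b : R => a * b - b * a) _ (fin_sub F) fin_closed),
    (fun x => @sl_mk _ _ (Subsp (fin_sub F)) _ (fg x)); split.
  - exact: sub_lie_axioms (commutator_lie F) _ _.
  - by left; exact: gl_inf_model.
  split.
  - by move=> c x y; apply: sl_inj; rewrite sl_lin /= lg.
  - by move=> x y; apply: sl_inj; rewrite /= gbr.
  - move=> x; split=> [/(congr1 (@sl_val _ _ _)) /= E y Yy|H].
      apply: inj; first exact: Ymul.
      refine (@ideal_brl _ _ _ HL (killed f e) x y (killed_ideal Hf e) _).
      by apply/Hk; rewrite E ?sl_0.
    apply: sl_inj; rewrite sl_0 /=.
    (* If x centralizes Y, then g(x) commutes with all off-diagonal matrix units, so it is diagonal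
       with equal entries; being finitary, it is 0. *)
    have comm i j : i != j -> g x * eu F i j = eu F i j * g x.
      move=> ij; have [||y Yy <-] := Hsurj (eu F i j) => //.
        rewrite (trE_fsupp (proj2 (@bounded_eu F (maxn i j).+1 i j _ _))) ?ltnS ?leq_maxl ?leq_maxr //.
        rewrite big1 // => k _; rewrite ent_eu; case: (eqVneq (k : nat) i) => [->|] //=.
        by rewrite (negPf ij).
      by apply/eqP; rewrite -subr_eq0 -gbr H // (linear_0 lg).
    have off k i : k != i -> ent (g x) k i = 0.
      move=> ki; have ij : i != (maxn k i).+1 by rewrite ltn_eqF // ltnS leq_maxr.
      have := congr1 (fun a => ent a k (maxn k i).+1) (comm _ _ ij).
      by rewrite /= ent_eur // ent_eul // eqxx mulr1 (negPf ki) mul0r.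
    have diag i j : i != j -> ent (g x) i i = ent (g x) j j.
      move=> ij; have := congr1 (fun a => ent a i j) (comm _ _ ij).
      by rewrite /= ent_eur // ent_eul // !eqxx mulr1 mul1r.
    have [N [_ HN]] := fin_bounded (fg x).
    apply: ent_ext => // i j; rewrite ent0; have [<-|/off//] := eqVneq i j.
    rewrite (diag i (maxn i N).+1) ?HN //; first by left; rewrite leqW // leq_maxr.
    by rewrite ltn_eqF // ltnS leq_maxl.
  move=> z Dz; have tz : tr (sl_val z) = 0.
    move: z Dz; apply: derived_set_min => [|a b _ _].
      apply: (@preim_subspace F F^o _ (fun t => t = 0)
        (fun z : sub_lmod (Subsp (fin_sub F)) => tr (sl_val z))) => [a x y|].
        by rewrite sl_lin linearP.
      by split=> // a x y -> ->; rewrite scaler0 addr0.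
    by rewrite /= linearB /= trC subrr.
  have [y Yy E] := Hsurj (sl_val z) (sl_valP z) tz.
  by exists y => //; apply: sl_inj.
have [tau [t1 t2 t3 t4 t5]] := reversal_involution Hg geu Hs.
have gskew y : tau (g y) = - g y by symmetry; apply/t5 => //; exact: reversal_rep.
have Hsurj a : fin a -> tau a = - a -> exists2 y, Y y & g y = a.
  move=> fa ta; apply: (skew_image charF HL Hf finj Hh hS hall Hg geu HY YS Yg Hs).
  by apply/t5.
have iso P := @matrix_iso g tau P Hg ginj gskew Hsurj.
apply: inner_component.
  (* g(x) is skew for every x in L, so it already occurs as g(y) with y in Y; then x - y is killed
     by e and acts trivially on Y. *)
  move=> x; have [y Yy E] := Hsurj (g x) (fg x) (gskew x); exists y => // u Yu.
  apply: inj; first exact: Ymul.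
  refine (@ideal_brl _ _ _ HL (killed f e) _ u (killed_ideal Hf e) _).
  by apply/Hk; rewrite (linear_B lg) E subrr.
by case: (involution_model charF t1 t2 t3 t4) => /iso; [left | right; left].
Qed.
End Components.

(** * Assembly *)

Section FiniteClass.
Variable I : Type.

Definition finite_class (P : I -> Prop) : Prop :=
  exists n (idx : 'I_n -> I), forall i, P i -> exists k, idx k = i.

Lemma finite_class_bound D (P : I -> Prop) :
  (forall idx : 'I_D -> I, injective idx -> (forall k, P (idx k)) -> False) -> finite_class P.
Proof.
elim: D P => [|D IH] P HP.
  by case: (HP (fun k : 'I_0 => False_rect I (notF (ltn_ord k)))); case.
case: (pselect (exists i, P i)) => [[i0 Pi0]|H]; last first.
  exists 0%N, (fun k : 'I_0 => False_rect I (notF (ltn_ord k))) => i Pi.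
  by case: H; exists i.
have [|n [idx Hidx]] := IH (fun i => P i /\ i <> i0).
  move=> idx inj Hidx.
  apply: (HP (fun k => if unlift ord0 k is Some j then idx j else i0)).
    move=> k l; case: unliftP => [j ->|->]; case: unliftP => [m ->|->] //.
    - by move=> /inj ->.
    - by move=> E; case: (Hidx j) => _; case.
    - by move=> E; case: (Hidx m) => _; case.
  by move=> k; case: unliftP => [j _|_] //; case: (Hidx j).
exists n.+1, (fun k => if unlift ord0 k is Some j then idx j else i0) => i Pi.
case: (pselect (i = i0)) => [->|ni]; first by exists ord0; rewrite unlift_none.
by have [k Ek] := Hidx i (conj Pi ni); exists (lift ord0 k); rewrite liftK.
Qed.

Lemma finite_class_bigcup k (P : nat -> I -> Prop) :
  (forall j, (j < k)%N -> finite_class (P j)) -> finite_class (fun i => exists2 j, (j < k)%N & P j i).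
Proof.
elim: k => [|k IH] HP.
  by exists 0%N, (fun k : 'I_0 => False_rect I (notF (ltn_ord k))) => i [].
have [n [idx Hidx]] := IH (fun j jk => HP j (ltnW jk)).
have [m [idy Hidy]] := HP k (ltnSn k).
exists (n + m)%N, (fun l => match fintype.split l with inl a => idx a | inr b => idy b end).
move=> i [j]; rewrite ltnS leq_eqVlt => /orP[/eqP-> /Hidy [b <-]|jk Pj].
  by exists (rshift n b); rewrite (unsplitK (inr b)).
have [|a <-] := Hidx i; first by exists j.
by exists (lshift m a); rewrite (unsplitK (inl a)).
Qed.
End FiniteClass.

Section Projection.
Variables (F : fieldType) (V : lmodType F) (u : nat -> V) (C D : V -> Prop).
Hypotheses (spanu : forall v, exists K (c : nat -> F), v = \sum_(k < K) c k *: u k).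
Hypotheses (sC : subspace C) (sD : subspace D) (CD : forall v, C v -> D v -> v = 0).

Lemma projection_exists : exists p : V -> V, [/\ linear p, forall v, C (p v),
  forall v, D v -> p v = 0 & forall v, C v -> p v = v].
Proof.
pose add (E : V -> Prop) k v := exists a d, E d /\ v = a *: u k + d.
(* D is enlarged along the spanning sequence: u_k is adjoined whenever the result still meets C only
   in 0. If it is refused, some nonzero a u_k + d lies in C with a nonzero, so u_k is already in C
   plus the enlarged D. *)
pose Dk := fix Dk k : V -> Prop := if k is k'.+1 then
  if pselect (forall v, C v -> add (Dk k') k' v -> v = 0) is left _ then add (Dk k') k' else Dk k'
  else D.
have inv k : subspace (Dk k) /\ forall v, C v -> Dk k v -> v = 0.
  elim: k => [|k [sE CE]] //=; case: pselect => // H; split=> //.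
  split; first by exists 0, 0; rewrite scale0r addr0; split=> //; exact: subsp0.
  move=> c _ _ [a [d [Ed ->]]] [a' [d' [Ed' ->]]]; exists (c * a + a'), (c *: d + d').
  split; first exact: (proj2 sE).
  by rewrite scalerDr scalerA scalerDl addrACA.
have step k v : Dk k v -> Dk k.+1 v.
  move=> Ev /=; case: pselect => // _.
  by exists 0, v; rewrite scale0r add0r.
have mono k l v : (k <= l)%N -> Dk k v -> Dk l v.
  by move=> /subnK <-; elim: (l - k)%N => // j IH /IH; exact: step.
pose W v := exists k, Dk k v.
have sW : subspace W.
  split; first by exists 0%N; exact: (subsp0 sD).
  move=> c x y [k Hx] [l Hy]; exists (maxn k l); apply: (proj2 (proj1 (inv _))).
    by apply: mono Hx; exact: leq_maxl.
  by apply: mono Hy; exact: leq_maxr.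
have CW v : C v -> W v -> v = 0 by move=> Cv [k]; exact: (proj2 (inv k)).
have total v : exists2 c, C c & W (v - c).
  have [K [c ->]] := spanu v.
  suff H : subspace (fun v => exists2 c, C c & W (v - c)).
    apply: (subsp_comb H) => k; have [_ CE] := inv k.
    case: (pselect (forall v, C v -> add (Dk k) k v -> v = 0)) => Hk.
      exists 0; first exact: (subsp0 sC).
      exists k.+1; rewrite /= subr0; case: pselect => // _.
      exists 1, 0; rewrite scale1r addr0; split=> //; exact: (subsp0 (proj1 (inv k))).
    have [w [Cw [a [d [Ed Ew]]] nw]] : exists w, [/\ C w, add (Dk k) k w & w <> 0].
      apply: contrapT => H'; apply: Hk => w Cw Aw; apply: contrapT => nw.
      by apply: H'; exists w.
    have a0 : a != 0.
      apply/negP => /eqP a0; apply: nw; apply: CE => //.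
      by rewrite Ew a0 scale0r add0r.
    exists (a^-1 *: w); first exact: (subspZ sC).
    rewrite Ew scalerDr scalerA mulVf // scale1r opprD addrA subrr add0r.
    by apply: (subspN sW); apply: (subspZ sW); exists k.
  split; first by exists 0; [exact: subsp0 | rewrite subr0; exact: subsp0].
  move=> a x y [c1 Cc1 W1] [c2 Cc2 W2]; exists (a *: c1 + c2); first exact: (proj2 sC).
  rewrite (_ : _ - _ = a *: (x - c1) + (y - c2)); first exact: (proj2 sW).
  by rewrite scalerBr opprD addrACA.
have [p Hp] := choice (fun v => let: ex_intro2 c Cc Wc := total v in
  ex_intro (fun c => C c /\ W (v - c)) c (conj Cc Wc)).
have puniq v c : C c -> W (v - c) -> p v = c.
  move=> Cc Wc; have [Cp Wp] := Hp v; apply/eqP; rewrite -subr_eq0; apply/eqP/CW.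
    exact: (subspB sC).
  by rewrite (_ : p v - c = (v - c) - (v - p v)); [exact: (subspB sW) | rewrite opprB [RHS]addrC addrA subrK].
exists p; split.
- move=> a x y; have [Cx Wx] := Hp x; have [Cy Wy] := Hp y; apply: puniq.
    exact: (proj2 sC).
  rewrite (_ : _ - _ = a *: (x - p x) + (y - p y)); first exact: (proj2 sW).
  by rewrite scalerBr opprD addrACA.
- by move=> v; case: (Hp v).
- by move=> v Dv; apply: puniq; [exact: subsp0 | rewrite subr0; exists 0%N].
by move=> v Cv; apply: puniq => //; rewrite subrr; exact: subsp0.
Qed.
End Projection.

Section MinimalFiniteness.
Variables (F : closedFieldType) (charF : [pchar F] =i pred0).
Variables (L : lmodType F) (br : L -> L -> L).
Hypothesis HL : lie_axioms br.
Local Notation R := (emx F).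
Variables (f : L -> R) (h : nat -> L -> Prop).
Hypotheses (Hf : lie_rep br f) (finj : injective f).
Hypothesis Hh : forall n, fin_dim (h n) /\ subalg br (h n) /\ reductive br (h n).
Hypothesis hS : forall n x, h n x -> h n.+1 x.
Hypothesis hall : forall x, exists n, h n x.

Local Notation M := {Y : L -> Prop | minimal_ideal br Y}.

Lemma minimal_meet (i j : M) y : sval i y -> sval j y -> y != 0 -> i = j.
Proof.
case: i j => [Y mY] [Z mZ] /= Yy Zy y0.
have [HY _ _ Ymin] := mY; have [HZ _ _ Zmin] := mZ.
have YZ u : Y u -> Z u.
  have := Ymin _ (ideal_cap HY HZ) (fun v => @proj1 _ _).
  by move=> /(_ (ex_intro2 _ _ y (conj Yy Zy) y0)) H /H [].
have ZY u : Z u -> Y u.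
  have := Zmin _ (ideal_cap HY HZ) (fun v => @proj2 _ _).
  by move=> /(_ (ex_intro2 _ _ y (conj Yy Zy) y0)) H /H [].
have E : Y = Z by apply/funext => u; apply/propext; split; [exact: YZ | exact: ZY].
by move: mY mZ; rewrite E => mY mZ; congr exist; exact: Prop_irrelevance.
Qed.

Lemma minimal_commute (i j : M) a b : i <> j -> sval i a -> sval j b -> br a b = 0.
Proof.
move=> ij Ya Zb; apply: contrapT => /eqP n0; apply: ij; apply: minimal_meet n0.
  by apply: ideal_brl => //; case: (svalP i).
by case: (svalP j) => -[_ [_ H]] _ _ _; exact: H.
Qed.

(** When e gives finite codimension D, a dependency among D + 1 detected elements of distinct
    minimal ideals, bracketed with one ideal, isolates a single term, which must then be central in
    its ideal, hence 0. In the infinite case two distinct ideals would commute and have the same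
    image, so the second would be killed. *)
Lemma detected_finite e n : primitive f e n ->
  finite_class (fun i : M => exists2 y, sval i y & ~ killed f e y).
Proof.
move=> pe; have kI := killed_ideal Hf e; have sk := ideal_subspace kI.
have inj (i : M) : (exists2 y, sval i y & ~ killed f e y) ->
    forall y, sval i y -> killed f e y -> y = 0.
  move=> [y Yy nk] z Yz kz; apply: contrapT => /eqP z0; apply: nk.
  have [HY _ _ Ymin] := svalP i.
  have := Ymin _ (ideal_cap HY kI) (fun v => @proj1 _ _).
  by move=> /(_ (ex_intro2 _ _ z (conj Yz kz) z0) y Yy) [].
case: (primitive_dichotomy charF Hf pe) => [[D [th [lth Hth]]]|[g [Hg Hk geu]]].
  apply: (@finite_class_bound _ D.+1) => idx idx_inj Hidx.
  have [u Hu] := choice (fun k => let: ex_intro2 y Yy nk := Hidx k in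
    ex_intro (fun y => sval (idx k) y /\ ~ killed f e y) y (conj Yy nk)).
  have [c [j cj] Hc] := dependent u (ltnSn D) lth.
  have kc : killed f e (\sum_j c j *: u j) by apply/Hth.
  have [Yu nk] := Hu j; apply: nk.
  have -> : u j = 0; last exact: (subsp0 sk).
  apply: (minimal_centerless charF HL Hf finj Hh hS hall (svalP (idx j)) Yu) => v Yv.
  have [HY _ _ _] := svalP (idx j).
  apply: (inj _ (Hidx j)); first exact: ideal_brl.
  have -> : br (u j) v = (c j)^-1 *: br (\sum_j c j *: u j) v.
    rewrite (linear_comb _ _ (br_linl HL v)) (bigD1 j) //= big1 ?addr0.
      by rewrite scalerA mulVf // scale1r.
    move=> k kj; rewrite (@minimal_commute (idx k) (idx j)) ?scaler0 //; last by case: (Hu k).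
    by move=> /idx_inj E; rewrite E eqxx in kj.
  by apply: (subspZ sk); exact: (@ideal_brl _ _ _ HL (killed f e) _ v kI kc).
apply: (@finite_class_bound _ 2) => idx idx_inj Hidx; have [lg gbr fg] := Hg.
pose i0 : 'I_2 := ord0; pose i1 : 'I_2 := ord_max.
have [HY0 YS0 _ _] := svalP (idx i0); have [HY1 YS1 _ _] := svalP (idx i1).
have [y1 Yy1] := Hidx i1; case; apply/Hk.
have [x0 Yx0 nk0] := Hidx i0.
have G0 : exists2 x, sval (idx i0) x & g x != 0.
  by exists x0 => //; apply/negP => /eqP/Hk.
have := ideal_perfect charF HL Hf finj Hh hS hall HY1 YS1 Yy1.
move: y1 {Yy1}; apply: derived_set_min.
  by apply: (@preim_subspace F R L (fun t => t = 0) g lg); split=> // a x y -> ->; rewrite scaler0 addr0.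
move=> a b Ya Yb.
have [x Yx E] := image_constant charF HL Hf finj Hh hS hall Hg geu HY0 YS0 G0 (YS1 _ Ya).
rewrite gbr -E -gbr (@minimal_commute (idx i0) (idx i1)) ?(linear_0 lg) //.
by move=> /idx_inj.
Qed.

(** If x acts nontrivially on a minimal ideal, the primitive e' of that ideal does not kill x, so it
    is equivalent to a member e_j of the maximal family of x. Then e_j does not kill the ideal, and
    each e_j detects finitely many. *)
Lemma minimal_finite x : finite_class (fun i : M => exists2 y, sval i y & br x y <> 0).
Proof.
have [k [e [[He _ _] Hmax]]] := maximal_family charF Hf x.
have [|n [idx Hidx]] := @finite_class_bigcup M k
    (fun j i => exists2 y, sval i y & ~ killed f (e j) y).
  by move=> j jk; have [n pe] := He j jk; exact: detected_finite pe.
exists n, idx => i [y Yy n0]; apply: Hidx.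
have [e' [n' [pe' Ie' inj']]] := minimal_detected charF HL Hf finj Hh hS hall (svalP i).
have [[_ [_ HY]] _ _ _] := svalP i.
have [|j jk nin] := Hmax e' n' pe'.
  move=> kx; apply: n0; apply: inj'; first exact: HY.
  exact: (@ideal_brl _ _ _ HL (killed f e') x y (killed_ideal Hf e')).
exists j => //; apply: contrapT => H; apply: nin => a b Wa Wb.
apply: wideal_killed Ie' Wa Wb => z Yz; apply: contrapT => nk.
by apply: H; exists z.
Qed.

(** The intersection of the centre with [L, L] is an abelian ideal inside [L, L], hence 0. So the
    centre has a complement containing [L, L]. *)
Lemma center_projection : exists p : L -> L, [/\ linear p, forall x, center br (p x),
  forall x, derived br x -> p x = 0 & forall x, center br x -> p x = x].
Proof.
have [lf fbr ff] := Hf.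
have [||u _ Hu] := @countable_spanned F L (fun _ => True) f _ lf; [by split | by move=> p _ |].
apply: (@projection_exists F L u).
- by move=> v; have [K [c /finj E]] := Hu v I; exists K, c.
- by split=> [y|a x y Hx Hy z]; rewrite ?(br0r HL) // (br_linr HL) Hx Hy scaler0 addr0.
- exact: derived_set_subspace.
move=> v Cv Dv; apply: contrapT => /eqP v0.
pose J y := center br y /\ derived br y.
have HJ : lideal br J.
  split; first split.
  - by split; [move=> y; exact: br0r | exact: (subsp0 (derived_set_subspace _ _))].
  - move=> a x y [Cx Dx] [Cy Dy]; split; last exact: (proj2 (derived_set_subspace _ _)).
    by move=> z; rewrite (br_linr HL) Cx Cy scaler0 addr0.
  split=> // x y _ [Cy Dy]; rewrite Cy; split; first by move=> z; exact: br0r.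
  exact: (subsp0 (derived_set_subspace _ _)).
case/negP: v0; apply/eqP.
by apply: (abelian_ideal_zero charF HL Hf finj Hh hS hall HJ (fun y => @proj2 _ _) _ (conj Cv Dv)) => a b _ [Cb _].
Qed.
End MinimalFiniteness.

Lemma finitary_rep (F : closedFieldType) (L : lmodType F) (br : L -> L -> L) :
  finitary br -> exists2 f : L -> emx F, lie_rep br f & injective f.
Proof.
move=> [f0 [[lf [ff fbr]] inj]].
have [f Hf] := choice (fun x => let: ex_intro2 a fa Ea := fin_mx (ff x) in
   ex_intro (fun a => fin a /\ ent a = f0 x) a (conj fa Ea)).
have fE x i j : ent (f x) i j = f0 x i j by case: (Hf x) => _ ->.
have fin_f x : fin (f x) by case: (Hf x).
exists f; last by move=> x y E; apply: inj; have [_ <-] := Hf x; have [_ <-] := Hf y; rewrite E.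
split=> // [a x y|x y].
  apply: ent_ext => //; first exact: (proj2 (fin_sub F)).
  by move=> i j; rewrite ent_lin !fE lf.
apply: ent_ext => //; first by apply: (subspB (fin_sub F)); exact: fin_mull.
move=> i j; have [N HN] := fin_bounded (fin_f x); have [N' HN'] := fin_bounded (fin_f y).
have bx := bounded_le (leq_maxl N N') HN; have by_ := bounded_le (leq_maxr N N') HN'.
have sx : fsupp_lt (maxn N N') (f0 x) by move=> k l /(proj2 bx) <-; rewrite fE.
have sy : fsupp_lt (maxn N N') (f0 y) by move=> k l /(proj2 by_) <-; rewrite fE.
rewrite fE (fbr x y _ sx sy) entB (ent_mull _ _ bx (fin_f y)) (ent_mull _ _ by_ (fin_f x)).
by rewrite /mmul; congr (_ - _); apply: eq_bigr => k _; rewrite !fE.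
Qed.
Lemma component_family (F : closedFieldType) (L : lmodType F) (br : L -> L -> L)
    (I : Type) (Y : I -> L -> Prop) : (forall i, component br (Y i)) ->
  exists (G : I -> lmodType F) (brG : forall i, G i -> G i -> G i) (phi : forall i, L -> G i),
  forall i, [/\ lie_axioms (brG i),
      is_gl_inf (brG i) \/ is_so_inf (brG i) \/ is_sp_inf (brG i) \/ fd_simple (brG i) &
      [/\ linear (phi i), forall x y, phi i (br x y) = brG i (phi i x) (phi i y),
          forall x, phi i x = 0 <-> forall y, Y i y -> br x y = 0 &
          forall z, derived (brG i) z -> exists2 x, Y i x & phi i x = z]].
Proof.
move=> comp; exists (fun i => sval (cid (comp i))).
exists (fun i => sval (cid (svalP (cid (comp i))))).
exists (fun i => sval (cid (svalP (cid (svalP (cid (comp i))))))).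
by move=> i; exact: (svalP (cid (svalP (cid (svalP (cid (comp i))))))).
Qed.

Theorem theorem4p5 (F : closedFieldType) (charF : [pchar F] =i pred0)
  (L : lmodType F) (br : L -> L -> L)
  (HL : lie_axioms br) (Hfin : finitary br) (Hred : union_of_reductive br) :
  exists (I : Type) (G : I -> lmodType F) (brG : forall i, G i -> G i -> G i),
    (forall i, lie_axioms (brG i)) /\
    (forall i, is_gl_inf (brG i) \/ is_so_inf (brG i) \/ is_sp_inf (brG i)
               \/ fd_simple (brG i)) /\
    exists (phi0 : L -> L) (phi : forall i, L -> G i),
      (* phi = (phi0, (phi i)_i) : g -> z(g) (+) (+)_i g_i is a Lie algebra hom *)
      (forall x, center br (phi0 x)) /\
      (forall a x y, phi0 (a *: x + y) = a *: phi0 x + phi0 y) /\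
      (forall x y, phi0 (br x y) = 0) /\
      (forall i a x y, phi i (a *: x + y) = a *: phi i x + phi i y) /\
      (forall i x y, phi i (br x y) = brG i (phi i x) (phi i y)) /\
      (forall x, exists n (idx : 'I_n -> I),
          forall i, (forall k, idx k <> i) -> phi i x = 0) /\
      (* injective *)
      (forall x, phi0 x = 0 -> (forall i, phi i x = 0) -> x = 0) /\
      (* identity on the center, onto the summand z(g) *)
      (forall z, center br z -> phi0 z = z /\ forall i, phi i z = 0) /\
      (* phi([g,g]) = (+)_i [g_i, g_i] *)
      (forall x, derived br x -> phi0 x = 0 /\ forall i, derived (brG i) (phi i x)) /\
      (forall y : forall i, G i,
          (exists n (idx : 'I_n -> I), forall i, (forall k, idx k <> i) -> y i = 0) ->
          (forall i, derived (brG i) (y i)) ->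
          exists x, derived br x /\ forall i, phi i x = y i).
Proof.
have [f Hf finj] := finitary_rep Hfin.
have [h [Hh [hS hall]]] := Hred.
pose I := {Y : L -> Prop | minimal_ideal br Y}.
have [G [brG [phi Hphi]]] := component_family
  (fun i : I => minimal_component charF HL Hf finj Hh hS hall (svalP i)).
have [p0 [lp0 Cp0 Dp0 p0C]] := center_projection charF HL Hf finj Hh hS hall.
have phil i : linear (phi i) by case: (Hphi i) => _ _ [].
have phibr i x y : phi i (br x y) = brG i (phi i x) (phi i y) by case: (Hphi i) => _ _ [].
have phi0P i x : phi i x = 0 <-> forall y, sval i y -> br x y = 0.
  by case: (Hphi i) => _ _ [].
exists I, G, brG; split; first by move=> i; case: (Hphi i).
split; first by move=> i; case: (Hphi i).
exists p0, phi; do 2 (split=> //).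
split; first by move=> x y; apply: Dp0; exact: derived_set_br.
split; first by move=> i; exact: phil.
split; first exact: phibr.
split.
  move=> x; have [n [idx Hidx]] := minimal_finite charF HL Hf finj Hh hS hall x.
  exists n, idx => i Hi; apply/phi0P => y Yy; apply: contrapT => n0.
  by have [|k /Hi] := Hidx i; first by exists y.
split.
  move=> x p0x phix; rewrite -p0x p0C //.
  apply: (commutes_minimal_central charF HL Hf finj Hh hS hall) => Y mY y Yy.
  by apply: (proj1 (phi0P (exist _ Y mY) x)) => //; exact: phix.
split.
  move=> z Cz; split; first exact: p0C.
  by move=> i; apply/phi0P => y _; rewrite (br_anti HL) Cz oppr0.
split.
  move=> x Dx; split; first exact: Dp0.
  move=> i; move: x Dx.
  apply: (@derived_set_min _ _ br _ (fun x => derived (brG i) (phi i x))) => [|a b _ _].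
    by apply: (preim_subspace (phil i)); exact: derived_set_subspace.
  by rewrite phibr; exact: derived_set_br.
move=> y [n [idx Hidx]]; elim: n idx y Hidx => [|n IH] idx y Hidx Dy.
  exists 0; split; first exact: (subsp0 (derived_set_subspace _ _)).
  by move=> i; rewrite (linear_0 (phil i)) Hidx // => -[].
pose i0 := idx ord0.
(* The whole component at [i0] is set to 0, since the list of indices may contain [i0] again; that
   component is then supplied by an element z of the minimal ideal [i0], which commutes with the
   other minimal ideals. *)
pose y' i : G i := if pselect (i = i0) is left _ then 0 else y i.
have [||x [Dx Hx]] := IH (fun k => idx (lift ord0 k)) y'.
- move=> i Hi; rewrite /y'; case: pselect => // ni; apply: Hidx => k.
  by case: (unliftP ord0 k) => [j ->|-> /esym].
- move=> i; rewrite /y'; case: pselect => // _; exact: (subsp0 (derived_set_subspace _ _)).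
have [z Yz Ez] : exists2 z, sval i0 z & phi i0 z = y i0.
  by case: (Hphi i0) => _ _ [_ _ _]; apply; exact: Dy.
exists (x + z); split.
  apply: (subspD (derived_set_subspace _ _)) => //.
  by case: (svalP i0) => _ YS _ _; exact: YS.
move=> i; rewrite (linear_D (phil i)) Hx /y'; case: pselect => [ei|ni].
  by subst i; rewrite add0r.
rewrite (_ : phi i z = 0) ?addr0 //; apply/phi0P => u Yu.
exact: (minimal_commute HL (not_eq_sym ni) Yz Yu).
Qed.
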